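(* Let $X=\{X_t,\ t\in\mathbb R\}$ be a measurable process with stationary increments, with $X_0=0$, such that (i) $X\in\mathcal R_m([0,1],L^0(\Omega,P))$; (ii) $E\log^+\left|\int_0^1 e^tX_t\,dt\right|<\infty$; (iii) $E\log^+|X_1|<\infty$. Then $$Y_t=X_t-\int_{-\infty}^t e^{-(t-s)}X_s\,ds,\qquad t\in\mathbb R,$$ is a well-defined, stationary, stochastically continuous process such that $Y\in\mathcal R_m([s,t],L^0(\Omega,P))$ for every $s<t$, and $$X_t=Y_t-Y_0+\int_0^tY_u\,du,\qquad t\in\mathbb R.\qquad( * )$$ Conversely, if $Y=\{Y_t,\ t\in\mathbb R\}$ is a stationary process with $Y\in\mathcal R_m([s,t],L^0(\Omega,P))$ for every $s<t$, then $( * )$ defines a process $X$ with stationary increments and $X_0=0$.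
   Context: A process $\{X_t,t\in\mathbb R\}$ has stationary increments if for every $h\in\mathbb R$ the families $\{X_{t+h}-X_{s+h}:t,s\in\mathbb R\}$ and $\{X_t-X_s:t,s\in\mathbb R\}$ have the same finite-dimensional distributions. A process $Y$ is stationary if $\{Y_{t+\tau}\}_t$ and $\{Y_t\}_t$ have the same finite-dimensional distributions for every $\tau$. A process is measurable if it is jointly measurable in $(t,\omega)$; it is stochastically continuous if $t\mapsto Y_t$ is continuous in probability. $L^0(\Omega,P)$ is the space of random variables with the topology of convergence in probability, given by the F-norm $\|y\|=E\min(|y|,1)$. $D^-[a,b]$ is the space of all left-continuous functions $\phi:[a,b]\to\mathbb R$ having right-hand limits. A curve $X:[a,b]\to L^0(\Omega,P)$ belongs to $\mathcal R_m([a,b],L^0(\Omega,P))$ if for every $\phi\in D^-[a,b]$ the Riemann integral $\int_a^b\phi(t)X_t\,dt$ exists as the limit in probability of the Riemann sums $\sum_j\phi(\xi_j)X_{\xi_j}(t_j-t_{j-1})$, $\xi_j\in[t_{j-1},t_j]$, as the mesh of the partition tends to $0$. All integrals over bounded intervals are Riemann integrals in this sense, with $\int_0^t=-\int_t^0$ for $t<0$; the integral over $(-\infty,t]$ is the almost sure limit of the integrals over $[-n,t]$ as $n\to\infty$ ($n$ integer). $\log^+x=\max(\log x,0)$. *)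

(* Defs.v *)
From HB Require Import structures.
From mathcomp Require Import all_boot all_order all_algebra.
From mathcomp Require Import all_classical all_reals all_analysis.

Set Implicit Arguments.
Unset Strict Implicit.
Unset Printing Implicit Defensive.

Import Order.TTheory GRing.Theory Num.Theory.
Import numFieldNormedType.Exports.

Local Open Scope classical_set_scope.
Local Open Scope ring_scope.

(* [ln] is total with [ln 0 = 0], so [logp 0 = 0] agrees with the convention
   log^+ 0 = max(-oo, 0). *)
Definition logp (R : realType) (x : R) : R := Num.max (ln x) 0.

Section Functions.
Context {R : realType}.

(* D^-[a, b]; only the values of [phi] on [a, b] matter. *)
Definition Dminus (a b : R) (phi : R -> R) : Prop :=
  (forall x, a < x <= b -> phi y @[y --> x^'-] --> phi x) /\
  (forall x, a <= x < b -> cvg (phi y @[y --> x^'+])).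

(* In the following three definitions the partition t_0 = a < ... < t_m = b is
   [a :: s] with [itv_partition a b s], so that t_j is [nth b (a :: s) j], and
   the tag of the interval [t_j, t_(j+1)] is [xi j]. *)
Definition tags (a b : R) (s : seq R) (xi : nat -> R) : Prop :=
  forall j, (j < size s)%N ->
    nth b (a :: s) j <= xi j <= nth b (a :: s) j.+1.

Definition mesh_lt (a b : R) (s : seq R) (delta : R) : Prop :=
  forall j, (j < size s)%N ->
    nth b (a :: s) j.+1 - nth b (a :: s) j < delta.

Definition Riemann_sum (f : R -> R) (a b : R) (s : seq R) (xi : nat -> R) : R :=
  \sum_(0 <= j < size s)
    f (xi j) * (nth b (a :: s) j.+1 - nth b (a :: s) j).

End Functions.

Section Processes.
Context {R : realType} {d : measure_display} {Omega : measurableType d}.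
Variable P : probability Omega R.

Definition Fnorm (y : Omega -> R) : \bar R :=
  ('E_P[fun w => (Num.min `|y w| 1)%R])%E.

(* Random variables in L^0 are identified up to almost sure equality: [Q]
   determines an element of L^0. *)
Definition defines_L0 (Q : (Omega -> R) -> Prop) : Prop :=
  (exists y : {RV P >-> R}, Q y) /\
  (forall y z : {RV P >-> R}, Q y -> Q z -> {ae P, forall w, y w = z w}).

Definition same_fdd (T : Type) (U V : T -> Omega -> R) : Prop :=
  forall (n : nat) (t : 'I_n -> T) (A : set (n.-tuple R)), measurable A ->
    pushforward P (fun w => [tuple U (t i) w | i < n]) A =
    pushforward P (fun w => [tuple V (t i) w | i < n]) A.

Implicit Types X Y : R -> {RV P >-> R}.

Definition measurable_process X : Prop :=
  measurable_fun [set: R * Omega] (fun p : R * Omega => X p.1 p.2).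

Definition stationary_increments X : Prop :=
  forall h : R,
    same_fdd (fun (p : R * R) w => X (p.1 + h) w - X (p.2 + h) w)
             (fun (p : R * R) w => X p.1 w - X p.2 w).

Definition stationary Y : Prop :=
  forall tau : R, same_fdd (fun t w => Y (t + tau) w) (fun t w => Y t w).

Definition stochastically_continuous Y : Prop :=
  forall t : R, Fnorm (fun w => Y s w - Y t w) @[s --> t] --> 0%E.

(* [I] is (a version of) the Riemann integral of phi(t) X_t over [a, b], for
   a <= b: the limit in probability of the Riemann sums as the mesh tends
   to 0. *)
Definition Riemann_int (phi : R -> R) X (a b : R) (I : Omega -> R) : Prop :=
  forall eps : R, 0 < eps ->
    exists2 delta : R, 0 < delta &
      forall (s : seq R) (xi : nat -> R),
        itv_partition a b s -> tags a b s xi -> mesh_lt a b s delta ->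
        (Fnorm (fun w => (Riemann_sum (fun t => phi t * X t w) a b s xi - I w)%R)
           < eps%:E)%E.

Definition in_Rm (a b : R) X : Prop :=
  forall phi : R -> R, Dminus a b phi ->
    exists I : {RV P >-> R}, Riemann_int phi X a b I.

Definition oriented_int (phi : R -> R) X (t : R) (I : Omega -> R) : Prop :=
  if 0 <= t then Riemann_int phi X 0 t I else Riemann_int phi X t 0 (\- I).

(* Integral over ]-oo, t]: only the finitely many [n] with t < -n are left
   unconstrained. *)
Definition improper_int (phi : R -> R) X (t : R) (I : Omega -> R) : Prop :=
  exists J : nat -> {RV P >-> R},
    (forall n : nat, - n%:R <= t -> Riemann_int phi X (- n%:R) t (J n)) /\
    {ae P, forall w, J n w @[n --> \oo] --> I w}.

(* y = X_t - int_(-oo)^t e^(-(t-s)) X_s ds almost surely. *)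
Definition Y_of_X X (t : R) (y : Omega -> R) : Prop :=
  exists I : {RV P >-> R},
    improper_int (fun s => expR (- (t - s))) X t I /\
    {ae P, forall w, y w = X t w - I w}.

(* x = Y_t - Y_0 + int_0^t Y_u du almost surely. *)
Definition X_of_Y Y (t : R) (x : Omega -> R) : Prop :=
  exists I : {RV P >-> R},
    oriented_int (fun=> 1) Y t I /\
    {ae P, forall w, x w = Y t w - Y 0 w + I w}.

End Processes.

(* Main.v *)
(** Write V for the space of random variables with the complete F-norm
    N y = E min(|y|, 1).  A gliding hump argument shows that, as soon as every
    multiplier phi in D^- makes phi X Riemann integrable, phi |-> int phi X is
    continuous for the uniform norm.  Hence int psi(u) F(u) du, with
    F(u) = int_a^u e^s X_s ds, can be computed by exchanging the order of
    integration: a Riemann sum of psi F is the integral of e^s X_s against a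
    left-continuous step function converging uniformly to s |-> int_s^b psi.
    For psi(u) = e^{-u} this is an integration by parts, which with
    Z_t = int_{-oo}^t e^{-(t-s)} X_s ds reads
    Z_b - Z_a = int_a^b (X_u - Z_u) du, that is the equation relating X and
    Y = X - Z.

    The improper integral converges because
    int_{-n-1}^{-n} e^s X_s ds = e^{-n-1} (xi_n + (e - 1) X_{-n-1}), where xi_n
    has the law of int_0^1 e^t X_t dt and X_{-n} is a sum of n copies of X_1: by
    Borel-Cantelli the logarithmic moments bound both by a multiple of e^{n/2}.

    Laws are compared through pairs (y, z) approximated by the same linear
    combinations of two families having the same finite-dimensional laws;
    integrals and improper integrals of such pairs are again such pairs.

    A measurable X is stochastically continuous because
    N (X_h - X_0) = E int_0^1 min(|X_{t+h} - X_t|, 1) dt, which tends to 0 with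
    h by Lusin's theorem and the translation invariance of Lebesgue measure. *)

From HB Require Import structures.
Require Import Defs.
From mathcomp Require Import all_boot all_order all_algebra.
From mathcomp Require Import all_classical all_reals all_analysis.
From mathcomp Require Import measurable_realfun.
From mathcomp Require Import ring lra.
Import Order.TTheory GRing.Theory Num.Theory.
Import numFieldNormedType.Exports.
Local Open Scope classical_set_scope.
Local Open Scope ring_scope.

Set Implicit Arguments.
Unset Strict Implicit.
Unset Printing Implicit Defensive.

(** * Tagged partitions and Riemann sums *)

(** The F-norm is not homogeneous and the space is in general not locally convex, so integrals of X
    cannot be estimated by domination; hypothesis (i) only says that integrals exist. Every bound
    has to be extracted from this existence, and every auxiliary multiplier has to lie in D^-: hence
    step functions are spanned by the indicators of half-lines ]-oo, c], which are left-continuous.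
    A vector of F-norm 0 is only almost surely 0, so integrals are determined up to null vectors,
    and Y is not given as a measurable functional of the paths of X from which stationarity could be
    read off. Only increments of X have shift-invariant laws: in each translated integral the
    constant X_h must be split off. Moreover the cut-offs -n of the improper integral are not
    translation invariant: a shift by tau leaves an integral over the window [-n, tau - n], which
    has to vanish in probability. For exponentials, mean-value tags make the scalar Riemann sums
    telescope exactly, so their integrals are evaluated without any limit. *)

Section TaggedPartitions.
Context {R : realType}.
Implicit Types (a b c u x t delta : R) (p q : seq (R * R)).

(* A tagged partition as the list of its (tag, right endpoint) pairs. *)
Fixpoint tpart delta a b p : Prop :=
  if p is (x, t) :: p' then
    [/\ a < t, t - a < delta, a <= x <= t & tpart delta t b p']
  else a = b.

Lemma tpart_le delta a b p : tpart delta a b p -> a <= b.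
Proof.
elim: p a => [a -> //|[x t] p IH a /= [at_ _ _ /IH tb]].
exact: (le_trans (ltW at_) tb).
Qed.

Lemma tpart_weaken delta delta' a b p :
  delta <= delta' -> tpart delta a b p -> tpart delta' a b p.
Proof.
move=> dd; elim: p a => [//|[x t] p IH a /= [? h ? /IH ?]]; split => //.
exact: lt_le_trans h dd.
Qed.

Lemma tpart_min d1 d2 a b p :
  tpart (Num.min d1 d2) a b p -> tpart d1 a b p /\ tpart d2 a b p.
Proof.
by move=> h; split; apply: tpart_weaken h; rewrite ge_min lexx ?orbT.
Qed.

Lemma tpart_cat delta a b c p q :
  tpart delta a b p -> tpart delta b c q -> tpart delta a c (p ++ q).
Proof.
elim: p a => [a /= -> //|[x t] p IH a /= [? ? ? h1] h2]; split => //.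
exact: IH.
Qed.

(** The second conclusion is an induction principle for the constructed partition: it is how later
    proofs remember that every tag satisfies [Q], typically a mean-value identity. *)
Lemma tpart_exists (Q : R -> R -> R -> Prop) delta a b :
  (forall u v, u < v -> exists2 x, u <= x <= v & Q u x v) ->
  0 < delta -> a <= b ->
  exists2 p, tpart delta a b p &
    forall (G : R -> R -> seq (R * R) -> Prop), G b b [::] ->
      (forall u x v p, u < v -> u <= x <= v -> Q u x v -> v - u < delta ->
        tpart delta v b p -> G v b p -> G u b ((x, v) :: p)) -> G a b p.
Proof.
move=> hQ d0 ab.
suff H : forall n a, a <= b -> b - a <= n%:R * (delta / 2) ->
    exists2 p, tpart delta a b p &
    forall (G : R -> R -> seq (R * R) -> Prop), G b b [::] ->
      (forall u x v p, u < v -> u <= x <= v -> Q u x v -> v - u < delta ->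
        tpart delta v b p -> G v b p -> G u b ((x, v) :: p)) -> G a b p.
  pose n := Num.truncn ((b - a) / (delta / 2)).
  apply: (H n.+1) => //; apply: ltW; rewrite -ltr_pdivrMr ?divr_gt0//.
  by rewrite /n truncnS_gt.
elim=> [|n IH] a' a'b hn.
  have -> : a' = b by move: hn; rewrite mul0r; lra.
  by exists [::].
have [->|neq] := eqVneq a' b; first by exists [::].
have lt : a' < b by rewrite lt_neqAle neq.
(* Steps of [delta / 2] keep the cells strictly shorter than [delta]. *)
pose v := Num.min b (a' + delta / 2).
have av : a' < v by rewrite lt_min lt /=; lra.
have vb : v <= b by rewrite ge_min lexx.
have vd : v - a' < delta.
  have : v <= a' + delta / 2 by rewrite ge_min lexx orbT.
  lra.
have [|p hp hG] := IH v vb.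
  rewrite /v; case: (leP b (a' + delta / 2)) => h.
    by rewrite subrr mulr_ge0// divr_ge0// ltW.
  by move: hn; rewrite -natr1; lra.
have [x xuv Qx] := hQ _ _ av.
exists ((x, v) :: p); first exact: And4 av vd xuv hp.
by move=> G h0 hS; apply: (hS) => //; exact: (hG _ h0 hS).
Qed.

Lemma tpart_exists_any delta a b : 0 < delta -> a <= b ->
  exists p, tpart delta a b p.
Proof.
move=> d0 ab; have [|p hp _] := @tpart_exists (fun _ _ _ => True) delta a b _ d0 ab.
  by move=> u v uv; exists u => //; rewrite lexx ltW.
by exists p.
Qed.

Definition shiftp (h : R) p := [seq (z.1 + h, z.2 + h) | z <- p].

Lemma tpart_shift h delta a b p :
  tpart delta a b p -> tpart delta (a + h) (b + h) (shiftp h p).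
Proof.
elim: p a => [a /= -> //|[x t] p IH a /= [? ? ? h1]]; split.
- lra.
- lra.
- lra.
- exact: IH.
Qed.

Lemma shiftpK h p : shiftp (- h) (shiftp h p) = p.
Proof.
rewrite /shiftp -map_comp -[RHS]map_id; apply: eq_map => -[x t] /=.
by rewrite !addrK.
Qed.

Section Sums.
Context {V : lmodType R}.
Implicit Types f g : R -> V.

Fixpoint rsum f a p : V :=
  if p is (x, t) :: p' then (t - a) *: f x + rsum f t p' else 0.

Lemma rsum_cat f delta a b p q : tpart delta a b p ->
  rsum f a (p ++ q) = rsum f a p + rsum f b q.
Proof.
elim: p a => [a /= ->|[x t] p IH a /= [_ _ _ /IH ->]]; first by rewrite add0r.
by rewrite addrA.
Qed.

Lemma rsumD f g a p : rsum (fun t => f t + g t) a p = rsum f a p + rsum g a p.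
Proof.
elim: p a => [a|[x t] p IH a] /=; first by rewrite addr0.
by rewrite IH scalerDr !addrA; congr (_ + _); rewrite addrAC.
Qed.

Lemma rsumZ k f a p : rsum (fun t => k *: f t) a p = k *: rsum f a p.
Proof.
elim: p a => [a|[x t] p IH a] /=; first by rewrite scaler0.
by rewrite IH scalerDr !scalerA mulrC.
Qed.

Lemma rsumN f a p : rsum (fun t => - f t) a p = - rsum f a p.
Proof.
by rewrite -scaleN1r -rsumZ; congr (rsum _ a p); apply/funext => t; rewrite scaleN1r.
Qed.

Lemma rsumB f g a p : rsum (fun t => f t - g t) a p = rsum f a p - rsum g a p.
Proof. by rewrite rsumD rsumN. Qed.

Lemma rsum_ext f g delta a b p : (forall t, a <= t <= b -> f t = g t) ->
  tpart delta a b p -> rsum f a p = rsum g a p.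
Proof.
move=> fg; elim: p a fg => [//|[x t] p IH a fg /= [at_ _ /andP[ax xt] h]].
have tb := tpart_le h.
rewrite fg ?ax ?(le_trans xt)// (IH t)// => y /andP[ty yb].
by rewrite fg// yb (le_trans (ltW at_)).
Qed.

Lemma rsum_shift h f a p :
  rsum f (a + h) (shiftp h p) = rsum (fun t => f (t + h)) a p.
Proof.
elim: p a => [//|[x t] p IH a] /=; rewrite IH; congr (_ *: _ + _).
by rewrite opprD addrACA subrr addr0.
Qed.

(** The cell that straddles [b] is cut into two cells, both tagged [b]; [x] is its former tag and
    [k] its length. If [b] is already a division point, [k = 0]. *)
Lemma tpart_split delta a b c p : 0 < delta -> tpart delta a c p -> a <= b <= c ->
  exists p1 p2 x k, [/\ tpart delta a b p1, tpart delta b c p2, a <= x <= c,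
    0 <= k < delta &
    forall f, rsum f a p = rsum f a p1 + rsum f b p2 + k *: (f x - f b)].
Proof.
move=> d0; elim: p a => [a /= ->|[x t] p IH a /= [at_ td xat h]] /andP[ab bc].
  have -> : b = c by apply/eqP; rewrite eq_le bc ab.
  exists [::], [::], c, 0; split => //=; rewrite ?lexx ?d0//.
  by move=> f; rewrite scale0r !addr0.
have tc := tpart_le h.
have [tb|bt] := leP t b.
  have [|p1 [p2 [y [k [h1 h2 /andP[ty yc] h4 h5]]]]] := IH t h.
    by rewrite tb bc.
  exists ((x, t) :: p1), p2, y, k; split => //=.
    by rewrite yc (le_trans (ltW at_)).
  by move=> f; rewrite h5 !addrA.
have [ea|neq] := eqVneq a b.
  rewrite -ea in bc ab bt *.
  exists [::], ((x, t) :: p), a, 0; split => //=; rewrite ?lexx ?bc ?d0//.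
  by move=> f; rewrite add0r scale0r addr0.
have lt : a < b by rewrite lt_neqAle neq.
exists [:: (b, b)], ((b, t) :: p), x, (t - a); split => //=.
- by split=> //; lra.
- by split=> //; lra.
- by lra.
- by lra.
- move=> f; have e : (t - a) *: f b = (b - a) *: f b + (t - b) *: f b.
    by rewrite -scalerDl; congr (_ *: _); lra.
  by rewrite scalerBr e addr0 (addrA ((b - a) *: f b)) [RHS]addrC [RHS]addrA subrK.
Qed.

End Sums.
End TaggedPartitions.

(** * Riemann integrals in a complete F-normed space *)

(** [N x = 0] is allowed for nonzero [x]: random variables are functions here, not classes modulo
    null sets. Uniqueness of an integral therefore reads [N (I - J) = 0]. The field [fnorm_absorb]
    is continuity of scalar multiplication at 0. *)
Record fnorm (R : realType) (V : lmodType R) (N : V -> R) : Prop := FNorm {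
  fnorm0 : N 0 = 0;
  fnormN : forall x, N (- x) = N x;
  fnorm_triangle : forall x y, N (x + y) <= N x + N y;
  fnormZ : forall k x, `|k| <= 1 -> N (k *: x) <= N x;
  fnorm_absorb : forall x eps, 0 < eps ->
    exists2 eta, 0 < eta & forall k, `|k| <= eta -> N (k *: x) < eps;
  fnorm_complete : forall u : nat -> V,
    (forall eps, 0 < eps -> exists n0, forall m n, (n0 <= m)%N -> (n0 <= n)%N ->
      N (u m - u n) < eps) ->
    exists l, forall eps, 0 < eps -> exists n0, forall n, (n0 <= n)%N ->
      N (u n - l) < eps }.

Section AbstractIntegral.
Context {R : realType} {V : lmodType R} (N : V -> R) (NF : fnorm N).
Implicit Types (a b c delta eps : R) (p q : seq (R * R)) (f g : R -> V).

Let N0 := fnorm0 NF.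
Let NN := fnormN NF.
Let ND := fnorm_triangle NF.

Lemma fnormB x y : N (x - y) <= N x + N y.
Proof. by rewrite (le_trans (ND _ _))// NN. Qed.

Lemma fnorm_ge0 x : 0 <= N x.
Proof. by have := fnormB x x; rewrite subrr N0; lra. Qed.

Lemma fnormC x y : N (x - y) = N (y - x).
Proof. by rewrite -NN opprB. Qed.

Lemma fnorm_dist x y z : N (x - z) <= N (x - y) + N (y - z).
Proof. by rewrite (le_trans _ (ND _ _))// addrA subrK. Qed.

Lemma fnorm_dist0 x y : N x <= N (x - y) + N y.
Proof. by rewrite (le_trans _ (ND _ _))// subrK. Qed.

(** Substitute for homogeneity: [k] is [n] times a scalar of modulus at most 1, and the factor [n]
    costs [n] uses of the triangle inequality. *)
Lemma fnormZ_nat k n x : `|k| <= n%:R -> N (k *: x) <= n%:R * N x.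
Proof.
case: n => [|n]; first by rewrite normr_le0 => /eqP ->; rewrite scale0r N0 mul0r.
move=> kn; have n0 : 0 < n.+1%:R :> R by [].
have -> : k *: x = n.+1%:R *: ((k / n.+1%:R) *: x).
  by rewrite scalerA mulrCA mulfV ?mulr1// gt_eqF.
have h : forall m y, N (m%:R *: y) <= m%:R * N y.
  elim=> [|m IH] y; first by rewrite scale0r N0 mul0r.
  rewrite -natr1 scalerDl scale1r mulrDl mul1r (le_trans (ND _ _))//.
  by rewrite lerD.
rewrite (le_trans (h _ _))// ler_wpM2l// fnormZ// normrM normfV.
by rewrite ler_pdivrMr ?normr_gt0 ?gt_eqF// mul1r (ger0_norm (ltW n0)).
Qed.

Lemma fnorm_eq0Z k x : N x = 0 -> N (k *: x) = 0.
Proof.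
move=> x0; apply/eqP; rewrite eq_le fnorm_ge0 andbT.
have := @fnormZ_nat k (Num.truncn `|k|).+1 x.
by rewrite x0 mulr0; apply; rewrite ltW// truncnS_gt.
Qed.

Definition isint f a b (I : V) : Prop := forall eps, 0 < eps ->
  exists2 delta, 0 < delta &
    forall p, tpart delta a b p -> N (rsum f a p - I) < eps.

Lemma isint_refl f a : isint f a a 0.
Proof.
move=> eps e0; exists 1 => // -[|[x t] p] /=; first by rewrite subrr N0.
by move=> [? _ _ /tpart_le]; lra.
Qed.

Lemma isint_unique f a b I J : a <= b -> isint f a b I -> isint f a b J ->
  N (I - J) = 0.
Proof.
move=> ab hI hJ; apply/eqP; rewrite eq_le fnorm_ge0 andbT.
apply/ler_addgt0Pl => e e0; rewrite addr0.
have [|d1 d10 h1] := hI (e / 2); first lra.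
have [|d2 d20 h2] := hJ (e / 2); first lra.
have [|p hp] := @tpart_exists_any _ (Num.min d1 d2) a b _ ab.
  by rewrite lt_min d10.
have [/h1 h1' /h2 h2'] := tpart_min hp.
by have := fnorm_dist I (rsum f a p) J; rewrite (fnormC I (rsum _ _ _)); lra.
Qed.

Lemma isint_cvg f a b I J : N (I - J) = 0 -> isint f a b I -> isint f a b J.
Proof.
move=> IJ hI eps e0; have [d d0 h] := hI _ e0; exists d => // p /h hp.
by have := fnorm_dist (rsum f a p) I J; rewrite IJ; lra.
Qed.

Lemma isintD f g a b I J : isint f a b I -> isint g a b J ->
  isint (fun t => f t + g t) a b (I + J).
Proof.
move=> hI hJ e e0.
have [|d1 d10 h1] := hI (e / 2); first lra.
have [|d2 d20 h2] := hJ (e / 2); first lra.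
exists (Num.min d1 d2); first by rewrite lt_min d10.
move=> p hp; rewrite rsumD opprD addrACA.
have [/h1 h1' /h2 h2'] := tpart_min hp.
by have := ND (rsum f a p - I) (rsum g a p - J); lra.
Qed.

Lemma isintZ k f a b I : isint f a b I -> isint (fun t => k *: f t) a b (k *: I).
Proof.
move=> hI e e0; pose n := (Num.truncn `|k|).+1.
have n0 : 0 < n%:R :> R by [].
have [|d d0 h] := hI (e / n%:R); first exact: divr_gt0.
exists d => // p /h; rewrite rsumZ -scalerBr ltr_pdivlMr// mulrC.
apply: le_lt_trans; apply: fnormZ_nat.
by rewrite ltW// truncnS_gt.
Qed.

Lemma isintN f a b I : isint f a b I -> isint (fun t => - f t) a b (- I).
Proof.
move=> /(@isintZ (-1)); rewrite scaleN1r.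
by have -> : (fun t => -1 *: f t) = (fun t => - f t)
  by apply/funext => t; rewrite scaleN1r.
Qed.

Lemma isintB f g a b I J : isint f a b I -> isint g a b J ->
  isint (fun t => f t - g t) a b (I - J).
Proof. by move=> hI /isintN; exact: isintD. Qed.

Lemma isint_ext f g a b I : (forall t, a <= t <= b -> f t = g t) ->
  isint f a b I -> isint g a b I.
Proof.
move=> fg hI e e0; have [d d0 h] := hI e e0; exists d => // p hp.
by rewrite -(rsum_ext fg hp); exact: h.
Qed.

(** Once an integral is known to exist, one convenient partition of each mesh identifies its value;
    this is where mean-value tags are exploited. *)
Lemma isint_eq f a b I (J : V) :
  isint f a b I ->
  (forall eps delta, 0 < eps -> 0 < delta ->
    exists2 p, tpart delta a b p & N (rsum f a p - J) <= eps) -> isint f a b J.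
Proof.
move=> hI hJ; apply: isint_cvg (hI); apply/eqP; rewrite eq_le fnorm_ge0 andbT.
apply/ler_addgt0Pl => e e0; rewrite addr0.
have [|d d0 h] := hI (e / 2); first lra.
have [||p hp hp'] := hJ (e / 2) d; [lra|by []|].
have := h p hp.
by have := fnorm_dist I (rsum f a p) J; rewrite (fnormC I (rsum _ _ _)); lra.
Qed.

Lemma isint_cauchy f a b : a <= b ->
  (forall eps, 0 < eps -> exists2 delta, 0 < delta & forall p q,
     tpart delta a b p -> tpart delta a b q ->
     N (rsum f a p - rsum f a q) < eps) ->
  exists I, isint f a b I.
Proof.
move=> ab hC.
have hp n : exists p, tpart (n.+1%:R^-1 : R) a b p.
  by apply: tpart_exists_any => //; rewrite invr_gt0.
have [pp hpp] := choice hp.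
have small d : 0 < d -> exists n0, forall n, (n0 <= n)%N ->
    n.+1%:R^-1 <= d :> R.
  move=> d0; exists (Num.truncn d^-1) => n hn.
  rewrite -[leRHS]invrK lef_pV2 ?posrE ?invr_gt0//.
  rewrite (le_trans (ltW (truncnS_gt _)))// ler_nat.
  by rewrite ltnS.
have [u hu|l hl] := fnorm_complete NF (u := fun n => rsum f a (pp n)).
  have [d d0 h] := hC _ hu; have [n0 hn0] := small _ d0.
  exists n0 => m n hm hn; apply: h; apply: tpart_weaken (hpp _); exact: hn0.
exists l => e e0.
have [|d d0 h] := hC (e / 2); first lra.
have [|n1 hn1] := hl (e / 2); first lra.
have [n0 hn0] := small _ d0.
exists d => // p hp'.
have h1 := h p (pp (maxn n0 n1)) hp' _.
have h2 := hn1 (maxn n0 n1) (leq_maxr _ _).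
have h3 := h1 (tpart_weaken (hn0 _ (leq_maxl _ _)) (hpp _)).
by have := fnorm_dist (rsum f a p) (rsum f a (pp (maxn n0 n1))) l; lra.
Qed.

(* Changing one tag changes the sum by (v - u)(f t - f x), so on each of
   finitely many cells f is a small perturbation of a single vector. *)
Lemma isint_bounded f a b I : a <= b -> isint f a b I -> forall eps, 0 < eps ->
  exists2 eta, 0 < eta & forall t k, a <= t <= b -> `|k| <= eta ->
    N (k *: f t) < eps.
Proof.
move=> ab hI e e0.
have [|d d0 h] := hI (e / 4); first lra.
have [p hp] := tpart_exists_any d0 ab.
(* This form of the Cauchy property passes to the tail of [p]: a partition of the remaining interval
   is completed by the first cell of [p], whose contribution cancels. Hence the induction on [p]. *)
have {h} : forall q, tpart d a b q -> N (rsum f a p - rsum f a q) < e / 2.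
  move=> q /h hq; have := h _ hp.
  by have := fnorm_dist (rsum f a p) I (rsum f a q); rewrite (fnormC I); lra.
elim: p a {ab hI} hp => [|[x v] p IH] a /= => [-> _|].
  have [eta eta0 h] := fnorm_absorb NF (f b) e0.
  exists eta => // t k tb /h; suff -> : t = b by [].
  by apply/eqP; rewrite eq_le andbC.
move=> [av vad axv hp] hq.
have [q hq'|eta1 eta10 h1] := IH v hp.
  have := hq ((x, v) :: q); rewrite /= opprD addrACA subrr add0r.
  by apply; split.
have [|eta2 eta20 h2] := fnorm_absorb NF (f x) (eps := e / 2); first lra.
exists (Num.min eta1 (Num.min eta2 (v - a))).
  by rewrite !lt_min eta10 eta20 subr_gt0.
move=> t k /andP[at_ tb]; rewrite !le_min => /and3P[k1 k2 k3].
have [vt|tv] := leP v t; first by apply: h1; rewrite ?vt.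
have := hq ((t, v) :: p); rewrite /= opprD addrACA subrr addr0 -scalerBr.
move=> /(_ (And4 av vad _ hp)); rewrite at_ ltW// => /(_ isT) hh.
have := fnorm_dist0 (k *: f t) (k *: f x).
suff : N (k *: f t - k *: f x) <= N ((v - a) *: (f x - f t)).
  by have := h2 _ k2; lra.
have va0 : 0 < v - a by lra.
have -> : k *: f t - k *: f x = (- k / (v - a)) *: ((v - a) *: (f x - f t)).
  by rewrite scalerA divfK ?gt_eqF// scaleNr -scalerN opprB scalerBr.
apply: fnormZ => //.
by rewrite normrM normrN normfV (gtr0_norm va0) ler_pdivrMr// mul1r.
Qed.

(** A partition of [[a, c]] may miss [b]; the correction [k *: (f x - f b)] from [tpart_split] is
    small by [isint_bounded], since [k] is less than the mesh bound. *)
Lemma isint_cat f a b c I J : a <= b <= c -> isint f a b I -> isint f b c J ->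
  isint f a c (I + J).
Proof.
move=> /andP[ab bc] hI hJ e e0.
have [|d1 d10 h1] := hI (e / 4); first lra.
have [|d2 d20 h2] := hJ (e / 4); first lra.
have [|n1 n10 k1] := isint_bounded ab hI (eps := e / 4); first lra.
have [|n2 n20 k2] := isint_bounded bc hJ (eps := e / 4); first lra.
pose d := Num.min (Num.min d1 d2) (Num.min n1 n2).
have d0 : 0 < d by rewrite !lt_min d10 d20 n10.
have [dd1 dd2 dn1 dn2] : [/\ d <= d1, d <= d2, d <= n1 & d <= n2].
  by split; rewrite /d !ge_min lexx ?orbT.
exists d => // p hp.
have hb : a <= b <= c by rewrite ab.
have [p1 [p2 [x [k [hp1 hp2 /andP[ax xc] /andP[k0 kd] hs]]]]] :=
  @tpart_split _ V _ _ _ _ _ d0 hp hb.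
rewrite hs.
have e1 := h1 p1 (tpart_weaken dd1 hp1).
have e2 := h2 p2 (tpart_weaken dd2 hp2).
have e3 : N (k *: f x) < e / 4.
  have [xb|bx] := leP x b.
    by apply: k1; [rewrite ax xb|rewrite ger0_norm//; lra].
  by apply: k2; [rewrite (ltW bx) xc|rewrite ger0_norm//; lra].
have e4 : N (k *: f b) < e / 4.
  by apply: k1; [rewrite ab lexx|rewrite ger0_norm//; lra].
have -> : rsum f a p1 + rsum f b p2 + k *: (f x - f b) - (I + J) =
    (rsum f a p1 - I) + (rsum f b p2 - J) + (k *: f x - k *: f b).
  by rewrite scalerBr [LHS]addrAC opprD (addrACA (rsum f a p1)).
have := ND (rsum f a p1 - I + (rsum f b p2 - J)) (k *: f x - k *: f b).
have := ND (rsum f a p1 - I) (rsum f b p2 - J).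
by have := fnormB (k *: f x) (k *: f b); lra.
Qed.

(* Tagging the cells of [b, c] at their right ends makes the sums of the
   extension by zero coincide with those over [a, b]. *)
Lemma isint_restrict f a b c I : a <= b <= c ->
  isint (fun t => if t <= b then f t else 0) a c I -> isint f a b I.
Proof.
move=> /andP[ab bc] hI e e0; have [d d0 h] := hI e e0; exists d => // p hp.
have [|q hq hG] := @tpart_exists _ (fun u x v => x = v) d b c _ d0 bc.
  by move=> u v uv; exists v => //; rewrite lexx ltW.
have := h (p ++ q) (tpart_cat hp hq); rewrite (rsum_cat _ _ hp).
rewrite (@rsum_ext _ _ _ f d a b p) //; last by move=> t /andP[_ ->].
suff -> : rsum (fun t => if t <= b then f t else 0) b q = 0 by rewrite addr0.
have := hG (fun u _ q =>
  b <= u -> rsum (fun t => if t <= b then f t else 0) u q = 0).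
apply => // u x v q' uv _ -> _ _ IH bu /=.
rewrite IH; last by rewrite (le_trans bu) // ltW.
by rewrite leNgt (le_lt_trans bu uv)/= scaler0 addr0.
Qed.

(* Henstock: over a short interval the integral is close to (v - u) f u. *)
Lemma isint_primitive_continuous f (F : R -> V) a b :
  a <= b -> (forall u v, a <= u <= v -> v <= b -> isint f u v (F v - F u)) ->
  forall eps, 0 < eps -> exists2 delta, 0 < delta &
    forall u v, a <= u <= v -> v <= b -> v - u < delta -> N (F v - F u) < eps.
Proof.
move=> ab hF e e0.
have hab : isint f a b (F b - F a) by apply: hF; rewrite ?lexx ?ab.
have [|d d0 h] := hab (e / 6); first lra.
have [|n n0 k] := isint_bounded ab hab (eps := e / 6); first lra.
exists (Num.min d n); first by rewrite lt_min d0.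
move=> u v /andP[au uv] vb; rewrite lt_min => /andP[vd vn].
have [->|neq] := eqVneq u v; first by rewrite subrr N0.
have lt : u < v by rewrite lt_neqAle neq.
have huv : isint f u v (F v - F u) by apply: hF; rewrite ?au ?uv.
have [|d2 d20 h2] := huv (e / 6); first lra.
have [p1 hp1] := tpart_exists_any d0 au.
have [p3 hp3] := tpart_exists_any d0 vb.
have [|p2 hp2] := @tpart_exists_any _ (Num.min d d2) u v _ uv.
  by rewrite lt_min d0.
have [hp2' /h2 e1] := tpart_min hp2.
have e2 := h _ (tpart_cat hp1 (tpart_cat hp2' hp3)).
(* With [[u, v]] as one cell tagged [u], two partitions of [[a, b]] agree outside [[u, v]], so that
   their sums differ by a fine sum over [[u, v]] minus [(v - u) *: f u]. *)
have hc : tpart d u v [:: (u, v)] by split => //; rewrite lexx uv.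
have e3 := h _ (tpart_cat hp1 (tpart_cat hc hp3)).
have e4 : N ((v - u) *: f u) < e / 6.
  apply: k; first by rewrite au (le_trans uv).
  by rewrite ger0_norm; lra.
rewrite !(rsum_cat _ _ hp1) (rsum_cat _ _ hp2') in e2.
rewrite !(rsum_cat _ _ hp1) (rsum_cat _ _ hc) /= addr0 in e3.
move: e2 e3; set J := F b - F a.
set A := rsum f a p1; set B := rsum f u p2; set C := rsum f v p3.
set D := _ *: _ => e2 e3.
have := fnorm_dist (A + (B + C)) J (A + (D + C)); rewrite (fnormC J).
rewrite (_ : A + (B + C) - (A + (D + C)) = B - D); last first.
  by rewrite opprD addrACA subrr add0r opprD addrACA subrr addr0.
have := fnorm_dist0 B D.
by have := fnorm_dist0 (F v - F u) B; rewrite (fnormC _ B); lra.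
Qed.

End AbstractIntegral.

(** * Left-continuous multipliers *)

Section Dminus.
Context {R : realType}.
Implicit Types (a b c delta eps : R) (p q : seq (R * R)) (phi psi : R -> R).

Lemma near_leftP (P : R -> Prop) x : (\forall y \near x^'-, P y) ->
  exists2 eta, 0 < eta & forall y, x - eta < y < x -> P y.
Proof.
move=> /nbhs_ballP[e /= e0 he]; exists e => // y /andP[y1 y2]; apply: he => //=.
by rewrite /ball /= gtr0_norm; lra.
Qed.

Lemma near_rightP (P : R -> Prop) x : (\forall y \near x^'+, P y) ->
  exists2 eta, 0 < eta & forall y, x < y < x + eta -> P y.
Proof.
move=> /nbhs_ballP[e /= e0 he]; exists e => // y /andP[y1 y2]; apply: he => //=.
by rewrite /ball /= ltr0_norm; lra.
Qed.

Lemma Dminus_sub a b a' b' phi : a <= a' -> b' <= b ->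
  Dminus a b phi -> Dminus a' b' phi.
Proof.
move=> aa bb [h1 h2]; split=> x /andP[x1 x2].
  by apply: h1; rewrite (le_lt_trans aa)// (le_trans x2).
by apply: h2; rewrite (le_trans aa)// (lt_le_trans x2).
Qed.

Lemma Dminus_continuous a b phi : continuous phi -> Dminus a b phi.
Proof.
move=> h; split=> x _; first exact/cvg_at_left_filter/h.
by apply/cvg_ex; exists (phi x); exact/cvg_at_right_filter/h.
Qed.

Lemma Dminus_cst a b c : Dminus a b (fun=> c).
Proof. by apply: Dminus_continuous => x; exact: cvg_cst. Qed.

Lemma DminusD a b phi psi : Dminus a b phi -> Dminus a b psi ->
  Dminus a b (fun t => phi t + psi t).
Proof.
move=> [h1 h2] [k1 k2]; split=> x hx; first by apply: cvgD; [exact: h1|exact: k1].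
by apply: is_cvgD; [exact: h2|exact: k2].
Qed.

Lemma DminusM a b phi psi : Dminus a b phi -> Dminus a b psi ->
  Dminus a b (fun t => phi t * psi t).
Proof.
move=> [h1 h2] [k1 k2]; split=> x hx; first by apply: cvgM; [exact: h1|exact: k1].
by apply: is_cvgM; [exact: h2|exact: k2].
Qed.

Lemma DminusB a b phi psi : Dminus a b phi -> Dminus a b psi ->
  Dminus a b (fun t => phi t - psi t).
Proof.
move=> h1 h2; have -> : (fun t => phi t - psi t) = (fun t => phi t + -1 * psi t).
  by apply/funext => t; rewrite mulN1r.
by apply: DminusD => //; apply: DminusM => //; exact: Dminus_cst.
Qed.

Lemma Dminus_indic a b c : Dminus a b (fun t => (t <= c)%R%:R).
Proof.
split=> x _.
  have [xc|cx] := leP x c.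
    apply: cvg_near_cst; near=> y; suff -> : y <= c by [].
    by rewrite (le_trans _ xc)// ltW//; near: y; exact: nbhs_left_lt.
  apply: cvg_near_cst; near=> y; suff -> : y <= c = false by [].
  by apply/negbTE; rewrite -ltNge; near: y; exact: nbhs_left_gt.
have [xc|cx] := ltP x c; apply/cvg_ex.
  exists 1; apply: cvg_near_cst; near=> y; suff -> : y <= c by [].
  by near: y; exact: nbhs_right_le.
exists 0; apply: cvg_near_cst; near=> y; suff -> : y <= c = false by [].
have xy : x < y by near: y; exact: nbhs_right_gt.
by apply/negbTE; rewrite -ltNge (le_lt_trans cx).
Unshelve. all: by end_near. Qed.

Lemma Dminus_shift h a b phi : Dminus (a + h) (b + h) phi ->
  Dminus a b (fun t => phi (t + h)).
Proof.
move=> [h1 h2]; split=> x /andP[x1 x2].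
  apply/cvgrPdist_lt => e e0.
  have hx : a + h < x + h <= b + h by lra.
  have /cvgrPdist_lt/(_ _ e0)/near_leftP[n n0 hn] := h1 _ hx.
  near=> y; apply: hn.
  have yx : y < x by near: y; exact: nbhs_left_lt.
  have xy : x - n < y by near: y; apply: nbhs_left_gt; lra.
  lra.
have hx : a + h <= x + h < b + h by lra.
have /cvg_ex[l /cvgrPdist_lt hl] := h2 _ hx.
apply/cvg_ex; exists l; apply/cvgrPdist_lt => e e0.
have [n n0 hn] := near_rightP (hl _ e0).
near=> y; apply: hn.
have xy : x < y by near: y; exact: nbhs_right_gt.
have yx : y < x + n by near: y; apply: nbhs_right_lt; lra.
lra.
Unshelve. all: by end_near. Qed.

Lemma Dminus_lim a b phi :
  (forall eps, 0 < eps -> exists2 psi, Dminus a b psi &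
    forall t, a <= t <= b -> `|phi t - psi t| <= eps) -> Dminus a b phi.
Proof.
move=> H; split=> x /andP[x1 x2].
  apply/cvgrPdist_lt => e e0.
  have [|psi [h1 _] hpsi] := H (e / 4); first lra.
  have hx : a < x <= b by rewrite x1.
  have e40 : 0 < e / 4 by lra.
  have {h1} /cvgrPdist_lt/(_ _ e40) h1 := h1 x hx.
  near=> y.
  have h3 := hpsi x; rewrite (ltW x1) x2 in h3.
  have h4 := hpsi y.
  have h5 : `|psi x - psi y| < e / 4 by near: y.
  have yx : y < x by near: y; exact: nbhs_left_lt.
  have ay : a <= y by near: y; exact: nbhs_left_ge.
  rewrite ay (le_trans (ltW yx) x2) in h4.
  move: (h3 isT) (h4 isT) h5; rewrite !ler_distl !ltr_distl; lra.
(* No candidate for the right limit of [phi] is at hand, so the Cauchy criterion is used, with balls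
   centred at the right limit of an approximant [psi]. *)
apply: cauchy_cvg; apply: cauchy_exP => e e0.
have e40 : 0 < e / 4 by lra.
have [psi [_ h2] hpsi] := H (e / 4) e40.
have /cvg_ex[l /cvgrPdist_lt/(_ _ e40) hl] := h2 x (introT andP (conj x1 x2)).
exists l; rewrite /= nbhs_simpl /=; near=> y.
rewrite /ball /=.
have h5 : `|l - psi y| < e / 4 by near: y.
have xy : x < y by near: y; exact: nbhs_right_gt.
have yb : y <= b by near: y; exact: nbhs_right_le.
have := hpsi y; rewrite yb (le_trans x1 (ltW xy)) => /(_ isT).
move: h5; rewrite !ler_distl !ltr_distl; lra.
Unshelve. all: by end_near. Qed.

(** A pair [(c, x)] contributes [c] on ]-oo, x], so the first components are jumps rather than
    values. *)
Definition step (l : seq (R * R)) (t : R) : R :=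
  \sum_(z <- l) z.1 * (t <= z.2)%R%:R.

(** Supremum argument on the set of [x] such that approximation is possible on [[a, x]]:
    left-continuity shows that the supremum is attained, the right limit there allows passing beyond
    it unless it is [b]. *)
Lemma Dminus_step a b phi eps : a <= b -> Dminus a b phi -> 0 < eps ->
  exists l, forall t, a <= t <= b -> `|phi t - step l t| <= eps.
Proof.
move=> ab [hl hr] e0.
(* Vanishing beyond [x] allows an extension by [L] times the indicator of ]x, x'], that is, by the
   two pairs [(L, x')] and [(- L, x)]. *)
pose S x := exists2 l, forall t, x < t -> step l t = 0 &
  forall t, a <= t <= x -> `|phi t - step l t| <= eps.
have Sa : S a.
  exists [:: (phi a, a)] => t; rewrite /step big_seq1 /=.
    by rewrite ltNge => /negbTE ->; rewrite mulr0.
  move=> ata; have -> : t = a by lra.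
    by rewrite lexx /= mulr1 subrr normr0 ltW.
have Sext x x' L : S x -> x < x' ->
    (forall t, x < t <= x' -> `|phi t - L| <= eps) -> S x'.
  move=> [l l0 hl'] xx' hL; exists (l ++ [:: (L, x'); (- L, x)]) => t.
    rewrite /step big_cat /= big_cons big_seq1 /= => x't.
    rewrite -[X in X + _ = _]/(step l t) l0; last by rewrite (lt_trans xx').
    by rewrite leNgt x't leNgt (lt_trans xx' x't) !mulr0 !addr0.
  rewrite /step big_cat /= big_cons big_seq1 /= -[X in _ - (X + _)]/(step l t).
  move=> /andP[at_ tx']; rewrite tx' /= mulr1.
  have [tx|xt] := leP t x; first by rewrite mulr1 subrr addr0 hl'// at_.
  by rewrite mulr0 addr0 l0// add0r hL// xt.
pose A := [set x | a <= x <= b /\ S x].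
have Aa : A a by split; rewrite ?lexx.
have supA : has_sup A by split; [exists a|exists b => x [/andP[]]].
have as_ : a <= sup A by apply: sup_upper_bound.
have sb : sup A <= b by apply: sup_le_ub; [exists a|move=> x [/andP[]]].
have Ss : S (sup A).
  have [<-//|neq] := eqVneq a (sup A).
  have lt : a < sup A by rewrite lt_neqAle neq.
  have /cvgrPdist_lt/(_ _ e0)/near_leftP[n n0 hn] : phi y @[y --> (sup A)^'-] --> phi (sup A).
    by apply: hl; rewrite lt.
  have [x [hx Sx] xs] := sup_adherent n0 supA.
  have : x <= sup A by apply: sup_upper_bound.
  rewrite le_eqVlt => /predU1P[<-//|lt'].
  apply: (Sext x _ (phi (sup A))) => // t /andP[xt].
  rewrite le_eqVlt => /predU1P[->|ts]; first by rewrite subrr normr0 ltW.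
  by rewrite distrC ltW// hn// ts (lt_trans xs).
have [e|neq] := eqVneq (sup A) b.
  by rewrite e in Ss; have [l _ h] := Ss; exists l.
have lt : sup A < b by rewrite lt_neqAle neq.
have /cvg_ex[L /cvgrPdist_lt/(_ _ e0)/near_rightP[n n0 hn]] := hr _ (introT andP (conj as_ lt)).
pose x' := Num.min b (sup A + n / 2).
have sx' : sup A < x' by rewrite lt_min lt /=; lra.
have : A x'.
  split; first by rewrite (le_trans as_ (ltW sx')) ge_min lexx.
  apply: (Sext (sup A) _ L) => // t /andP[t1 t2].
  rewrite distrC ltW// hn// t1 /=.
  have : x' <= sup A + n / 2 by rewrite ge_min lexx orbT.
  lra.
move=> /(sup_upper_bound supA); lra.
Qed.

(* Covers both P u = (s <= u) and P u = (s < u). *)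
Lemma rsum_upset delta a b p (P : pred R) s :
  (forall u, s < u -> P u) -> (forall u, u < s -> ~~ P u) ->
  0 <= delta -> tpart delta a b p ->
  `|rsum (V := R^o) (fun u => (P u)%:R) a p - Num.max 0 (b - Num.max a s)| <= delta.
Proof.
move=> hP hN d0.
have one : forall q u, (forall v, u <= v -> P v) -> tpart delta u b q ->
    rsum (V := R^o) (fun u => (P u)%:R) u q = b - u.
  elim=> [|[x t] q IH] u hu /=; first by move=> ->; rewrite subrr.
  move=> [ut _ /andP[ux _] h]; rewrite (IH t)//; last first.
    by move=> v tv; apply: hu; exact: le_trans (ltW ut) tv.
  by rewrite hu// /GRing.scale /= mulr1; lra.
elim: p a => [|[x t] p IH] a /=.
  move=> ->; rewrite sub0r normrN max_l ?normr0//.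
  by rewrite subr_le0 le_max lexx.
move=> [at_ td /andP[ax xt] h].
have tb := tpart_le h.
case: (boolP (P x)) => Px.
  have sx : s <= x by rewrite leNgt; apply: contraTN Px => /hN.
  rewrite (one _ _ _ h); last first.
    move=> v tv; have := le_trans xt tv; rewrite le_eqVlt => /predU1P[<-//|xv].
    by apply: hP; exact: le_lt_trans xv.
  rewrite /GRing.scale /= mulr1.
  have am : a <= Num.max a s by rewrite le_max lexx.
  have mx : Num.max a s <= x by rewrite ge_max ax.
  rewrite (@max_r _ _ 0); last lra.
  by rewrite ger0_norm; lra.
have xs : x <= s by rewrite leNgt; apply: contra Px => /hP.
rewrite scaler0 add0r.
have [st|ts] := ltP s t; last first.
  by have := IH t h; rewrite (max_r ts) (max_r (le_trans (ltW at_) ts)).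
rewrite (one _ _ _ h); last by move=> v tv; apply: hP; exact: lt_le_trans tv.
have am : a <= Num.max a s by rewrite le_max lexx.
have mt : Num.max a s <= t by rewrite ge_max (ltW at_) ltW.
rewrite (@max_r _ _ 0); last lra.
by rewrite ler0_norm; lra.
Qed.

End Dminus.

(** * Riemann sums truncated to half-lines, uniformly in the truncation point *)

Section IndicatorSums.
Context {R : realType}.
Implicit Types (a b c delta eps : R) (p q : seq (R * R)) (phi psi : R -> R).

(* As s varies, the tail sums play the role of the primitive of psi from s
   to b. *)
Definition tail_sum psi a p s : R :=
  rsum (V := R^o) (fun u => psi u * (s <= u)%R%:R) a p.

Lemma tail_sumD phi psi a p s :
  tail_sum (fun u => phi u + psi u) a p s = tail_sum phi a p s + tail_sum psi a p s.
Proof.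
rewrite /tail_sum -rsumD; congr (rsum _ _ _); apply/funext => u.
by rewrite mulrDl.
Qed.

Lemma tail_sum_le delta psi a b p s eps :
  (forall t, a <= t <= b -> `|psi t| <= eps) -> tpart delta a b p ->
  `|tail_sum psi a p s| <= eps * (b - a).
Proof.
rewrite /tail_sum; elim: p a => [|[x t] p IH] a hpsi /=.
  by move=> ->; rewrite normr0 subrr mulr0.
move=> [at_ _ /andP[ax xt] h]; have tb := tpart_le h.
rewrite (le_trans (ler_normD _ _))//.
have -> : eps * (b - a) = (t - a) * eps + eps * (b - t) by ring.
apply: lerD; last first.
  by apply: IH => // u /andP[tu ub]; rewrite hpsi// ub (le_trans (ltW at_)).
rewrite /GRing.scale /= normrM gtr0_norm ?subr_gt0// ler_pM2l ?subr_gt0//.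
have := hpsi x; rewrite ax (le_trans xt tb) => /(_ isT) hx.
by case: (s <= x); rewrite /= ?mulr1// mulr0 normr0 (le_trans (normr_ge0 _) hx).
Qed.

(** On one term of [step l], the product of the indicators of [s <= u] and [u <= x] is that of
    [s <= x] times the difference of those of [s <= u] and [x < u]. Both are indicators of upper
    sets in [u], for which [rsum_upset] has an error independent of [s]. *)
Lemma tail_sum_step_cauchy a b l eps : 0 < eps ->
  exists2 delta, 0 < delta & forall p q s, tpart delta a b p -> tpart delta a b q ->
    `|tail_sum (step l) a p s - tail_sum (step l) a q s| <= eps.
Proof.
elim: l eps => [|[c x] l IH] eps e0.
  exists 1 => // p q s _ _; rewrite /tail_sum.
  have H r : rsum (V := R^o) (fun u => step [::] u * (s <= u)%R%:R) a r = 0.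
    rewrite (_ : (fun u => _) = fun u => 0 *: (0 : R^o)); first by rewrite rsumZ scale0r.
    by apply/funext => u; rewrite /step big_nil mul0r scale0r.
  by rewrite !H subrr normr0 ltW.
have [|d1 d10 h1] := IH (eps / 2); first lra.
(* Each of the two indicator sums varies by at most [2 * d2] between [p] and [q]; the summand 1
   covers [c = 0]. *)
pose d2 := eps / 2 / (4 * (`|c| + 1)).
have c0 := normr_ge0 c.
have d20 : 0 < d2 by rewrite !divr_gt0// mulr_gt0//; lra.
have hd2 : 4 * (`|c| + 1) * d2 = eps / 2.
  by rewrite /d2 mulrCA mulfV ?mulr1// gt_eqF// mulr_gt0//; lra.
exists (Num.min d1 d2); first by rewrite lt_min d10.
move=> p q s /tpart_min[p1 p2] /tpart_min[q1 q2].
have E r : tail_sum (step ((c, x) :: l)) a r s =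
    (s <= x)%R%:R * c * (rsum (V := R^o) (fun u => (s <= u)%R%:R) a r -
      rsum (V := R^o) (fun u => (x < u)%R%:R) a r) + tail_sum (step l) a r s.
  rewrite -rsumB -[_ * _]/(((s <= x)%R%:R * c) *: (_ : R^o)) -rsumZ /tail_sum -rsumD.
  congr (rsum _ _ _); apply/funext => u; rewrite /step big_cons /= mulrDl.
  congr (_ + _); rewrite /GRing.scale /=.
  have [sx|xs] := leP s x; have [ux|xu] := leP u x; have [su|us] := leP s u;
    rewrite /= ?mulr0 ?mulr1 ?mul0r ?mul1r ?subr0 ?subrr ?mulr0 //; lra.
have up (P : pred R) z r r' : (forall u, z < u -> P u) -> (forall u, u < z -> ~~ P u) ->
    tpart d2 a b r -> tpart d2 a b r' ->
    `|rsum (V := R^o) (fun u => (P u)%:R) a r -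
      rsum (V := R^o) (fun u => (P u)%:R) a r'| <= 2 * d2.
  move=> P1 P2 /(rsum_upset P1 P2 (ltW d20)) + /(rsum_upset P1 P2 (ltW d20)).
  by rewrite !ler_distl; lra.
have u1 : `|rsum (V := R^o) (fun u => (s <= u)%R%:R) a p -
      rsum (V := R^o) (fun u => (s <= u)%R%:R) a q| <= 2 * d2.
  apply: (up (fun u => s <= u) s) => // [u /ltW //|u]; by rewrite -ltNge.
have u2 : `|rsum (V := R^o) (fun u => (x < u)%R%:R) a p -
      rsum (V := R^o) (fun u => (x < u)%R%:R) a q| <= 2 * d2.
  by apply: (up (fun u => x < u) x) => // u ux; rewrite -leNgt ltW.
rewrite !E opprD addrACA -mulrBr (le_trans (ler_normD _ _))//.
have -> : eps = eps / 2 + eps / 2 by lra.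
apply: lerD; last exact: h1.
rewrite -hd2 !normrM -mulrA.
have bb : `|(s <= x)%R%:R| <= 1 :> R by case: (s <= x); rewrite ?normr1 ?normr0.
move: u1 u2; set A1 := rsum _ _ _; set A2 := rsum _ _ _.
set B1 := rsum _ _ _; set B2 := rsum _ _ _ => u1 u2.
have : `|A1 - B1 - (A2 - B2)| <= 4 * d2.
  by move: u1 u2; rewrite !ler_norml; lra.
set D := `|_ - _ - _| => hD.
have D0 : 0 <= D := normr_ge0 _.
rewrite (@le_trans _ _ (1 * (`|c| * D)))//; first by rewrite ler_wpM2r// mulr_ge0.
rewrite mul1r (@le_trans _ _ (`|c| * (4 * d2)))//; first by rewrite ler_wpM2l.
by nra.
Qed.

(** Uniformity in [s] is the point: the difference of two tail sums becomes a uniformly small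
    multiplier, to which [Rm_small] applies. *)
Lemma tail_sum_cauchy a b psi eps : a <= b -> Dminus a b psi -> 0 < eps ->
  exists2 delta, 0 < delta & forall p q s, tpart delta a b p -> tpart delta a b q ->
    `|tail_sum psi a p s - tail_sum psi a q s| <= eps.
Proof.
move=> ab hpsi e0; pose e1 := eps / (4 * (b - a + 1)).
have e10 : 0 < e1 by rewrite divr_gt0// mulr_gt0//; lra.
have he1 : 4 * (b - a + 1) * e1 = eps.
  by rewrite /e1 mulrCA mulfV ?mulr1// gt_eqF// mulr_gt0//; lra.
have [l hl] := Dminus_step ab hpsi e10.
have [|d d0 h] := @tail_sum_step_cauchy a b l (eps / 4); first lra.
exists d => // p q s hp hq.
have E r : tail_sum psi a r s = tail_sum (step l) a r s +
    tail_sum (fun u => psi u - step l u) a r s.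
  by rewrite -tail_sumD; congr (tail_sum _ _ _ _); apply/funext => u; rewrite addrC subrK.
have h1 := tail_sum_le s hl hp; have h2 := tail_sum_le s hl hq.
have := h p q s hp hq; rewrite !E.
have : e1 * (b - a) <= eps / 4 by nra.
move: h1 h2; rewrite !ler_norml; lra.
Qed.

Lemma Dminus_tail_sum a b psi u p : Dminus a b (tail_sum psi u p).
Proof.
rewrite /tail_sum; elim: p u => [|[x t] p IH] u /=; first exact: Dminus_cst.
apply: DminusD; last exact: IH.
apply: (@DminusM _ _ _ (fun=> t - u)); first exact: Dminus_cst.
by apply: DminusM; [exact: Dminus_cst|exact: Dminus_indic].
Qed.

End IndicatorSums.

(** * Equicontinuity of the integral *)

Section Multipliers.
Context {R : realType} {V : lmodType R} (N : V -> R) (NF : fnorm N).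
Implicit Types (a b c delta eps : R) (p q : seq (R * R)) (phi psi : R -> R)
  (X F G : R -> V).

Definition Rm X a b : Prop := forall phi, Dminus a b phi ->
  exists I, isint N (fun t => phi t *: X t) a b I.

Lemma rsum_mul_small X delta a b p eps : tpart delta a b p -> 0 < eps ->
  exists2 eta, 0 < eta & forall phi, (forall t, a <= t <= b -> `|phi t| <= eta) ->
    N (rsum (fun t => phi t *: X t) a p) < eps.
Proof.
elim: p a eps => [|[x t] p IH] a eps /=.
  by move=> _ e0; exists 1 => // phi _; rewrite (fnorm0 NF).
move=> [at_ _ /andP[ax xt] h] e0; have tb := tpart_le h.
have [|n1 n10 h1] := IH t (eps / 2) h; first lra.
have [|n2 n20 h2] := fnorm_absorb NF ((t - a) *: X x) (eps := eps / 2); first lra.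
exists (Num.min n1 n2); first by rewrite lt_min n10.
move=> phi hphi; have := fnorm_triangle NF ((t - a) *: (phi x *: X x))
  (rsum (fun t0 => phi t0 *: X t0) t p).
have := h1 phi; have := h2 (phi x).
rewrite !scalerA (mulrC (phi x)).
have := hphi x; rewrite ax (le_trans xt tb) le_min => /(_ isT)/andP[_ ->] /(_ isT).
move=> k1 k2; have := k2 _; suff hh : forall u, t <= u <= b -> `|phi u| <= n1.
  by move=> /(_ hh); lra.
move=> u /andP[tu ub]; have := hphi u; rewrite ub (le_trans (ltW at_))//.
by rewrite le_min => /(_ isT)/andP[].
Qed.

(** As [eta n / 2 <= eta n - eta n.+1], the intervals of centre [Phi n t] and radius [eta n] are
    nested; the supremum of their left ends lies in all of them. *)
Lemma nested_limit (P : R -> Prop) (Phi : nat -> R -> R) (eta : nat -> R) :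
  (forall n, 0 < eta n) -> (forall n, eta n.+1 <= eta n / 2) ->
  (forall n t, P t -> `|Phi n.+1 t - Phi n t| <= eta n / 2) ->
  exists phi, forall n t, P t -> `|phi t - Phi n t| <= eta n.
Proof.
move=> e0 he hP.
have mono n k t : P t -> `|Phi (n + k)%N t - Phi n t| <= eta n - eta (n + k)%N.
  move=> Pt; elim: k => [|k]; first by rewrite addn0 !subrr normr0.
  rewrite addnS => IH; have := he (n + k)%N; have := hP (n + k)%N t Pt.
  have := ler_normD (Phi (n + k).+1 t - Phi (n + k)%N t) (Phi (n + k)%N t - Phi n t).
  by rewrite addrA subrK; lra.
have mono' m n t : P t -> Phi m t - eta m <= Phi n t + eta n.
  move=> Pt; have em := e0 m; have en := e0 n.
  have [mn|nm] := leqP m n.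
    by have := mono m (n - m)%N t Pt; rewrite subnKC// ler_distl; lra.
  by have := mono n (m - n)%N t Pt; rewrite subnKC ?(ltnW nm)// ler_distl; lra.
exists (fun t => sup (range (fun n => Phi n t - eta n))) => n t Pt.
rewrite ler_distl; apply/andP; split.
  apply: sup_upper_bound; last by exists n.
  split; first by exists (Phi 0%N t - eta 0%N); exists 0%N.
  by exists (Phi 0%N t + eta 0%N) => _ [m _ <-]; exact: mono'.
apply: sup_le_ub; first by exists (Phi 0%N t - eta 0%N); exists 0%N.
by move=> _ [m _ <-]; exact: mono'.
Qed.

(* Gliding hump: otherwise a uniformly convergent series of ever smaller
   functions phi_k in D^- can be built together with two partitions p_k, q_k of
   mesh tending to 0, the hump phi_k being visible on q_k and neither on p_k nor
   on the partitions of the earlier stages; the sums of the limit are then not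
   Cauchy. *)
Lemma Rm_equicontinuous X a b : a <= b -> Rm X a b -> forall eps, 0 < eps ->
  exists eta delta : R, [/\ 0 < eta, 0 < delta &
    forall phi, Dminus a b phi -> (forall t, a <= t <= b -> `|phi t| <= eta) ->
    forall p, tpart delta a b p -> N (rsum (fun t => phi t *: X t) a p) <= eps].
Proof.
move=> ab hX e e0; apply: contrapT => hno.
have bad (eta : R) : 0 < eta -> exists phi p, [/\ Dminus a b phi,
    forall t, a <= t <= b -> `|phi t| <= eta, tpart eta a b p &
    e < N (rsum (fun t => phi t *: X t) a p)].
  move=> eta0; apply: contrapT => h; apply: hno; exists eta, eta; split => //.
  move=> phi h1 h2 p hp; rewrite leNgt; apply/negP => h3; apply: h.
  by exists phi, p.
pose S := {z : (R -> R) * R | Dminus a b z.1 /\ 0 < z.2}.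
(* A state is a partial sum of the series together with a tolerance. The oscillation is required for
   every [chi] within the new tolerance, so that it survives all later stages and holds for the
   limit. *)
pose nxt (s s' : S) :=
  [/\ (forall t, a <= t <= b -> `|(sval s').1 t - (sval s).1 t| <= (sval s).2 / 2),
    (sval s').2 <= (sval s).2 / 2 &
    exists p q, [/\ tpart (sval s).2 a b p, tpart (sval s).2 a b q &
      forall chi, (forall t, a <= t <= b -> `|chi t - (sval s').1 t| <= (sval s').2) ->
      e / 2 < N (rsum (fun t => chi t *: X t) a q - rsum (fun t => chi t *: X t) a p)]].
have step_ s : exists s', nxt s s'.
  case: s => -[Phi eta] /= [hPhi eta0]; rewrite /nxt /=.
  have e20 : 0 < e / 20 by lra.
  have [I hI] := hX _ hPhi; have [d d0 hd] := hI _ e20.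
  have [|p hp0] := @tpart_exists_any _ (Num.min d eta) a b _ ab.
    by rewrite lt_min d0.
  have [hpd hp] := tpart_min hp0.
  have [n1 n10 h1] := rsum_mul_small X hp e20.
  (* [m] bounds both the height of the new hump and the mesh of [q]: below [d], the sums of [Phi]
     over [p] and [q] are close; at most [eta / 2], the tolerances nest; below [n1], the hump is
     invisible on [p]. *)
  pose m := Num.min (Num.min d eta) n1 / 2.
  have m0 : 0 < m by rewrite divr_gt0// !lt_min d0 eta0 n10.
  have m2 : m < Num.min (Num.min d eta) n1 by rewrite /m; move: m0; rewrite /m; lra.
  have [md me mn] : [/\ m < d, m <= eta / 2 & m < n1].
    move: (m2); rewrite !lt_min => /andP[/andP[-> _] ->]; split => //.
    by rewrite /m ler_pM2r// !ge_min lexx orbT.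
  have [phi [q [D1 D2 hq hN]]] := bad m m0.
  have hqd := tpart_weaken (ltW md) hq.
  have hqe : tpart eta a b q by apply: tpart_weaken hq; lra.
  have [n2 n20 h2] := rsum_mul_small X hqe e20.
  (* Later corrections, bounded by [m'], stay small on [q] by [n2] and on [p] by [m < n1]. *)
  pose m' := Num.min m n2.
  have m'0 : 0 < m' by rewrite lt_min m0.
  have D3 : Dminus a b (fun t => Phi t + phi t) by exact: DminusD.
  exists (exist _ ((fun t => Phi t + phi t), m') (conj D3 m'0)) => /=; split.
  - move=> t /D2 ht; rewrite addrAC subrr add0r; exact: le_trans ht me.
  - by rewrite (le_trans _ me)// ge_min lexx.
  exists p, q; split => // chi hchi.
  pose xi t := chi t - (Phi t + phi t).
  have E u r : rsum (fun t => chi t *: X t) u r =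
      rsum (fun t => Phi t *: X t) u r + rsum (fun t => phi t *: X t) u r +
      rsum (fun t => xi t *: X t) u r.
    rewrite -!rsumD; congr (rsum _ _ _); apply/funext => t.
    by rewrite -!scalerDl /xi addrC subrK.
  have xip : N (rsum (fun t => xi t *: X t) a p) < e / 20.
    apply: h1 => t /hchi ht; apply: (le_trans ht).
    by rewrite (@le_trans _ _ m) ?(ltW mn)// ge_min lexx.
  have xiq : N (rsum (fun t => xi t *: X t) a q) < e / 20.
    by apply: h2 => t /hchi ht; apply: (le_trans ht); rewrite ge_min lexx orbT.
  have php : N (rsum (fun t => phi t *: X t) a p) < e / 20.
    by apply: h1 => t /D2 ht; apply: (le_trans ht); exact: ltW.
  have k1 := hd _ hpd; have k2 := hd _ hqd.
  rewrite !E.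
  set A := rsum _ a q in k2 *; set B := rsum _ a q in hN *.
  set C := rsum _ a q in xiq *; set A' := rsum _ a p in k1 *.
  set B' := rsum _ a p in php *; set C' := rsum _ a p in xip *.
  have -> : A + B + C - (A' + B' + C') = B + ((A - A') + (C - C') - B').
    rewrite opprD [LHS]addrACA opprD (addrACA A) (addrCA (A - A')) -addrA.
    by congr (_ + _); rewrite addrAC.
  have := fnorm_dist0 NF B (- (A - A' + (C - C') - B')); rewrite opprK fnormN//.
  have := fnormB NF (A - A' + (C - C')) B'.
  have := fnorm_triangle NF (A - A') (C - C').
  have := fnormB NF C C'.
  have := fnorm_dist NF A I A'; rewrite (fnormC NF I).
  lra.
have [f hf] := choice step_.
have s0P : Dminus a b (fun=> 0) /\ 0 < 1 :> R by split=> //; exact: Dminus_cst.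
pose s0 : S := exist _ (fun=> 0, 1) s0P.
pose s n := iter n f s0.
have hs n : nxt (s n) (s n.+1) by exact: hf.
pose Phi n := (sval (s n)).1; pose eta n := (sval (s n)).2.
have eta0 n : 0 < eta n by case: (svalP (s n)).
have eta2 n : eta n.+1 <= eta n / 2 by case: (hs n).
(* Forces the tolerances, hence the meshes of the partitions, to tend to 0. *)
have etan n : n.+1%:R * eta n <= 1.
  elim: n => [|n IH]; first by rewrite mul1r /eta.
  have := eta2 n; have := eta0 n; have n0 : 0 <= n%:R :> R by [].
  move: IH; rewrite -(natr1 n.+1) -(natr1 n); nra.
have [|phi hphi] := @nested_limit (fun t => a <= t <= b) Phi eta eta0 eta2.
  by move=> n t ht; case: (hs n) => + _ _; exact.
have small d : 0 < d -> exists n, eta n < d.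
  move=> d0; exists (Num.truncn d^-1).
  have := truncnS_gt d^-1; have := etan (Num.truncn d^-1).
  set M := _.+1%:R => h1 h2.
  have : 1 < M * d by rewrite -ltr_pdivrMr// mul1r.
  by have M0 : 0 < M := ltr0Sn _ _; nra.
have Dphi : Dminus a b phi.
  apply: Dminus_lim => d /small[n hn]; exists (Phi n).
    by case: (svalP (s n)).
  by move=> t /(hphi n) ht; exact: le_trans ht (ltW hn).
have [I hI] := hX _ Dphi.
have [|d d0 hd] := hI (e / 4); first lra.
have [n hn] := small d d0.
have [_ _ [p [q [hp hq hpq]]]] := hs n.
have := hpq phi (hphi n.+1).
have := hd p (tpart_weaken (ltW hn) hp); have := hd q (tpart_weaken (ltW hn) hq).
have := fnorm_dist NF (rsum (fun t => phi t *: X t) a q) I (rsum (fun t => phi t *: X t) a p).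
by rewrite (fnormC NF I); lra.
Qed.

Lemma Rm_small X a b : a <= b -> Rm X a b -> forall eps, 0 < eps ->
  exists2 eta, 0 < eta & forall phi I, Dminus a b phi ->
    (forall t, a <= t <= b -> `|phi t| <= eta) ->
    isint N (fun t => phi t *: X t) a b I -> N I <= eps.
Proof.
move=> ab hX e e0; have [|n [d [n0 d0 h]]] := Rm_equicontinuous ab hX (eps := e / 2).
  lra.
exists n => // phi I D1 D2 hI; have [|d' d'0 h'] := hI (e / 2); first lra.
have [|p /tpart_min[p1 p2]] := @tpart_exists_any _ (Num.min d d') a b _ ab.
  by rewrite lt_min d0.
have := h phi D1 D2 p p1; have := h' p p2.
have := fnorm_dist0 NF I (rsum (fun t => phi t *: X t) a p).
by rewrite (fnormC NF I); lra.
Qed.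

End Multipliers.

(** * Integration by parts *)

Section Primitives.
Context {R : realType}.
Implicit Types (a b c delta eps : R) (p q : seq (R * R)) (phi psi : R -> R).

(** Lets scalar integrals be obtained from the abstract [isint_cauchy]. *)
Lemma fnorm_normr : fnorm (V := R^o) (fun x : R => `|x|).
Proof.
split => /=.
- exact: normr0.
- exact: normrN.
- exact: ler_normD.
- by move=> k x k1; rewrite normrM ler_piMl.
- move=> x e e0; exists (e / (`|x| + 1)).
    by rewrite divr_gt0// ltr_wpDl.
  have x1 : 0 < `|x| + 1 by rewrite ltr_wpDl.
  move=> k; rewrite ler_pdivlMr// /GRing.scale /= normrM => kx.
  have : 0 <= `|k| := normr_ge0 k.
  have [->|k0] := eqVneq `|k| 0; first by rewrite mul0r.
  rewrite le_eqVlt eq_sym (negbTE k0) /=; nra.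
move=> u hu; have : cvg (u @ \oo).
  apply: cauchy_cvg; apply: cauchy_exP => e e0.
  have [n0 h] := hu e e0; exists (u n0), n0 => // n /= n0n.
  by rewrite /ball /=; exact: h.
move=> /cvg_ex[l /cvgrPdist_lt hl]; exists l => e e0.
have [n0 _ h] := hl e e0; exists n0 => n n0n.
by rewrite distrC; exact: h.
Qed.

(** The tag is [- ln r] for the mean slope [r]; it lies in the cell because the inequality 1 + x <=
    e^x, applied at both ends, puts [r] between [expR (- v)] and [expR (- u)]. *)
Lemma expN_mean (u v : R) : u < v ->
  exists2 x, u <= x <= v & (v - u) * expR (- x) = expR (- u) - expR (- v).
Proof.
move=> uv; have uv0 : 0 < v - u by rewrite subr_gt0.
pose r := (expR (- u) - expR (- v)) / (v - u).
have e1 : expR (- u) = expR (- v) * expR (v - u) by rewrite -expRD; congr expR; lra.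
have e2 : expR (- v) = expR (- u) * expR (- (v - u)) by rewrite -expRD; congr expR; lra.
have rv : expR (- v) <= r.
  rewrite ler_pdivlMr// e1; have := expR_ge1Dx (v - u); have := expR_gt0 (- v); nra.
have ru : r <= expR (- u).
  rewrite ler_pdivrMr// e2; have := expR_ge1Dx (- (v - u)).
  have := expR_gt0 (- u); nra.
have r0 : 0 < r := lt_le_trans (expR_gt0 _) rv.
exists (- ln r).
  rewrite lerNr lerNl -(ler_expR (ln r)) -(ler_expR (- v)).
  by rewrite lnK ?posrE// ru.
by rewrite opprK lnK ?posrE// /r mulrCA mulfV ?mulr1// gt_eqF.
Qed.

(** With mean-value tags the tail sums telescope exactly, except on the cell containing [s], where
    the error is at most the increment of [expR (- u)] over that cell. *)
Lemma tpart_exists_expN a b delta : 0 < delta -> a <= b ->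
  exists p, [/\ tpart delta a b p,
    forall s, s <= a ->
      tail_sum (fun u => expR (- u)) a p s = expR (- a) - expR (- b) &
    forall s, a <= s <= b ->
      `|tail_sum (fun u => expR (- u)) a p s - (expR (- s) - expR (- b))| <=
        expR (- a) * delta].
Proof.
move=> d0 ab; have [p hp hG] := tpart_exists expN_mean d0 ab.
have := hG (fun u _ p =>
  (forall s, s <= u ->
    tail_sum (fun u => expR (- u)) u p s = expR (- u) - expR (- b)) /\
  (a <= u -> forall s, u <= s <= b ->
      `|tail_sum (fun u => expR (- u)) u p s - (expR (- s) - expR (- b))| <=
        expR (- a) * delta)).
case.
- split=> [s _|_ s sb]; first by rewrite /tail_sum /= subrr.
  have -> : s = b by lra.
  by rewrite /tail_sum /= !subrr normr0 mulr_ge0 ?expR_ge0// ltW.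
- move=> u x v q uv /andP[ux xv] hx vu hq [h1 h2].
  have tE s : tail_sum (fun u => expR (- u)) u ((x, v) :: q) s =
      (expR (- u) - expR (- v)) * (s <= x)%R%:R +
      tail_sum (fun u => expR (- u)) v q s.
    by rewrite /tail_sum /= -hx /GRing.scale /= mulrA.
  have A s : s <= x -> tail_sum (fun u => expR (- u)) u ((x, v) :: q) s =
      expR (- u) - expR (- b).
    by move=> sx; rewrite tE sx /= mulr1 h1 ?(le_trans sx)//; lra.
  split=> [s su|au s /andP[us sb]]; first by rewrite A// (le_trans su).
  have d1 : expR (- u) - expR (- v) <= expR (- a) * delta.
    rewrite -hx; have : expR (- x) <= expR (- a) by rewrite ler_expR; lra.
    by have := expR_gt0 (- x); nra.
  have su : expR (- s) <= expR (- u) by rewrite ler_expR; lra.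
  have [sx|xs] := leP s x.
    rewrite A//; have : expR (- v) <= expR (- s) by rewrite ler_expR; lra.
    by rewrite ger0_norm; lra.
  have [sv|vs] := leP s v; last first.
    rewrite tE (lt_geF xs) /= mulr0 add0r; apply: h2; last by rewrite sb ltW.
    lra.
  rewrite tE (lt_geF xs) /= mulr0 add0r h1//.
  have vs : expR (- v) <= expR (- s) by rewrite ler_expR; lra.
  by rewrite ler0_norm; lra.
by move=> h1 /(_ (lexx a)) h2; exists p.
Qed.

Context {V : lmodType R} (N : V -> R) (NF : fnorm N).
Implicit Types (X F G : R -> V).

Lemma rsum_cst psi (x : V) delta a b p s : s <= a -> tpart delta a b p ->
  rsum (fun t => psi t *: x) a p = tail_sum psi a p s *: x.
Proof.
rewrite /tail_sum; elim: p a => [|[y t] p IH] a sa /=; first by rewrite scale0r.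
move=> [at_ _ /andP[ay yt] h]; rewrite (IH t) ?(le_trans sa (ltW at_))//.
by rewrite (le_trans sa ay) mulr1 [RHS]scalerDl [in LHS]scalerA.
Qed.

Lemma isint_cst a b psi : a <= b -> Dminus a b psi ->
  exists c, forall x, isint N (fun t => psi t *: x) a b (c *: x).
Proof.
move=> ab hpsi; have [|c hc] := isint_cauchy fnorm_normr ab (f := fun t => psi t : R^o).
  move=> e e0; have [|d d0 h] := tail_sum_cauchy ab hpsi (eps := e / 2); first lra.
  exists d => // p q hp hq; have := h p q a hp hq.
  have E r : tpart d a b r -> rsum (fun t => psi t : R^o) a r = tail_sum psi a r a.
    move=> hr; apply: (rsum_ext _ hr) => t /andP[at_ _] /=.
    by rewrite at_ mulr1.
  by rewrite !E//; lra.
exists c => x e e0; have [eta eta0 h] := fnorm_absorb NF x e0.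
have [d d0 h'] := hc eta eta0; exists d => // p hp.
have -> : rsum (fun t => psi t *: x) a p = rsum (fun t => psi t : R^o) a p *: x.
  elim: p a {ab hpsi hc h' hp} => [|[y t] p IH] a /=; first by rewrite scale0r.
  by rewrite IH [RHS]scalerDl [in LHS]scalerA.
by rewrite -scalerBl; apply: h; rewrite ltW// h'.
Qed.

Lemma isint_expN_cst a b x : a <= b ->
  isint N (fun t => expR (- t) *: x) a b ((expR (- a) - expR (- b)) *: x).
Proof.
move=> ab; have [|c hc] := @isint_cst a b (fun t => expR (- t)) ab.
  apply: Dminus_continuous => t; apply: continuous_comp; first exact: opp_continuous.
  exact: continuous_expR.
apply: (isint_eq NF (hc x)) => e d e0 d0.
have [p [hp h _]] := tpart_exists_expN d0 ab.
exists p => //; rewrite (rsum_cst _ _ (lexx a) hp) h//.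
by rewrite subrr (fnorm0 NF) ltW.
Qed.

Lemma isint_tail_sum X F delta a b p psi : Rm N X a b ->
  (forall u, a <= u <= b -> isint N X a u (F u)) -> tpart delta a b p ->
  isint N (fun s => tail_sum psi a p s *: X s) a b (rsum (fun t => psi t *: F t) a p).
Proof.
move=> hX hF.
(* Writing all the [F x] as integrals over the same interval [[a, b]] lets them be combined
   linearly. Existence comes from the indicator being in D^-, the value from [isint_restrict]. *)
have ind x : a <= x <= b -> isint N (fun s => (s <= x)%R%:R *: X s) a b (F x).
  move=> /andP[ax xb]; have [I hI] := hX _ (Dminus_indic a b x).
  apply: isint_cvg (hI) => //.
  apply: (isint_unique NF (a := a) (b := x) (f := X)) => //.
    apply: (isint_restrict (c := b)); first by rewrite ax.
    apply: isint_ext hI => t _; case: ifP => _; by rewrite ?scale1r ?scale0r.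
  by apply: hF; rewrite ax.
suff H u : a <= u -> tpart delta u b p ->
    isint N (fun s => tail_sum psi u p s *: X s) a b (rsum (fun t => psi t *: F t) u p).
  exact: H.
elim: p u => [|[x t] p IH] u au /=.
  move=> _ e e0; exists 1 => // q _.
  rewrite (_ : (fun s => _) = fun s => 0 *: X s); last first.
    by apply/funext => s; rewrite /tail_sum.
  by rewrite rsumZ scale0r subrr (fnorm0 NF).
move=> [ut _ /andP[ux xt] h]; have tb := tpart_le h.
have ax : a <= x <= b by lra.
have := isintD NF (isintZ NF (t - u) (isintZ NF (psi x) (ind x ax)))
  (IH t (le_trans au (ltW ut)) h).
apply: isint_ext => s _; rewrite /tail_sum /= [RHS]scalerDl.
by congr (_ + _); rewrite [in LHS]scalerA [in LHS]scalerA -mulrA.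
Qed.

Lemma Rm_primitive X F a b : a <= b -> Rm N X a b ->
  (forall u, a <= u <= b -> isint N X a u (F u)) -> Rm N F a b.
Proof.
move=> ab hX hF psi hpsi; apply: isint_cauchy => // e e0.
have [|eta eta0 h] := Rm_small NF ab hX (eps := e / 2); first lra.
have [d d0 hd] := tail_sum_cauchy ab hpsi eta0.
exists d => // p q hp hq.
have := isintB NF (isint_tail_sum psi hX hF hp) (isint_tail_sum psi hX hF hq).
move=> hI; suff : N (rsum (fun t => psi t *: F t) a p - rsum (fun t => psi t *: F t) a q) <= e / 2.
  by lra.
apply: (h (fun s => tail_sum psi a p s - tail_sum psi a q s)).
- by apply: DminusB; exact: Dminus_tail_sum.
- by move=> t _; exact: hd.
- by apply: isint_ext hI => t _; rewrite scalerBl.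
Qed.

Lemma Rm_mul X a b psi : Dminus a b psi -> Rm N X a b ->
  Rm N (fun t => psi t *: X t) a b.
Proof.
move=> hpsi hX phi hphi; have [I hI] := hX _ (DminusM hphi hpsi).
by exists I; apply: isint_ext hI => t _; rewrite scalerA.
Qed.

Lemma Dminus_expN a b : Dminus a b (fun t : R => expR (- t)).
Proof.
apply: Dminus_continuous => t; apply: continuous_comp; first exact: opp_continuous.
exact: continuous_expR.
Qed.

Lemma isint_expN_primitive X F a b I : a <= b -> Rm N X a b ->
  isint N X a b I ->
  (forall u, a <= u <= b -> isint N (fun s => expR s *: X s) a u (F u)) ->
  isint N (fun t => expR (- t) *: F t) a b (I - expR (- b) *: F b).
Proof.
move=> ab hX hI hF.
have De : Dminus a b (fun t => expR t) by apply: Dminus_continuous; exact: continuous_expR.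
have hE := Rm_mul De hX.
have [J hJ] := Rm_primitive ab hE hF (Dminus_expN a b).
apply: (isint_eq NF hJ) => e d e0 d0.
have [eta eta0 h] := Rm_small NF ab hE e0.
(* The mesh [eta / expR (- a)] turns the error [expR (- a) * delta] of the tail sums into at most
   [eta]. *)
have [|p [/tpart_min[hp _] _ hs]] :=
    @tpart_exists_expN a b (Num.min d (eta / expR (- a))) _ ab.
  by rewrite lt_min d0 divr_gt0// expR_gt0.
exists p => //.
have h1 := isint_tail_sum (fun t => expR (- t)) hE hF hp.
(* The target value is itself an integral of [expR s *: X s], with multiplier
   [expR (- s) - expR (- b)], the uniform limit of the tail sums. *)
have h2 := isintB NF hI (isintZ NF (expR (- b)) (hF b _)).
have {}h2 := h2 (introT andP (conj ab (lexx b))).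
apply: (h (fun s => tail_sum (fun u => expR (- u)) a p s - (expR (- s) - expR (- b)))).
- apply: DminusB; first exact: Dminus_tail_sum.
  by apply: DminusB; [exact: Dminus_expN|exact: Dminus_cst].
- move=> t /hs ht; apply: (le_trans ht).
  by rewrite mulrC -ler_pdivlMr ?expR_gt0// ge_min lexx orbT.
- apply: isint_ext (isintB NF h1 h2) => t _.
  rewrite [RHS]scalerBl; congr (_ - _); rewrite [RHS]scalerBl.
  by congr (_ - _); rewrite scalerA -expRD addNr expR0 scale1r.
Qed.

End Primitives.

(** * The Langevin equation for an abstract primitive *)

Section LangevinCore.
Context {R : realType} {V : lmodType R} (N : V -> R) (NF : fnorm N).
Variables (X G : R -> V).
Hypothesis hX : forall a b, a <= b -> Rm N X a b.
Hypothesis hG : forall a b, a <= b ->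
  isint N (fun s => expR s *: X s) a b (G b - G a).

(** [G t] stands for the integral of [expR s *: X s] over ]-oo, t], known here only through its
    increments, and [Z t] for the integral of X against e^{-(t-s)}. *)
Let Z t := expR (- t) *: G t.

(** [G] is the primitive vanishing at [a] plus the constant vector [G a]; the two parts are
    integrated separately. *)
Lemma Langevin_Rm a b : a <= b -> Rm N Z a b.
Proof.
move=> ab phi hphi.
have De : Dminus a b (fun t : R => expR t) by apply: Dminus_continuous; exact: continuous_expR.
have hE := Rm_mul De (hX ab).
have hD := DminusM hphi (Dminus_expN a b).
have [|J hJ] := Rm_primitive NF ab hE (F := fun u => G u - G a) _ hD.
  by move=> u /andP[au _]; exact: hG.
have [c hc] := isint_cst NF ab hD.
exists (J + c *: G a); apply: isint_ext (isintD NF hJ (hc (G a))) => t _.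
by rewrite -scalerDr subrK scalerA.
Qed.

Lemma Langevin_identity a b : a <= b ->
  isint N (fun t => X t - Z t) a b (Z b - Z a).
Proof.
move=> ab; have [I hI] := hX ab (Dminus_cst a b 1).
have {}hI : isint N X a b I by apply: isint_ext hI => t _; rewrite scale1r.
have h1 := isint_expN_primitive NF ab (hX ab) hI (F := fun u => G u - G a) _.
have {}h1 := h1 (fun u hu => hG (proj1 (andP hu))).
have h2 := isintD NF h1 (isint_expN_cst NF (G a) ab).
have h3 := isintB NF hI h2.
have -> : Z b - Z a = I - (I - expR (- b) *: (G b - G a) +
    (expR (- a) - expR (- b)) *: G a).
  rewrite /Z scalerBr scalerBl; set u := _ *: G b; set v := expR (- a) *: _.
  set w := expR (- b) *: _; rewrite opprD addrA opprB addrCA subrr addr0.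
  by rewrite opprB addrA subrK.
apply: isint_ext h3 => t _; congr (_ - _).
by rewrite -scalerDr subrK.
Qed.

Lemma Langevin_continuous t eps : 0 < eps ->
  exists2 delta, 0 < delta & forall s, `|s - t| < delta -> N (Z s - Z t) < eps.
Proof.
move=> e0.
(* For [s] within 1 of [t], [expR (- s)] is at most [n]; an integer is wanted for [fnormZ_nat]. *)
pose n := (Num.truncn (expR (1 - t))).+1.
have n0 : 0 < n%:R :> R by [].
have en : expR (1 - t) <= n%:R by rewrite ltW// truncnS_gt.
have tt : t - 1 <= t + 1 by lra.
have e2 : 0 < eps / 2 / n%:R by rewrite divr_gt0//; lra.
have hG' u v : t - 1 <= u <= v -> v <= t + 1 ->
    isint N (fun s => expR s *: X s) u v (G v - G u).
  by move=> /andP[_ uv] _; exact: hG.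
have [d1 d10 h1] := isint_primitive_continuous NF tt hG' e2.
have [|eta eta0 h2] := fnorm_absorb NF (G t) (eps := eps / 2); first lra.
have /cvgrPdist_lt/(_ _ eta0)/nbhs_ballP[d2 /= d20 h3] :
    expR (- y) @[y --> t] --> expR (- t).
  have : continuous (fun y : R => expR (- y)).
    move=> y; apply: continuous_comp; first exact: opp_continuous.
    exact: continuous_expR.
  exact.
exists (Num.min 1 (Num.min d1 d2)); first by rewrite !lt_min d10 d20 ltr01.
move=> s; rewrite !lt_min => /and3P[s1 s2 s3].
have h4 : N (G s - G t) < eps / 2 / n%:R.
  have := s1; rewrite ltr_distl => /andP[s1a s1b].
  have := s2; rewrite ltr_distl => /andP[s2a s2b].
  have [st|ts] := leP s t.
    by rewrite (fnormC NF); apply: h1; lra.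
  by apply: h1; lra.
have -> : Z s - Z t = expR (- s) *: (G s - G t) + (expR (- s) - expR (- t)) *: G t.
  by rewrite scalerBr scalerBl addrA subrK.
have h5 : N (expR (- s) *: (G s - G t)) <= n%:R * N (G s - G t).
  apply: (fnormZ_nat NF); rewrite ger0_norm ?expR_ge0// (le_trans _ en)// ler_expR.
  by move: s1; rewrite ltr_distl; lra.
have h6 : N ((expR (- s) - expR (- t)) *: G t) < eps / 2.
  apply: h2; rewrite distrC ltW//; apply: h3.
  by rewrite /ball /= distrC.
have := fnorm_triangle NF (expR (- s) *: (G s - G t)) ((expR (- s) - expR (- t)) *: G t).
move: h4; rewrite ltr_pdivlMr// mulrC; lra.
Qed.

End LangevinCore.

(** * The F-norm of convergence in probability *)

Lemma minr1_triangle (R : realType) (a b c : R) : 0 <= a -> 0 <= b -> c <= a + b ->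
  Num.min c 1 <= Num.min a 1 + Num.min b 1.
Proof. by case: (leP a 1); case: (leP b 1); case: (leP c 1); lra. Qed.

Definition tmod (R : realType) (T : Type) (y : T -> R) (w : T) : R :=
  Num.min `|y w| 1.

HB.lock Definition Nrv (R : realType) (d : measure_display)
    (Omega : measurableType d) (P : probability Omega R)
    (y : {mfun Omega >-> R}) : R :=
  fine (\int[P]_w (tmod y w)%:E)%E.
Canonical Nrv_unlockable := Unlockable Nrv.unlock.

Section L0.
Context {R : realType} {d : measure_display} {Omega : measurableType d}.
Variable P : probability Omega R.
Local Notation V := {mfun Omega >-> R}.
Implicit Types (y z : V) (eps : R).

Lemma tmod_ge0 y w : 0 <= tmod y w.
Proof. by rewrite le_min normr_ge0/=. Qed.

Lemma tmod_le1 y w : tmod y w <= 1.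
Proof. by rewrite ge_min lexx orbT. Qed.

Lemma measurable_tmod (y : Omega -> R) : measurable_fun setT y ->
  measurable_fun setT (tmod y).
Proof.
move=> my; apply: measurable_minr; last exact: measurable_cst.
exact: measurableT_comp.
Qed.

Local Notation Nrv := (@Nrv R d Omega P).

Lemma measurable_etmod y : measurable_fun setT (fun w => (tmod y w)%:E).
Proof. by apply/measurable_EFinP; apply: measurable_tmod. Qed.

Lemma int_bounded_fin_num (f : Omega -> R) (c : R) : measurable_fun setT f ->
  (forall w, 0 <= f w <= c) -> (\int[P]_w (f w)%:E)%E \is a fin_num.
Proof.
move=> mf hf; rewrite ge0_fin_numE; last first.
  by apply: integral_ge0 => w _; rewrite lee_fin; case/andP: (hf w).
apply: (@le_lt_trans _ _ (\int[P]_w c%:E)%E).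
  apply: ge0_le_integral => //.
  - by move=> w _; rewrite lee_fin; case/andP: (hf w).
  - exact/measurable_EFinP.
  - by move=> w _; rewrite lee_fin; case/andP: (hf w).
by rewrite integral_cst//= probability_setT mule1 ltry.
Qed.

Lemma tmod_fin_num y : (\int[P]_w (tmod y w)%:E)%E \is a fin_num.
Proof.
apply: (@int_bounded_fin_num _ 1); first exact: measurable_tmod.
by move=> w; rewrite tmod_ge0 tmod_le1.
Qed.

Lemma FnormE y : Fnorm P y = (Nrv y)%:E.
Proof. by rewrite /Fnorm !unlock fineK// tmod_fin_num. Qed.

Lemma NrvE y : (Nrv y)%:E = (\int[P]_w (tmod y w)%:E)%E.
Proof. by rewrite unlock fineK// tmod_fin_num. Qed.

Lemma Nrv_le y z : (forall w, tmod y w <= tmod z w) -> Nrv y <= Nrv z.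
Proof.
move=> h; rewrite -lee_fin !NrvE; apply: ge0_le_integral => //.
- by move=> w _; rewrite lee_fin tmod_ge0.
- exact: measurable_etmod.
- exact: measurable_etmod.
- by move=> w _; rewrite lee_fin.
Qed.

Lemma Nrv_triangle y z : Nrv (y + z) <= Nrv y + Nrv z.
Proof.
rewrite -lee_fin EFinD !NrvE -ge0_integralD//; first last.
- exact: measurable_etmod.
- by move=> w _; rewrite lee_fin tmod_ge0.
- exact: measurable_etmod.
- by move=> w _; rewrite lee_fin tmod_ge0.
apply: ge0_le_integral => //.
- by move=> w _; rewrite lee_fin tmod_ge0.
- exact: measurable_etmod.
- by apply: emeasurable_funD; exact: measurable_etmod.
- move=> w _; rewrite -EFinD lee_fin; apply: minr1_triangle => //.
  exact: ler_normD.
Qed.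

Lemma Nrv_ge0 y : 0 <= Nrv y.
Proof.
by rewrite unlock fine_ge0// integral_ge0// => w _; rewrite lee_fin tmod_ge0.
Qed.

Lemma ae_cvg_Nrv (u : nat -> V) y :
  {ae P, forall w, u n w @[n --> \oo] --> y w} ->
  forall eps, 0 < eps -> exists n0, forall n, (n0 <= n)%N -> Nrv (u n - y) < eps.
Proof.
move=> uy eps e0.
have h1 n : measurable_fun setT (fun w => (tmod (u n - y) w)%:E).
  exact: measurable_etmod.
have h2 : {ae P, forall w, setT w ->
    (tmod (u n - y) w)%:E @[n --> \oo] --> cst 0%E w}.
  apply: filterS uy => w hw _ /=.
  apply/fine_cvgP; split; first exact: nearW.
  apply/cvgrPdist_lt => e e1; have /cvgrPdist_lt/(_ _ e1) := hw.
  apply: filterS => n hn /=; rewrite sub0r normrN ger0_norm ?tmod_ge0//.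
  by rewrite /tmod gt_min /= distrC [X in X || _]hn.
have h3 : {ae P, forall w n, setT w -> (`|(tmod (u n - y) w)%:E| <= cst 1 w)%E}.
  apply: aeW => w n _; rewrite /= lee_fin ger0_norm ?tmod_ge0//.
  exact: tmod_le1.
have h4 : P.-integrable setT (cst 1%E).
  exact: finite_measure_integrable_cst.
have [_ _] := dominated_convergence measurableT h1 (measurable_cst _) h2 h4 h3.
rewrite integral_cst//= mul0e.
move=> /fine_cvgP[_ /cvgrPdist_lt/(_ _ e0)[n0 _ h]].
exists n0 => n n0n; have := h n n0n.
by rewrite /= -NrvE /= sub0r normrN ger0_norm// Nrv_ge0.
Qed.

Lemma Nrv_eq0 y : Nrv y = 0 <-> {ae P, forall w, y w = 0}.
Proof.
split=> [y0|y0].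
  have : (\int[P]_w `|(tmod y w)%:E| = 0)%E.
    rewrite -[RHS]/(0%:E) -y0 NrvE; apply: eq_integral => w _.
    by rewrite gee0_abs// lee_fin tmod_ge0.
  move=> /(ae_eq_integral_abs P measurableT (measurable_etmod y)).
  apply: filterS => w /(_ I) [] /eqP; rewrite /tmod.
  case: leP => [_|_]; first by rewrite normr_eq0 => /eqP.
  by rewrite oner_eq0.
apply/eqP; rewrite eq_le Nrv_ge0 andbT; apply/ler_addgt0Pl => e e0; rewrite addr0.
have [|n h] := @ae_cvg_Nrv (fun=> y) 0 _ e e0.
  by apply: filterS y0 => w ->; exact: cvg_cst.
by have := h n (leqnn n); rewrite subr0 => /ltW.
Qed.

Lemma ae_eq_Nrv y z : Nrv (y - z) = 0 <-> {ae P, forall w, y w = z w}.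
Proof.
split=> [/Nrv_eq0|yz].
  by apply: filterS => w /eqP; rewrite subr_eq0 => /eqP.
apply/Nrv_eq0; apply: filterS yz => w yz.
by rewrite -[LHS]/(y w - z w) yz subrr.
Qed.

End L0.

(** * Geometric bounds for real sequences *)

Section RealSequences.
Context {R : realType}.
Implicit Types (x : nat -> R) (q C : R).

Lemma eventually_geometric_bound x q : 0 < q ->
  (exists n0, forall n, (n0 <= n)%N -> `|x n| <= q ^+ n) ->
  exists2 C, 0 <= C & forall n, `|x n| <= C * q ^+ n.
Proof.
(* The sum absorbs the finitely many exceptional indices, each of which is one of its terms. *)
move=> q0 [n0 h]; exists (1 + \sum_(k < n0) `|x k| / q ^+ k).
  rewrite addr_ge0// sumr_ge0// => k _.
  by rewrite divr_ge0// exprn_ge0// ltW.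
move=> n; have qn : 0 < q ^+ n by rewrite exprn_gt0.
have [/h hn|nn0] := leqP n0 n.
  rewrite (le_trans hn)// ler_peMl// ?(ltW qn)// lerDl sumr_ge0// => k _.
  by rewrite divr_ge0// exprn_ge0// ltW.
rewrite -ler_pdivrMr// (bigD1 (Ordinal nn0))//= addrCA lerDl addr_ge0// sumr_ge0//.
by move=> k _; rewrite divr_ge0// exprn_ge0// ltW.
Qed.

Lemma geometric_increments_cvg x q C : 0 < q -> q < 1 ->
  (forall n, `|x n.+1 - x n| <= C * q ^+ n) -> cvg (x n @[n --> \oo]).
Proof.
move=> q0 q1 h; have C0 : 0 <= C.
  by have := h 0%N; rewrite expr0 mulr1; exact: le_trans (normr_ge0 _).
have /cvg_ex[l hl] : cvgn (series (telescope x)).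
  apply: normed_cvg; apply: (@series_le_cvg _ _ (geometric C q)).
  - by move=> n; exact: normr_ge0.
  - by move=> n; rewrite /= mulr_ge0// exprn_ge0// ltW.
  - exact: h.
  - by apply: is_cvg_geometric_series; rewrite gtr0_norm.
apply/cvg_ex; exists (x 0%N + l).
rewrite (_ : (fun n => x n) = fun n => x 0%N + series (telescope x) n).
  by apply: cvgD => //; exact: cvg_cst.
by apply/funext => n; exact: eq_sum_telescope.
Qed.

Lemma nneseries_le_ub (a : nat -> \bar R) (C : \bar R) :
  (forall n, 0 <= a n)%E -> (forall n, \sum_(0 <= k < n) a k <= C)%E ->
  (\sum_(k <oo) a k <= C)%E.
Proof.
move=> a0 h; apply: lime_le; first exact: is_cvg_nneseries.
exact: nearW.
Qed.

End RealSequences.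

(** * Completeness of convergence in probability *)

Section L0Complete.
Context {R : realType} {d : measure_display} {Omega : measurableType d}.
Variable P : probability Omega R.
Local Notation V := {mfun Omega >-> R}.
Local Notation N := (@Nrv R d Omega P).
Implicit Types (y z : V) (eps : R).

Lemma ae_limit_exists (u : nat -> V) :
  {ae P, forall w, cvg (u n w @[n --> \oo])} ->
  exists y : V, {ae P, forall w, u n w @[n --> \oo] --> y w}.
Proof.
(* The upper limit is measurable on the whole space, including the null set where [u n w] diverges;
   [fine] makes it real-valued. *)
move=> hu; pose f w := fine (limn_esup (fun n => (u n w)%:E)).
have mf : measurable_fun setT f.
  apply: measurableT_comp => //; apply: measurable_fun_limn_esup => n.
  by apply/measurable_EFinP.
exists (mfun_Sub (mem_set mf : f \in mfun)).
apply: filterS hu => w /cvg_ex[l hl].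
change (u n w @[n --> \oo] --> f w); suff -> : f w = l by [].
rewrite /f; have hl' : (u n w)%:E @[n --> \oo] --> l%:E.
  by apply: cvg_comp hl _; exact: cvg_id.
rewrite limn_esup_lim; have /cvg_lim -> // := @cvg_esups _ _ _ hl'.
Qed.

Lemma measurable_normr_gt (c : R) y : measurable [set w | c < `|y w|].
Proof.
have mf : measurable_fun setT (fun w => `|y w|) by exact: measurableT_comp.
have := mf measurableT _ (measurable_itv `]c, +oo[); rewrite setTI.
by congr (measurable _); apply/seteqP; split=> w; rewrite /= in_itv /= andbT.
Qed.

(** Borel-Cantelli: the exceptional null set is the upper limit of the events [c n < |y n|]. *)
Lemma ae_eventually_le (y : nat -> V) (c : nat -> R) :
  (\sum_(n <oo) P [set w | (c n < `|y n w|)%R] < +oo)%E ->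
  {ae P, forall w, exists n0, forall n, (n0 <= n)%N -> `|y n w| <= c n}.
Proof.
move=> h; pose F n := [set w | c n < `|y n w|].
have mF n : measurable (F n) := measurable_normr_gt (c n) (y n).
exists (lim_sup_set F); split.
- apply: bigcap_measurable => // n _; exact: bigcup_measurable.
- exact: lim_sup_set_cvg0.
- move=> w /= hw n _; apply: contrapT => hn; apply: hw; exists n => m nm.
  rewrite leNgt; apply/negP => hm; apply: hn; exists m => //.
Qed.

Lemma Nrv_markov y (c : R) : 0 < c -> c <= 1 ->
  (P [set w | (c < `|y w|)%R] <= (N y / c)%:E)%E.
Proof.
move=> c0 c1; have mA := measurable_normr_gt c y.
rewrite mulrC EFinM lee_pdivlMl// NrvE -[X in P X]setIT.
rewrite -(integral_indic P measurableT mA).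
have i0 : forall w, setT w -> (0 <= (\1_[set w | c < `|y w|] w)%:E :> \bar R)%E.
  by move=> w _; rewrite lee_fin indicE.
have mi : measurable_fun setT (fun w => (\1_[set w | c < `|y w|] w : R)%:E).
  by apply/measurable_EFinP; exact: measurable_indic.
rewrite -ge0_integralZl_EFin//; last exact: ltW.
apply: ge0_le_integral => //.
- by move=> w _; rewrite -EFinM lee_fin mulr_ge0// ltW.
- exact: measurable_funeM.
- exact: measurable_etmod.
move=> w _; rewrite -EFinM lee_fin indicE.
case: (boolP (w \in _)); last by rewrite mulr0 tmod_ge0.
by rewrite inE /= mulr1 => cw; rewrite le_min c1 ltW.
Qed.

Lemma NrvN y : N (- y) = N y.
Proof.
apply/eqP; rewrite eq_le; apply/andP; split; apply: Nrv_le => w;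
  by rewrite /tmod /= normrN.
Qed.

Lemma NrvZ k y : `|k| <= 1 -> N (k *: y) <= N y.
Proof.
move=> k1; apply: Nrv_le => w; rewrite /tmod /=.
apply: (@le_trans _ _ (Num.min (`|k| * `|y w|) 1)); first by rewrite -normrM.
by rewrite le_min !ge_min lexx ler_piMl// orbT.
Qed.

Lemma Nrv_absorb y eps : 0 < eps ->
  exists2 eta, 0 < eta & forall k, `|k| <= eta -> N (k *: y) < eps.
Proof.
move=> e0; have [|n h] := @ae_cvg_Nrv _ _ _ P (fun n => n.+1%:R^-1 *: y) 0 _ _ e0.
  apply: aeW => w /=.
  rewrite -[X in _ --> X](mul0r (y w)); apply: cvgM; last exact: cvg_cst.
  exact: cvg_harmonic.
exists n.+1%:R^-1; first by rewrite invr_gt0.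
move=> k kn; have := h n (leqnn n); rewrite subr0; apply: le_lt_trans.
have n0 : 0 < n.+1%:R :> R by [].
have -> : k *: y = (k * n.+1%:R) *: (n.+1%:R^-1 *: y).
  by rewrite scalerA mulfK// gt_eqF.
by apply: NrvZ; rewrite normrM (gtr0_norm n0) -ler_pdivlMr// div1r.
Qed.

Lemma Nrv_complete (u : nat -> V) :
  (forall eps, 0 < eps -> exists n0, forall m n, (n0 <= m)%N -> (n0 <= n)%N ->
      N (u m - u n) < eps) ->
  exists l, forall eps, 0 < eps -> exists n0, forall n, (n0 <= n)%N ->
      N (u n - l) < eps.
Proof.
move=> hu; pose q : R := 2^-1.
have q0 : 0 < q by rewrite invr_gt0.
(* A bound 4^{-k} on the F-norm and Markov's inequality at level 2^{-k} give probabilities at most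
   2^{-k}, of total at most 2; the chosen subsequence then converges almost surely. *)
have hk k : exists n0, (k <= n0)%N /\ forall m n, (n0 <= m)%N -> (n0 <= n)%N ->
    N (u m - u n) < (q * q) ^+ k.
  have [n0 h] := hu ((q * q) ^+ k) (exprn_gt0 k (mulr_gt0 q0 q0)).
  exists (maxn k n0); split; first exact: leq_maxl.
  by move=> m n; rewrite !geq_max => /andP[_ km] /andP[_ kn]; exact: h.
have [n_ hn_] := choice hk.
(* Running maxima make the indices nondecreasing, so that [s k] and [s k.+1] are both past
   [n_ k]. *)
pose s k := (\max_(i < k.+1) n_ i)%N.
have sn k : (n_ k <= s k)%N by exact: (@leq_bigmax _ (fun i : 'I_k.+1 => n_ i) ord_max).
have ss k : (s k <= s k.+1)%N by rewrite {2}/s big_ord_recr /= leq_maxl.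
have s1 k : (n_ k <= s k.+1)%N by exact: leq_trans (sn k) (ss k).
pose v k := u (s k).
have hv k : N (v k.+1 - v k) < (q * q) ^+ k by apply: (hn_ k).2.
have : {ae P, forall w, cvg (v n w @[n --> \oo])}.
  have : {ae P, forall w, exists n0, forall n, (n0 <= n)%N ->
      `|(v n.+1 - v n) w| <= q ^+ n}.
    apply: ae_eventually_le; apply: (@le_lt_trans _ _ 2%:E); last exact: ltry.
    apply: nneseries_le_ub => // n.
    apply: (@le_trans _ _ (\sum_(0 <= k < n) (q ^+ k)%:E)%E).
      apply: lee_sum => k _; apply: (le_trans (Nrv_markov _ _ _)).
      + by rewrite exprn_gt0.
      + by rewrite exprn_ile1// ?(ltW q0)// invf_le1// ler1n.
      + rewrite lee_fin ler_pdivrMr ?exprn_gt0// -exprMn.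
        exact: ltW.
    rewrite sumEFin lee_fin.
    suff -> : \sum_(0 <= i < n) q ^+ i = 2 - 2 * q ^+ n.
      by rewrite gerBl mulr_ge0// exprn_ge0// ltW.
    elim: n => [|n IH]; first by rewrite big_nil expr0 mulr1 subrr.
    by rewrite big_nat_recr //= IH exprS /q; field.
  apply: filterS => w /(eventually_geometric_bound q0)[C _ hC].
  by apply: (geometric_increments_cvg q0 _ hC); rewrite invf_lt1// ltr1n.
move=> /ae_limit_exists[l hl]; exists l => e e0.
have [|n0 h0] := hu (e / 2); first lra.
have [|n1 h1] := ae_cvg_Nrv hl (eps := e / 2); first lra.
exists n0 => n n0n; pose j := maxn n0 n1.
have n0j : (n0 <= s j)%N.
  by rewrite (leq_trans (leq_maxl n0 n1))// (leq_trans (hn_ j).1).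
have := Nrv_triangle P (u n - u (s j)) (u (s j) - l).
by rewrite addrA subrK; have := h0 _ _ n0n n0j; have := h1 j (leq_maxr _ _); rewrite /v; lra.
Qed.

Lemma fnorm_Nrv : fnorm N.
Proof.
split.
- by apply/Nrv_eq0; exact: aeW.
- exact: NrvN.
- exact: Nrv_triangle.
- exact: NrvZ.
- exact: Nrv_absorb.
- exact: Nrv_complete.
Qed.

End L0Complete.

(** * Finite-dimensional laws and limits in probability *)

Section TupleLaws.
Context {R : realType} {d : measure_display} {Omega : measurableType d}.
Variable P : probability Omega R.
Local Notation V := {mfun Omega >-> R}.
Local Notation N := (@Nrv R d Omega P).
Let NF : fnorm N := fnorm_Nrv P.

Definition orthant n (a : 'I_n -> R) : set (n.-tuple R) :=
  [set x | forall i, tnth x i <= a i].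

Lemma measurable_orthant n (a : 'I_n -> R) : measurable (orthant a).
Proof.
have -> : orthant a = \bigcap_(i in [set: 'I_n]) (@tnth n R ^~ i @^-1` `]-oo, a i]).
    apply/seteqP; split => u /= h i; first by move=> _; rewrite /= in_itv /=.
    by have := h i I; rewrite /= in_itv.
apply: fin_bigcap_measurable => // i _.
rewrite -[X in measurable X]setTI.
exact: (measurable_tnth i measurableT (measurable_itv _)).
Qed.

Lemma measurable_tuple_orthants n (A : set (n.-tuple R)) : measurable A ->
  <<s [set B | exists a : 'I_n -> R, B = orthant a] >> A.
Proof.
pose G := [set B | exists a : 'I_n -> R, B = orthant a].
have : measurable_fun [set: g_sigma_algebraType G] (id : g_sigma_algebraType G -> n.-tuple R).
  apply/measurable_fun_tnthP => i.
  apply: (measurability _ (RGenOInfty.measurableE R)) => B [_ [x ->]] <-.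
  rewrite setTI.
  (* The half-space where coordinate [i] is at most [x] is the increasing union of the orthants
     bounding all other coordinates by [k]. *)
  have -> : (@tnth n R ^~ i \o id) @^-1` `]x, +oo[ =
      ~` \bigcup_k orthant (fun j => if j == i then x else k%:R).
    apply/seteqP; split => u /=; rewrite in_itv /= andbT.
      by move=> xu [k _ /(_ i)]; rewrite eqxx leNgt xu.
    move=> hu; rewrite ltNge; apply/negP => ux; apply: hu.
    exists (Num.truncn (\sum_(j < n) `|tnth u j|)).+1 => // j.
    case: eqP => [->//|_]; apply: ltW; apply: le_lt_trans (truncnS_gt _).
    rewrite (bigD1 j)//= (le_trans (ler_norm _))// lerDl.
    exact: sumr_ge0.
  apply: measurableC; apply: bigcupT_measurable => k.
  by apply: sub_sigma_algebra; eexists.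
move=> mid mA; have := mid measurableT A mA.
by rewrite setTI.
Qed.

Lemma tuple_law_unique n (y z : Omega -> n.-tuple R) :
  measurable_fun setT y -> measurable_fun setT z ->
  (forall a : 'I_n -> R, P (y @^-1` orthant a) = P (z @^-1` orthant a)) ->
  forall A, measurable A -> pushforward P y A = pushforward P z A.
Proof.
move=> my mz yz A mA.
pose Y : {mfun Omega >-> n.-tuple R} := mfun_Sub (mem_set my : y \in mfun).
pose Z : {mfun Omega >-> n.-tuple R} := mfun_Sub (mem_set mz : z \in mfun).
have H := @measure_unique _ R (n.-tuple R) [set B | exists a : 'I_n -> R, B = orthant a]
  (fun k => orthant (fun=> k%:R)) _ _ _ _ (distribution P Y) (distribution P Z).
apply: (H _ _ _ _ _ _ A mA) => {H}.
- apply/seteqP; split; first by move=> B; exact: measurable_tuple_orthants.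
  apply: smallest_sub; first exact: sigma_algebra_measurable.
  move=> B [a ->].
  exact: measurable_orthant.
- move=> B C [a ->] [c ->]; exists (fun i => Num.min (a i) (c i)).
  apply/seteqP; split => u /=.
    by move=> [h1 h2] i; rewrite le_min h1 h2.
  by move=> h; split=> i; have := h i; rewrite le_min => /andP[].
- by move=> k; eexists.
- apply/seteqP; split => // u _; exists (Num.truncn (\sum_(j < n) `|tnth u j|)).+1 => // j.
  apply: ltW; apply: le_lt_trans (truncnS_gt _).
  rewrite (bigD1 j)//= (le_trans (ler_norm _))// lerDl.
  exact: sumr_ge0.
- by move=> B [a ->]; exact: yz.
- move=> k; apply: (@le_lt_trans _ _ 1%E); last exact: ltry.
  apply: probability_le1; exact: measurable_orthant.
Qed.

Lemma measurable_mktuple n (y : 'I_n -> V) :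
  measurable_fun setT (fun w => [tuple y i w | i < n]).
Proof.
apply/measurable_fun_tnthP => i.
rewrite (_ : _ \o _ = y i); first exact: measurable_funPT.
by apply/funext => w /=; rewrite tnth_mktuple.
Qed.

Definition excess n (a : 'I_n -> R) (x : n.-tuple R) : R :=
  \sum_(i < n) Num.max 0 (tnth x i - a i).

(* A Lipschitz function decreasing, as k grows, to the indicator of the
   orthant. *)
Definition tent n (a : 'I_n -> R) (k : nat) (x : n.-tuple R) : R :=
  Num.max 0 (1 - k%:R * excess a x).

Lemma excess_ge0 n (a : 'I_n -> R) x : 0 <= excess a x.
Proof. by apply: sumr_ge0 => i _; rewrite le_max lexx. Qed.

Lemma tent01 n (a : 'I_n -> R) k x : 0 <= tent a k x <= 1.
Proof.
by rewrite le_max lexx /= ge_max ler01 gerBl mulr_ge0// excess_ge0.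
Qed.

Lemma measurable_tent n (a : 'I_n -> R) k : measurable_fun setT (tent a k).
Proof.
apply: measurable_maxr; first exact: measurable_cst.
apply: measurable_funB; first exact: measurable_cst.
apply: measurable_funM; first exact: measurable_cst.
apply: measurable_sum => i; apply: measurable_maxr; first exact: measurable_cst.
by apply: measurable_funB; [exact: measurable_tnth|exact: measurable_cst].
Qed.

(** The truncation at 1, harmless because tents take values in [[0, 1]], makes the error term
    integrate to F-norms of [k%:R *: (y i - z i)]. *)
Lemma tent_lipschitz n (a : 'I_n -> R) k (x y : n.-tuple R) :
  tent a k x <= tent a k y + \sum_(i < n) Num.min `|k%:R * (tnth x i - tnth y i)| 1.
Proof.
have h1 : excess a y <= excess a x + \sum_(i < n) `|tnth x i - tnth y i|.
  rewrite -big_split /=; apply: ler_sum => i _.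
  have : tnth y i - tnth x i <= `|tnth x i - tnth y i| by rewrite distrC ler_norm.
  have := normr_ge0 (tnth x i - tnth y i).
  by case: (leP 0 (tnth y i - a i)); case: (leP 0 (tnth x i - a i)); lra.
pose S := \sum_(i < n) `|k%:R * (tnth x i - tnth y i)|.
have [S0 h2] : 0 <= S /\
    Num.min S 1 <= \sum_(i < n) Num.min `|k%:R * (tnth x i - tnth y i)| 1.
  rewrite /S; apply: (big_ind2 (fun u v => 0 <= u /\ Num.min u 1 <= v)).
  - by rewrite min_l.
  - move=> u1 v1 u2 v2 [u10 uv1] [u20 uv2]; split; first exact: addr_ge0.
    rewrite (le_trans (minr1_triangle u10 u20 (lexx _)))//; exact: lerD.
  - by move=> i _; split.
have h3 : k%:R * excess a y <= k%:R * excess a x + S.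
  have -> : S = k%:R * \sum_(i < n) `|tnth x i - tnth y i|.
    by rewrite mulr_sumr; apply: eq_bigr => i _; rewrite normrM ger0_norm.
  by rewrite -mulrDr ler_wpM2l.
have h4 : 0 <= k%:R * excess a x by rewrite mulr_ge0// excess_ge0.
apply: (@le_trans _ _ (tent a k y + Num.min S 1)); last by rewrite lerD2l.
rewrite /tent; move: S0 h2 h3 h4.
move: (k%:R * excess a x) (k%:R * excess a y) S => p q S S0 h2 h3 h4.
by case: (leP 0 (1 - p)); case: (leP 0 (1 - q)); case: (leP S 1); lra.
Qed.

End TupleLaws.

(** * Transfer of finite-dimensional laws to limits *)

Section FiniteDimensionalLaws.
Context {R : realType} {d : measure_display} {Omega : measurableType d}.
Variable P : probability Omega R.
Local Notation V := {mfun Omega >-> R}.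
Local Notation N := (@Nrv R d Omega P).
Let NF : fnorm N := fnorm_Nrv P.

Lemma mfun_sumE (I : Type) (r : seq I) (F : I -> V) w :
  (\sum_(i <- r) F i) w = \sum_(i <- r) F i w.
Proof.
elim: r => [|i r IH]; first by rewrite !big_nil.
by rewrite !big_cons -IH.
Qed.

Definition lincomb (T : Type) (U : T -> V) (l : seq (R * T)) : V :=
  \sum_(c <- l) c.1 *: U c.2.

Definition tent_int n (a : 'I_n -> R) k (y : 'I_n -> V) : \bar R :=
  (\int[P]_w (tent a k [tuple y i w | i < n])%:E)%E.

Lemma measurable_tent_tuple n (a : 'I_n -> R) k (y : 'I_n -> V) :
  measurable_fun setT (fun w => (tent a k [tuple y i w | i < n])%:E).
Proof.
apply/measurable_EFinP.
apply: (measurableT_comp (measurable_tent a k) (measurable_mktuple y)).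
Qed.

Lemma tent_int_le n (a : 'I_n -> R) k (y z : 'I_n -> V) :
  (tent_int a k y <= tent_int a k z + \sum_(i < n) (N (k%:R *: (y i - z i)))%:E)%E.
Proof.
have m1 i : measurable_fun setT (fun w => (tmod (k%:R *: (y i - z i)) w)%:E).
  exact: measurable_etmod.
have p1 i w : setT w -> (0 <= (tmod (k%:R *: (y i - z i)) w)%:E)%E.
  by move=> _; rewrite lee_fin tmod_ge0.
have -> : (\sum_(i < n) (N (k%:R *: (y i - z i)))%:E =
    \int[P]_w \sum_(i < n) (tmod (k%:R *: (y i - z i)) w)%:E)%E.
  rewrite ge0_integral_sum//.
  by apply: eq_bigr => i _; rewrite NrvE.
rewrite /tent_int -ge0_integralD//.
- apply: ge0_le_integral => //.
  + by move=> w _; rewrite lee_fin; case/andP: (tent01 a k [tuple y i w | i < n]).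
  + exact: measurable_tent_tuple.
  + apply: emeasurable_funD; first exact: measurable_tent_tuple.
    by apply: emeasurable_sum => i; exact: m1.
  + move=> w _; rewrite sumEFin -EFinD lee_fin.
    have := tent_lipschitz a k [tuple y i w | i < n] [tuple z i w | i < n].
    by under eq_bigr => i _ do rewrite !tnth_mktuple.
- by move=> w _; rewrite lee_fin; case/andP: (tent01 a k [tuple z i w | i < n]).
- exact: measurable_tent_tuple.
- by move=> w _; apply: sume_ge0 => i _; exact: p1.
- by apply: emeasurable_sum => i; exact: m1.
Qed.

Lemma tent_int_cvg n (a : 'I_n -> R) (y : 'I_n -> V) :
  tent_int a k y @[k --> \oo] --> P [set w | orthant a [tuple y i w | i < n]].
Proof.
have mA : measurable [set w | orthant a [tuple y i w | i < n]].
  rewrite -[X in measurable X]setTI.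
  exact: (measurable_mktuple y measurableT (measurable_orthant a)).
have h1 k : measurable_fun setT (fun w => (tent a k [tuple y i w | i < n])%:E).
  exact: measurable_tent_tuple.
have h2 : {ae P, forall w, setT w ->
   (tent a k [tuple y i w | i < n])%:E @[k --> \oo] -->
   (\1_[set w | orthant a [tuple y i w | i < n]] w)%:E}.
  apply: aeW => w _; set x := [tuple y i w | i < n].
  (* At each point the values are eventually constant: 1 on the orthant, and 0 off it as soon as [k]
     exceeds the inverse of the excess. *)
  apply: cvg_near_cst.
  have [/= ax|nax] := pselect (orthant a x).
    apply: nearW => k; rewrite indicE mem_set//=.
    suff -> : tent a k x = 1 by [].
    rewrite /tent (_ : excess a x = 0) ?mulr0 ?subr0 ?max_r//.
    by rewrite /excess big1// => i _; rewrite max_l// subr_le0.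
  have e0 : 0 < excess a x.
    have [i hi] : exists i, ~~ (tnth x i <= a i).
      apply: contrapT => h; apply: nax => i; apply: contrapT => hi; apply: h.
      by exists i; apply/negP.
    rewrite /excess (bigD1 i)//= ltr_pwDl//.
      by rewrite lt_max subr_gt0 [X in _ || X]ltNge hi orbT.
    by apply: sumr_ge0 => j _; rewrite le_max lexx.
  exists (Num.truncn (excess a x)^-1).+1 => // k /= hk.
  rewrite indicE memNset//=; congr EFin; apply: max_l.
  rewrite subr_le0 -ler_pdivrMr// div1r (le_trans (ltW (truncnS_gt _)))//.
  by rewrite ler_nat.
have h3 : P.-integrable setT (cst 1%E) by exact: finite_measure_integrable_cst.
have h4 : {ae P, forall w k, setT w ->
   (`|(tent a k [tuple y i w | i < n])%:E| <= cst 1 w)%E}.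
  apply: aeW => w k _; have /andP[t0 t1] := tent01 a k [tuple y i w | i < n].
  by rewrite /= lee_fin ger0_norm.
have h5 : measurable_fun setT
    (fun w => (\1_[set w | orthant a [tuple y i w | i < n]] w : R)%:E).
  by apply/measurable_EFinP; exact: measurable_indic.
have [_ _] := dominated_convergence measurableT h1 h5 h2 h3 h4.
by rewrite integral_indic// setIT.
Qed.

Lemma fdd_lincomb (T : Type) (U W : T -> V) :
  same_fdd P U W -> same_fdd P (lincomb U) (lincomb W).
Proof.
move=> UW n l A mA.
(* All terms of the [n] combinations are listed in a single tuple indexed by pairs (combination,
   position); the combinations are then its image under one measurable linear map [Phi]. *)
pose K := {i : 'I_n & 'I_(size (l i))}.
pose pt (k : 'I_#|{: K}|) : R * T :=
  let z := enum_val k in tnth (in_tuple (l (tag z))) (tagged z).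
pose Phi (v : #|{: K}|.-tuple R) : n.-tuple R :=
  [tuple \sum_(j < size (l i)) (tnth (in_tuple (l i)) j).1 *
     tnth v (enum_rank (Tagged (fun i => 'I_(size (l i))) j)) | i < n].
have mPhi : measurable_fun setT Phi.
  apply/measurable_fun_tnthP => i.
  rewrite (_ : _ \o _ = fun v => \sum_(j < size (l i)) (tnth (in_tuple (l i)) j).1 *
     tnth v (enum_rank (Tagged (fun i => 'I_(size (l i))) j))); last first.
    by apply/funext => v /=; rewrite tnth_mktuple.
  apply: measurable_sum => j; apply: measurable_funM; first exact: measurable_cst.
  exact: measurable_tnth.
have E (Z : T -> V) w : [tuple lincomb Z (l i) w | i < n] =
    Phi [tuple Z (pt k).2 w | k < #|{: K}|].
  apply: eq_from_tnth => i; rewrite !tnth_mktuple mfun_sumE big_tnth.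
  by apply: eq_bigr => j _; rewrite tnth_mktuple /pt enum_rankK.
have := UW _ (fun k => (pt k).2) (Phi @^-1` A).
rewrite -[X in measurable X]setTI => /(_ (mPhi measurableT A mA)).
rewrite /pushforward => e.
have E' (Z : T -> V) : (fun w => [tuple lincomb Z (l i) w | i < n]) @^-1` A =
    (fun w => [tuple Z (pt k).2 w | k < #|{: K}|]) @^-1` (Phi @^-1` A).
  by apply/seteqP; split => w /=; rewrite E.
by rewrite !E'.
Qed.

Section Twins.
Variables (T : Type) (U W : T -> V).

(** When [U] and [W] have the same laws, this is the graph of the induced isometry between the
    closed spans; working with the graph avoids constructing the map modulo null vectors. *)
Definition twin (y z : V) : Prop := forall eps, 0 < eps ->
  exists l, N (lincomb U l - y) < eps /\ N (lincomb W l - z) < eps.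

Lemma lincomb_cat (Z : T -> V) l1 l2 :
  lincomb Z (l1 ++ l2) = lincomb Z l1 + lincomb Z l2.
Proof. exact: big_cat. Qed.

Lemma lincomb_scale (Z : T -> V) k l :
  lincomb Z [seq (k * c.1, c.2) | c <- l] = k *: lincomb Z l.
Proof.
by rewrite /lincomb big_map scaler_sumr; apply: eq_bigr => c _; rewrite scalerA.
Qed.

Lemma twin_gen t : twin (U t) (W t).
Proof.
move=> e e0; exists [:: (1, t)].
by rewrite /lincomb !big_seq1 !scale1r !subrr (fnorm0 NF).
Qed.

Lemma twin0 : twin 0 0.
Proof.
by move=> e e0; exists [::]; rewrite /lincomb !big_nil !subrr (fnorm0 NF).
Qed.

Lemma twinD y z y' z' : twin y z -> twin y' z' -> twin (y + y') (z + z').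
Proof.
move=> h h' e e0; have [|l [l1 l2]] := h (e / 2); first lra.
have [|l' [l1' l2']] := h' (e / 2); first lra.
exists (l ++ l'); rewrite !lincomb_cat !opprD.
rewrite (addrACA (lincomb U l)) (addrACA (lincomb W l)).
have := fnorm_triangle NF (lincomb U l - y) (lincomb U l' - y').
have := fnorm_triangle NF (lincomb W l - z) (lincomb W l' - z').
by split; lra.
Qed.

Lemma twinZ k y z : twin y z -> twin (k *: y) (k *: z).
Proof.
move=> h e e0; pose n := (Num.truncn `|k|).+1.
have kn : `|k| <= n%:R by rewrite ltW// truncnS_gt.
have n0 : 0 < n%:R :> R by [].
have [|l [l1 l2]] := h (e / n%:R); first exact: divr_gt0.
exists [seq (k * c.1, c.2) | c <- l]; rewrite !lincomb_scale -!scalerBr.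
move: l1 l2; rewrite !ltr_pdivlMr// ![_ * n%:R]mulrC => l1 l2.
by split; [apply: le_lt_trans l1|apply: le_lt_trans l2]; exact: fnormZ_nat.
Qed.

Lemma twinB y z y' z' : twin y z -> twin y' z' -> twin (y - y') (z - z').
Proof.
by move=> h /(twinZ (-1)); rewrite !scaleN1r; exact: twinD.
Qed.

Lemma twin_lim y z : (forall eps, 0 < eps -> exists y' z',
  [/\ twin y' z', N (y' - y) < eps & N (z' - z) < eps]) -> twin y z.
Proof.
move=> h e e0; have [|y' [z' [h1 h2 h3]]] := h (e / 2); first lra.
have [|l [l1 l2]] := h1 (e / 2); first lra.
exists l; have := fnorm_dist NF (lincomb U l) y' y.
have := fnorm_dist NF (lincomb W l) z' z.
by split; lra.
Qed.

Lemma twin_eq y z y' z' : N (y - y') = 0 -> N (z - z') = 0 -> twin y z -> twin y' z'.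
Proof.
by move=> hy hz h; apply: twin_lim => e e0; exists y, z; rewrite hy hz.
Qed.

Lemma twin_rsum f g delta a b p : tpart delta a b p ->
  (forall t, a <= t <= b -> twin (f t) (g t)) -> twin (rsum f a p) (rsum g a p).
Proof.
elim: p a => [|[x t] p IH] a /=; first by move=> *; exact: twin0.
move=> [at_ _ /andP[ax xt] hp] fg; have tb := tpart_le hp.
apply: twinD; first by apply: twinZ; apply: fg; rewrite ax (le_trans xt).
by apply: IH => // u /andP[tu ub]; apply: fg; rewrite ub (le_trans (ltW at_)).
Qed.

(** A partition and its translate by [h] give Riemann sums with the same coefficients. *)
Lemma twin_isint f g a b h I J : a <= b ->
  (forall t, a <= t <= b -> twin (f (t + h)) (g t)) ->
  isint N f (a + h) (b + h) I -> isint N g a b J -> twin I J.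
Proof.
move=> ab fg hI hJ; apply: twin_lim => e e0.
have [d1 d10 h1] := hI e e0; have [d2 d20 h2] := hJ e e0.
have [|p /tpart_min[p1 p2]] := @tpart_exists_any _ (Num.min d1 d2) a b _ ab.
  by rewrite lt_min d10.
exists (rsum f (a + h) (shiftp h p)), (rsum g a p); split.
- by rewrite rsum_shift; exact: twin_rsum p1 fg.
- exact/h1/tpart_shift.
- exact: h2.
Qed.

End Twins.

Lemma twin_sym (T : Type) (U W : T -> V) y z : twin U W y z -> twin W U z y.
Proof. by move=> h e /h[l [h1 h2]]; exists l. Qed.

Lemma fdd_sym (T : Type) (U W : T -> Omega -> R) : same_fdd P U W -> same_fdd P W U.
Proof. by move=> h n t A mA; rewrite h. Qed.

Lemma twin_tent_le (T : Type) (U W : T -> V) n (a : 'I_n -> R) k (y z : 'I_n -> V) :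
  same_fdd P U W -> (forall i, twin U W (y i) (z i)) ->
  (tent_int a k y <= tent_int a k z)%E.
Proof.
move=> UW yz; apply/lee_addgt0Pr => e e0.
(* Replacing [n] coordinates costs at most [k * n * eta <= e / 2]; this is paid once from [y] to
   combinations of [U], once from combinations of [W] to [z]. *)
pose eta := e / (2 * (k%:R * n%:R + 1)).
have kn0 : 0 <= k%:R * n%:R :> R by rewrite mulr_ge0.
have eta0 : 0 < eta by rewrite divr_gt0// mulr_gt0//; lra.
have etaE : eta * (2 * (k%:R * n%:R + 1)) = e.
  by rewrite /eta divfK// gt_eqF// mulr_gt0//; lra.
have hl i := yz i eta eta0.
have [l hl'] := choice hl.
have B (u v : 'I_n -> V) : (forall i, N (u i - v i) < eta) ->
    (\sum_(i < n) (N (k%:R *: (u i - v i)))%:E <= (e / 2)%:E)%E.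
  move=> huv; rewrite sumEFin lee_fin.
  apply: (@le_trans _ _ (\sum_(i < n) k%:R * eta)).
    apply: ler_sum => i _.
    apply: (@le_trans _ _ (k%:R * N (u i - v i))).
      by apply: fnormZ_nat => //; rewrite ger0_norm.
    by rewrite ler_wpM2l// ltW.
  rewrite sumr_const card_ord -mulr_natr; nra.
have e1 : tent_int a k (fun i => lincomb U (l i)) = tent_int a k (fun i => lincomb W (l i)).
  have H := fdd_lincomb UW; have {}H := fun A mA => H n l A mA.
  pose Y (Z : T -> V) : {mfun Omega >-> n.-tuple R} :=
    mfun_Sub (mem_set (measurable_mktuple (fun i => lincomb Z (l i))) : _ \in mfun).
  have I (Z : T -> V) : tent_int a k (fun i => lincomb Z (l i)) =
      (\int[distribution P (Y Z)]_x (tent a k x)%:E)%E.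
    rewrite ge0_integral_distribution//.
    - by apply/measurable_EFinP; exact: measurable_tent.
    - by move=> x; rewrite lee_fin; case/andP: (tent01 a k x).
  by rewrite !I; apply: eq_measure_integral => A mA _; exact: H.
apply: (le_trans (tent_int_le a k y (fun i => lincomb U (l i)))).
rewrite e1.
have := tent_int_le a k (fun i => lincomb W (l i)) z.
move=> h; apply: (le_trans (leeD h (B _ _ _))).
  by move=> i; rewrite (fnormC NF); case: (hl' i).
rewrite -addeA leeD2l//.
have -> : e%:E = ((e / 2)%:E + (e / 2)%:E)%E :> \bar R by rewrite -EFinD -splitr.
by apply: leeD => //; apply: B => i; case: (hl' i).
Qed.

(** Orthant probabilities are not continuous for convergence in probability, but tent integrals are,
    and they decrease to those probabilities. *)
Lemma fdd_twin (T T' : Type) (U W : T -> V) (U' W' : T' -> V) :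
  same_fdd P U W -> (forall s, twin U W (U' s) (W' s)) -> same_fdd P U' W'.
Proof.
move=> UW h n t A mA; apply: tuple_law_unique => //.
- exact: (measurable_mktuple (fun i => U' (t i))).
- exact: (measurable_mktuple (fun i => W' (t i))).
move=> a.
have c1 := @tent_int_cvg _ a (fun i => U' (t i)).
have c2 := @tent_int_cvg _ a (fun i => W' (t i)).
have e : tent_int a ^~ (fun i => U' (t i)) = tent_int a ^~ (fun i => W' (t i)).
  apply/funext => k; apply/eqP; rewrite eq_le; apply/andP; split.
    by apply: (twin_tent_le _ _ UW) => i; exact: h.
  by apply: (twin_tent_le _ _ (fdd_sym UW)) => i; exact/twin_sym/h.
rewrite e in c1.
exact: (etrans (esym (cvg_lim (@ereal_hausdorff R) c1)) (cvg_lim (@ereal_hausdorff R) c2)).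
Qed.

Lemma twin_law (T : Type) (U W : T -> V) (y z : V) B :
  same_fdd P U W -> twin U W y z -> measurable B -> P (y @^-1` B) = P (z @^-1` B).
Proof.
move=> UW yz mB.
have := @fdd_twin T unit U W (fun=> y) (fun=> z) UW (fun=> yz) 1%N (fun=> tt)
  ((@tnth 1 R ^~ ord0) @^-1` B).
rewrite -[X in measurable X]setTI => /(_ (measurable_tnth ord0 measurableT mB)).
rewrite /pushforward.
have E (u : V) : (fun w => [tuple u w | i < 1]) @^-1` (@tnth 1 R ^~ ord0 @^-1` B) = u @^-1` B.
  by apply/seteqP; split => w /=; rewrite tnth_mktuple.
by rewrite !E.
Qed.

Lemma law_Nrv (y z : V) :
  (forall B, measurable B -> P (y @^-1` B) = P (z @^-1` B)) -> N y = N z.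
Proof.
move=> h; apply: EFin_inj; rewrite !NrvE.
have mt : measurable_fun setT (fun x : R => (Num.min `|x| 1)%:E).
  apply/measurable_EFinP; apply: measurable_minr; last exact: measurable_cst.
  exact: normr_measurable.
have I (u : V) : (\int[P]_w (tmod u w)%:E =
    \int[distribution P u]_x (Num.min `|x| 1)%:E)%E.
  have p0 (x : R) : (0 <= (Num.min `|x| 1)%:E)%E by rewrite lee_fin le_min normr_ge0/=.
  by rewrite (ge0_integral_distribution u mt p0).
by rewrite !I; apply: eq_measure_integral => B mB _; exact: h.
Qed.

Lemma twin_Nrv (T : Type) (U W : T -> V) (y z : V) :
  same_fdd P U W -> twin U W y z -> N y = N z.
Proof. by move=> UW yz; apply: law_Nrv => B; exact: (twin_law UW yz). Qed.

End FiniteDimensionalLaws.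

(** * Random integrals *)

Section RiemannSums.
Context {R : realType}.
Implicit Types (f : R -> R) (a b t delta : R) (s : seq R) (xi : nat -> R).

Lemma Riemann_sum_cons f a b t s xi :
  Riemann_sum f a b (t :: s) xi =
  f (xi 0%N) * (t - a) + Riemann_sum f t b s (fun j => xi j.+1).
Proof. by rewrite /Riemann_sum /= big_nat_recl. Qed.

Lemma tpart_Riemann delta a b p : tpart delta a b p ->
  exists s xi, [/\ itv_partition a b s, tags a b s xi, mesh_lt a b s delta &
    forall f, Riemann_sum f a b s xi = rsum (V := R^o) f a p].
Proof.
elim: p a => [|[x t] p IH] a /=.
  move=> ->; exists [::], (fun=> 0); split => // f.
  by rewrite /Riemann_sum big_geq.
move=> [at_ td axt /IH[s [xi [[s1 s2] h2 h3 h4]]]].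
exists (t :: s), (fun j => if j is j'.+1 then xi j' else x); split.
- by split; rewrite //= at_.
- by move=> [|j] //= js; exact: h2.
- by move=> [|j] //= js; exact: h3.
- by move=> f; rewrite Riemann_sum_cons h4 mulrC.
Qed.

Lemma Riemann_tpart delta a b s xi :
  itv_partition a b s -> tags a b s xi -> mesh_lt a b s delta ->
  exists2 p, tpart delta a b p &
    forall f, Riemann_sum f a b s xi = rsum (V := R^o) f a p.
Proof.
elim: s a xi => [|t s IH] a xi [/= s1 s2] h2 h3.
  exists [::] => [|f]; first exact/eqP.
  by rewrite /Riemann_sum big_geq.
case/andP: s1 => at_ s1.
have [|||p hp hE] := IH t (fun j => xi j.+1).
- by split.
- by move=> j js; exact: (h2 j.+1).
- by move=> j js; exact: (h3 j.+1).
exists ((xi 0%N, t) :: p) => [/=|f].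
  by split => //; [exact: (h3 0%N)|exact: (h2 0%N)].
by rewrite Riemann_sum_cons hE /= mulrC.
Qed.

End RiemannSums.

Section RandomIntegrals.
Context {R : realType} {d : measure_display} {Omega : measurableType d}.
Variable P : probability Omega R.
Local Notation V := {mfun Omega >-> R}.
Local Notation N := (@Nrv R d Omega P).
Implicit Types (X : R -> {RV P >-> R}) (I : {RV P >-> R}) (phi : R -> R).

Lemma rsum_mfunE phi X a p w :
  (rsum (V := V) (fun t => phi t *: (X t : V)) a p) w =
  rsum (V := R^o) (fun t => phi t * X t w) a p.
Proof.
elim: p a => [//|[x t] p IH] a /=.
by rewrite -IH.
Qed.

Lemma Riemann_intP phi X a b I :
  Riemann_int phi X a b I <-> isint N (fun t => phi t *: (X t : V)) a b I.
Proof.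
have E s xi p : (forall f, Riemann_sum f a b s xi = rsum (V := R^o) f a p) ->
    Fnorm P (fun w => Riemann_sum (fun t => phi t * X t w) a b s xi - I w) =
    (N (rsum (V := V) (fun t => phi t *: (X t : V)) a p - (I : V)))%:E.
  move=> h; rewrite -FnormE; congr (Fnorm P _); apply/funext => w.
  by rewrite h -rsum_mfunE.
split=> hI e e0; have [dl d0 h] := hI e e0; exists dl => //.
  move=> p /tpart_Riemann[s [xi [h1 h2 h3 h4]]].
  by rewrite -lte_fin -(E _ _ _ h4); exact: h.
move=> s xi h1 h2 h3; have [p hp h4] := Riemann_tpart h1 h2 h3.
by rewrite (E _ _ _ h4) lte_fin; exact: h.
Qed.

Lemma in_RmP X a b : in_Rm a b X <-> Rm N (fun t => X t : V) a b.
Proof.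
by split=> h phi /h[I hI]; exists I; apply/Riemann_intP.
Qed.

End RandomIntegrals.

(** * Translation, restriction and concatenation of integrals *)

Section MoreIntegrals.
Context {R : realType} {V : lmodType R} (N : V -> R) (NF : fnorm N).
Implicit Types (a b c h delta eps : R) (p q : seq (R * R)) (phi : R -> R)
  (X f g : R -> V).

Lemma isint_shift f a b h I : isint N f (a + h) (b + h) I <->
  isint N (fun t => f (t + h)) a b I.
Proof.
split=> H e e0; have [d d0 hd] := H e e0; exists d => // p hp.
  by rewrite -rsum_shift; exact/hd/tpart_shift.
rewrite -[p](shiftpK (- h)) opprK rsum_shift; apply: hd.
by have := tpart_shift (- h) hp; rewrite !addrK.
Qed.

(** The null set may depend on [t]: a Riemann sum involves only finitely many values. *)
Lemma isint_near_eq f g a b I : (forall t, a <= t <= b -> N (f t - g t) = 0) ->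
  isint N f a b I -> isint N g a b I.
Proof.
move=> fg hI e e0; have [d d0 h] := hI e e0; exists d => // p hp.
have E : N (rsum g a p - rsum f a p) = 0.
  rewrite -(rsumB g f); elim: p a fg {hI h} hp => [|[x t] p IH] a fg /=.
    by rewrite (fnorm0 NF).
  move=> [at_ _ /andP[ax xt] hp]; have tb := tpart_le hp.
  apply/eqP; rewrite eq_le (fnorm_ge0 NF) andbT (le_trans (fnorm_triangle NF _ _))//.
  rewrite (IH t) ?addr0//; last first.
    by move=> u /andP[tu ub]; rewrite fg// ub (le_trans (ltW at_)).
  rewrite (fnorm_eq0Z NF)//= (fnormC NF) fg// ax.
  exact: le_trans xt tb.
have := fnorm_dist NF (rsum g a p) (rsum f a p) I; have := h p hp; lra.
Qed.

Lemma isint_expC a b (x : V) : a <= b ->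
  isint N (fun t => expR t *: x) a b ((expR b - expR a) *: x).
Proof.
move=> ab; have De : Dminus a b (fun t => expR t).
  by apply: Dminus_continuous; exact: continuous_expR.
have [c hc] := isint_cst NF ab De; apply: (isint_eq NF (hc x)) => e d e0 d0.
(* Reflection of [expN_mean]; with these tags the sum telescopes. *)
have mv u v : u < v -> exists2 y : R, u <= y <= v & (v - u) * expR y = expR v - expR u.
  move=> uv; have [|y hy E] := @expN_mean R (- v) (- u); first by rewrite ltrN2.
  exists (- y); first by rewrite lerNr lerNl andbC.
  by move: E; rewrite !opprK addrC => <-; rewrite addrC.
have [p hp hG] := tpart_exists mv d0 ab; exists p => //.
suff -> : rsum (fun t => expR t *: x) a p = (expR b - expR a) *: x.
  by rewrite subrr (fnorm0 NF) ltW.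
have := hG (fun u _ p => rsum (fun t => expR t *: x) u p = (expR b - expR u) *: x).
apply; first by rewrite /= subrr scale0r.
move=> u y v q _ _ E _ _ /= ->; rewrite scalerA E -scalerDl; congr (_ *: _).
by rewrite addrC addrA subrK.
Qed.

Lemma Dminus_patch a b c phi : a <= b <= c -> Dminus a b phi ->
  Dminus a c (fun t => if t <= b then phi t else 0).
Proof.
move=> /andP[ab bc] [h1 h2]; split=> x /andP[x1 x2].
  have [xb|bx] := leP x b.
    apply: cvg_trans (h1 x _); last by rewrite x1.
    apply: near_eq_cvg; near=> y; rewrite ifT//.
    have yx : y < x by near: y; exact: nbhs_left_lt.
    by rewrite (le_trans (ltW yx)).
  apply: cvg_near_cst; near=> y; rewrite ifF//.
  by apply/negbTE; rewrite -ltNge; near: y; exact: nbhs_left_gt.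
have [xb|bx] := ltP x b.
  have /cvg_ex[l hl] := h2 x (introT andP (conj x1 xb)).
  apply/cvg_ex; exists l; apply: cvg_trans hl.
  apply: near_eq_cvg; near=> y; rewrite ifT//.
  by near: y; exact: nbhs_right_le.
apply/cvg_ex; exists 0; apply: cvg_near_cst; near=> y; rewrite ifF//.
have xy : x < y by near: y; exact: nbhs_right_gt.
by apply/negbTE; rewrite -ltNge (le_lt_trans bx).
Unshelve. all: by end_near. Qed.

Lemma Rm_restrict X a b c : a <= b <= c -> Rm N X a c -> Rm N X a b.
Proof.
move=> abc hX phi hphi; have [I hI] := hX _ (Dminus_patch abc hphi).
exists I; apply: (isint_restrict abc); apply: isint_ext hI => t _.
by case: ifP => // _; rewrite scale0r.
Qed.

Lemma Rm_cat X a b c : a <= b <= c -> Rm N X a b -> Rm N X b c -> Rm N X a c.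
Proof.
move=> abc h1 h2 phi hphi; have /andP[ab bc] := abc.
have [I hI] := h1 _ (Dminus_sub (lexx a) bc hphi).
have [J hJ] := h2 _ (Dminus_sub ab (lexx c) hphi).
by exists (I + J); exact: isint_cat hI hJ.
Qed.

Lemma isint_sub f a b c I K : a <= b <= c ->
  isint N f a b I -> isint N f a c K -> (exists J, isint N f b c J) ->
  isint N f b c (K - I).
Proof.
move=> abc hI hK [J hJ]; have /andP[ab bc] := abc.
have := isint_unique NF (le_trans ab bc) (isint_cat NF abc hI hJ) hK.
move=> e; apply: (isint_cvg NF _ hJ).
by rewrite opprB addrA (addrC J).
Qed.

End MoreIntegrals.

(** * Integrals of processes with stationary increments *)

Section StationaryIncrements.
Context {R : realType} {d : measure_display} {Omega : measurableType d}.
Variable P : probability Omega R.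
Local Notation V := {mfun Omega >-> R}.
Local Notation N := (@Nrv R d Omega P).
Let NF : fnorm N := fnorm_Nrv P.
Variable X : R -> V.

Definition incr (h : R) (p : R * R) : V := X (p.1 + h) - X (p.2 + h).

Hypothesis SI : forall h, same_fdd P (incr h) (incr 0).
Hypothesis X01 : Rm N X 0 1.

Lemma twin_incr h s t :
  twin P (incr h) (incr 0) (X (s + h) - X (t + h)) (X s - X t).
Proof.
by have := twin_gen P (incr h) (incr 0) (s, t); rewrite /incr /= !addr0.
Qed.

(** [X (t + h) - X h] corresponds in law to [X t - X 0]; the constant [X h], whose law is not
    controlled, is integrated separately. *)
Lemma Rm_unit h : Rm N X (0 + h) (1 + h).
Proof.
move=> phi hphi; have hphi' := Dminus_shift hphi.
have le01 : (0 : R) <= 1 by [].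
have [I hI] := X01 hphi'; have [c hc] := isint_cst NF le01 hphi'.
have hJ := isintB NF hI (hc (X 0)).
(* Laws carry no limit from one process to the other, but they do carry the Cauchy property: the
   F-norm of a difference of two Riemann sums depends only on its law. Completeness then yields the
   integral. *)
have [K hK] : exists K, isint N (fun t => phi (t + h) *: (X (t + h) - X (0 + h))) 0 1 K.
  apply: (isint_cauchy NF le01) => e e0.
  have [|dl d0 hd] := hJ (e / 2); first lra.
  exists dl => // p q hp hq.
  have tw r : tpart dl 0 1 r -> twin P (incr h) (incr 0)
      (rsum (fun t => phi (t + h) *: (X (t + h) - X (0 + h))) 0 r)
      (rsum (fun t => phi (t + h) *: X t - phi (t + h) *: X 0) 0 r).
    move=> hr; apply: (twin_rsum hr) => t _; rewrite -scalerBr.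
    by apply: twinZ; exact: twin_incr.
  rewrite (twin_Nrv (SI h) (twinB (tw p hp) (tw q hq))).
  have := hd p hp; have := hd q hq.
  set A := rsum _ _ p; set B := rsum _ _ q; set C := I - _.
  by have := fnorm_dist NF A C B; rewrite (fnormC NF C); lra.
have := isintD NF hK (hc (X (0 + h))).
move=> hL; exists (K + c *: X (0 + h)); apply/isint_shift.
by apply: isint_ext hL => t _; rewrite -scalerDr subrK.
Qed.

Lemma Rm_all a b : a <= b -> Rm N X a b.
Proof.
move=> ab.
have H k : Rm N X a (a + k%:R).
  elim: k => [|k IH].
    move=> phi _; exists 0; rewrite addr0; exact: isint_refl.
  have h1 : Rm N X (a + k%:R) (1 + (a + k%:R)).
    by have h1 := @Rm_unit (a + k%:R); rewrite add0r in h1.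
  rewrite -natr1 addrA [_ + 1]addrC.
  by apply: (Rm_cat NF _ IH h1); rewrite lerDl ler0n lerDr ler01.
apply: (Rm_restrict (c := a + (Num.truncn (b - a)).+1%:R)); last exact: H.
rewrite ab -lerBlDl ltW//; exact: truncnS_gt.
Qed.

Lemma exp_integral_exists a b : a <= b ->
  exists I, isint N (fun t => expR t *: X t) a b I.
Proof.
move=> ab; apply: Rm_all => //; apply: Dminus_continuous.
exact: continuous_expR.
Qed.

(** Substitution s = t + h, with [X h] split off so that [Xi] involves increments only. The case
    [tau = 1] serves convergence at -oo, general [tau] the windows left by a shift. *)
Lemma exp_integral_shift tau K h : 0 <= tau ->
  isint N (fun t => expR t *: (X t - X 0)) 0 tau K ->
  exists2 Xi, isint N (fun t => expR t *: X t) h (tau + h)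
      (expR h *: (Xi + (expR tau - 1) *: X h)) &
    twin P (incr h) (incr 0) Xi K.
Proof.
move=> tau0 hK; have htau : h <= tau + h by rewrite lerDr.
have [J hJ] := exp_integral_exists htau.
have h0 : isint N (fun t => expR t *: X h) 0 tau ((expR tau - 1) *: X h).
  by rewrite -[X in _ - X]expR0; exact: isint_expC.
have hJ' : isint N (fun t => expR t *: X (t + h)) 0 tau (expR (- h) *: J).
  have hJ0 : isint N (fun t => expR t *: X t) (0 + h) (tau + h) J by rewrite add0r.
  have /isint_shift := isintZ NF (expR (- h)) hJ0.
  by apply: isint_ext => t _; rewrite scalerA -expRD addrCA addNr addr0.
have h1 := isintB NF hJ' h0.
exists (expR (- h) *: J - (expR tau - 1) *: X h).
  by rewrite subrK scalerA -expRD subrr expR0 scale1r.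
have h2 : isint N (fun s => expR (s - h) *: (X s - X (0 + h))) (0 + h) (tau + h)
    (expR (- h) *: J - (expR tau - 1) *: X h).
  apply/isint_shift; apply: isint_ext h1 => t _.
  by rewrite addrK add0r scalerBr.
apply: (twin_isint tau0 _ h2 hK) => t _.
by rewrite addrK; apply: twinZ; exact: twin_incr.
Qed.

End StationaryIncrements.

(** * The improper integral *)

Section LogMoment.
Context {R : realType} {d : measure_display} {Omega : measurableType d}.
Variable P : probability Omega R.
Local Notation V := {mfun Omega >-> R}.

(** Pointwise form of the bound of the sum of the P(Z > n) by E Z + 1. The induction also needs the
    trivial bound by [M], used when [M < z]. *)
Lemma count_lt_le (z : R) M : 0 <= z ->
  \sum_(0 <= n < M) (n%:R < z)%R%:R <= z + 1.
Proof.
move=> z0; suff [] : \sum_(0 <= n < M) (n%:R < z)%R%:R <= z + 1 /\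
    \sum_(0 <= n < M) (n%:R < z)%R%:R <= M%:R :> R by [].
elim: M => [|M [h1 h2]]; first by rewrite big_nil; split => //; rewrite addr_ge0.
rewrite big_nat_recr //= -natr1; case: ltP => /= hz; last by rewrite addr0; split; lra.
by split; lra.
Qed.

(** The rate exceeds 1, so that logarithmic moments control it, and is below e, so that e^{-n} q^n
    still decays geometrically. *)
Let q : R := expR 2^-1.

Lemma measurable_logp (y : V) : measurable_fun setT (fun w => logp `|y w|).
Proof.
apply: measurable_maxr; last exact: measurable_cst.
apply: measurableT_comp; first exact: measurable_ln.
exact: measurableT_comp.
Qed.

(** [q ^+ n < |zeta|] forces [n < 2 * ln |zeta|], so the probabilities sum to at most twice the
    logarithmic moment plus 1. The [y n] need not be independent. *)
Lemma log_moment_bound (zeta : V) (y : nat -> V) :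
  ('E_P[fun w => (logp `|zeta w|)%R] < +oo)%E ->
  (forall n B, measurable B -> P (y n @^-1` B) = P (zeta @^-1` B)) ->
  {ae P, forall w, exists2 C, 0 <= C & forall n, `|y n w| <= C * q ^+ n}.
Proof.
rewrite unlock => hE hlaw.
have q0 : 0 < q by exact: expR_gt0.
have : {ae P, forall w, exists n0, forall n, (n0 <= n)%N -> `|y n w| <= q ^+ n}.
  apply: ae_eventually_le.
  have hP n : P [set w | (q ^+ n < `|y n w|)%R] = P [set w | (q ^+ n < `|zeta w|)%R].
    apply: (hlaw n [set x | q ^+ n < `|x|]).
    have mf : measurable_fun setT (fun x : R => `|x|) by exact: normr_measurable.
    have := mf measurableT _ (measurable_itv `]q ^+ n, +oo[); rewrite setTI.
    by congr (measurable _); apply/seteqP; split=> x; rewrite /= in_itv /= andbT.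
  pose L := (\int[P]_w (logp `|zeta w|)%:E)%E.
  apply: (@le_lt_trans _ _ (2%:E * L + 1)%E); last first.
    by rewrite lte_add_pinfty ?ltry// lte_mul_pinfty.
  apply: nneseries_le_ub => // M.
  have l0 w : 0 <= logp `|zeta w| by rewrite le_max lexx orbT.
  have ml := measurable_logp zeta.
  have -> : (2%:E * L + 1 = \int[P]_w (2 * logp `|zeta w| + 1)%:E)%E.
    under eq_integral do rewrite EFinD EFinM.
    rewrite ge0_integralD//; first last.
    - by apply/measurable_EFinP; apply: measurable_funM.
    - by move=> w _; rewrite -EFinM lee_fin mulr_ge0.
    rewrite integral_cst//= probability_setT mule1 ge0_integralZl_EFin//.
    - by move=> w _; rewrite lee_fin.
    - exact/measurable_EFinP.
  have mA n : measurable [set w | q ^+ n < `|zeta w|] by exact: measurable_normr_gt.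
  rewrite (eq_bigr (fun n => \int[P]_w (\1_[set w | (q ^+ n < `|zeta w|)%R] w)%:E)%E); last first.
    by move=> n _; rewrite hP integral_indic// setIT.
  rewrite -ge0_integral_sum//; last first.
    by move=> n; apply/measurable_EFinP; exact: measurable_indic.
  apply: ge0_le_integral => //.
  - by move=> w _; apply: sume_ge0 => n _; rewrite lee_fin.
  - apply: emeasurable_sum => n; apply/measurable_EFinP; exact: measurable_indic.
  - by apply/measurable_EFinP; apply: measurable_funD => //; apply: measurable_funM.
  move=> w _; rewrite sumEFin lee_fin.
  have z0 : 0 <= 2 * logp `|zeta w| by rewrite mulr_ge0.
  apply: le_trans (count_lt_le M z0); apply: ler_sum => n _.
  rewrite indicE; case: (boolP (w \in _)) => //; rewrite inE /= => hn.
  suff -> : n%:R < 2 * logp `|zeta w| by [].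
  have qn : 0 < q ^+ n by rewrite exprn_gt0.
  have : ln (q ^+ n) < ln `|zeta w|.
    by rewrite ltr_ln ?posrE// (lt_trans qn).
  rewrite lnXn// /q expRK -mulr_natr => hln.
  have : ln `|zeta w| <= logp `|zeta w| by rewrite /logp le_max lexx.
  lra.
apply: filterS => w; exact: eventually_geometric_bound.
Qed.

End LogMoment.

Section ImproperIntegrals.
Context {R : realType} {d : measure_display} {Omega : measurableType d}.
Variable P : probability Omega R.
Local Notation V := {mfun Omega >-> R}.
Local Notation N := (@Nrv R d Omega P).
Let NF : fnorm N := fnorm_Nrv P.
Variable X : R -> V.
Hypothesis SI : forall h, same_fdd P (incr X h) (incr X 0).
Hypothesis X01 : Rm N X 0 1.
Hypothesis X00 : N (X 0) = 0.
Variable K1 : V.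
Hypothesis K1int : isint N (fun t => expR t *: X t) 0 1 K1.
Hypothesis K1log : ('E_P[fun w => (logp `|K1 w|)%R] < +oo)%E.
Hypothesis X1log : ('E_P[fun w => (logp `|X 1 w|)%R] < +oo)%E.

Let q : R := expR 2^-1.

Lemma q_gt1 : 1 < q. Proof. by rewrite expR_gt1. Qed.

Lemma X_geometric_bound :
  {ae P, forall w, exists2 C, 0 <= C & forall n, `|X (- n%:R) w| <= C * q ^+ n}.
Proof.
have q0 : 0 < q by exact: expR_gt0.
have := @log_moment_bound _ _ _ P (X 1) (fun n => X (- n%:R) - X (- n.+1%:R)) X1log.
have laws n B : measurable B ->
    P ((X (- n%:R) - X (- n.+1%:R)) @^-1` B) = P (X 1 @^-1` B).
  apply: (twin_law (SI (- n.+1%:R))).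
  have := twin_incr P X (- n.+1%:R) 1 0.
  have -> : 1 - n.+1%:R = - n%:R :> R by rewrite -natr1; lra.
  rewrite add0r; apply: (twin_eq (P := P)); first by rewrite subrr (fnorm0 NF).
  by rewrite addrAC subrr add0r NrvN.
move=> /(_ laws); apply: filterS => w [C C0 hC].
have q1 : 0 < q - 1 by rewrite subr_gt0 q_gt1.
have D0 : 0 <= C / (q - 1) by rewrite divr_ge0// ltW.
(* D = C / (q - 1) solves D + C = D q, which closes the induction on the telescoping increments. *)
exists (`|X 0 w| + C / (q - 1)); first exact: addr_ge0.
elim=> [|n IH]; first by rewrite oppr0 expr0 mulr1 lerDl.
have : `|X (- n.+1%:R) w| <= `|X (- n%:R) w| + C * q ^+ n.
  have := hC n; rewrite -[X in `|X|]/(X (- n%:R) w - X (- n.+1%:R) w).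
  have := ler_distD (X (- n%:R) w) 0 (X (- n.+1%:R) w).
  by rewrite !sub0r !normrN; lra.
move=> /le_trans; apply; apply: (le_trans (lerD IH (lexx _))).
rewrite exprS -mulrDl mulrA ler_pM2r ?exprn_gt0//.
have e : C / (q - 1) * (q - 1) = C by rewrite divfK// gt_eqF.
have := normr_ge0 (X 0 w); nra.
Qed.

Lemma unit_exp_integrals : exists A : nat -> V,
  (forall n, isint N (fun t => expR t *: X t) (- n.+1%:R) (- n%:R) (A n)) /\
  {ae P, forall w, exists C, forall n, `|A n w| <= C * (expR (- 2^-1)) ^+ n}.
Proof.
have hK : isint N (fun t => expR t *: (X t - X 0)) 0 1 K1.
  apply: (isint_near_eq NF _ K1int) => t _.
  by rewrite -scalerBr opprB addrCA subrr addr0 (fnorm_eq0Z NF).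
have hXi n := exp_integral_shift SI X01 (- n.+1%:R) ler01 hK.
have [Xi hXi'] := choice (fun n => let: ex_intro2 a b c := hXi n in ex_intro _ a (conj b c)).
exists (fun n => expR (- n.+1%:R) *: (Xi n + (expR 1 - 1) *: X (- n.+1%:R))); split.
  move=> n; have [h _] := hXi' n.
  by have -> : - n%:R = 1 - n.+1%:R :> R by rewrite -natr1; lra.
have b1 : {ae P, forall w, exists2 C, 0 <= C & forall n, `|Xi n w| <= C * q ^+ n}.
  apply: (log_moment_bound K1log) => n B; have [_ tw] := hXi' n.
  exact: (twin_law (SI _) tw).
apply: filterS2 b1 X_geometric_bound => w [C1 C10 h1] [C2 C20 h2].
pose E : R := expR 1 - 1; have E0 : 0 <= E by rewrite subr_ge0 ltW// expR_gt1.
(* The extra factor [q] comes from X being evaluated at [- n.+1%:R] rather than [- n%:R]. *)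
exists (C1 + E * (C2 * q)) => n.
have r0 : 0 < expR (- n.+1%:R) :> R by exact: expR_gt0.
have -> : `|(expR (- n.+1%:R) *: (Xi n + E *: X (- n.+1%:R)) : V) w| =
    expR (- n.+1%:R) * `|Xi n w + E * X (- n.+1%:R) w|.
  by rewrite -[LHS]/(`|expR (- n.+1%:R) * (Xi n w + E * X (- n.+1%:R) w)|) normrM gtr0_norm.
have h3 : `|Xi n w + E * X (- n.+1%:R) w| <= (C1 + E * (C2 * q)) * q ^+ n.
  rewrite (le_trans (ler_normD _ _))// [leRHS]mulrDl lerD// normrM ger0_norm// -!mulrA.
  by rewrite ler_wpM2l// -exprS.
have h4 : expR (- n.+1%:R) * q ^+ n <= expR (- 2^-1) ^+ n.
  rewrite /q -!expRM_natl -expRD ler_expR -natr1.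
  have : 0 <= n%:R :> R by [].
  lra.
apply: (@le_trans _ _ (expR (- n.+1%:R) * ((C1 + E * (C2 * q)) * q ^+ n))).
  by rewrite ler_pM2l.
by rewrite mulrCA ler_wpM2l// addr_ge0// mulr_ge0// mulr_ge0// expR_ge0.
Qed.

Definition exp_improper (t : R) (Z : V) : Prop := exists J : nat -> V,
  (forall n : nat, - n%:R <= t ->
     isint N (fun s => expR (- (t - s)) *: X s) (- n%:R) t (J n)) /\
  {ae P, forall w, J n w @[n --> \oo] --> Z w}.

Lemma exp_improper_exists t : exists Z, exp_improper t Z.
Proof.
have [A [hA bA]] := unit_exp_integrals.
have hJ n : exists J : V, - n%:R <= t ->
    isint N (fun s => expR (- (t - s)) *: X s) (- n%:R) t J.
  have [nt|tn] := leP (- n%:R) t; last by exists 0.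
  have [J hJ] := exp_integral_exists SI X01 nt.
  exists (expR (- t) *: J) => _; have := isintZ NF (expR (- t)) hJ.
  by apply: isint_ext => s _; rewrite scalerA -expRD opprB addrC.
have [J hJ'] := choice hJ.
pose n0 := (Num.truncn `|t|).+1.
have n0t n : (n0 <= n)%N -> - n%:R <= t.
  move=> hn; have : `|t| <= n%:R by rewrite (le_trans (ltW (truncnS_gt _)))// ler_nat.
  by rewrite ler_norml => /andP[].
(* From [n0] on the cut-off lies below [t], and moving it by one unit adds a unit integral.
   Countably many null sets are then merged to obtain a pathwise series. *)
have step n : N (J (n + n0).+1 - J (n + n0)%N - expR (- t) *: A (n + n0)%N) = 0.
  have k1 := hJ' _ (n0t _ (leq_trans (leq_addl n n0) (leqnSn _))).
  have k2 := hJ' _ (n0t _ (leq_addl n n0)).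
  have k3 := isintZ NF (expR (- t)) (hA (n + n0)%N).
  have {}k3 : isint N (fun s => expR (- (t - s)) *: X s) (- (n + n0).+1%:R) (- (n + n0)%:R)
      (expR (- t) *: A (n + n0)%N).
    by apply: isint_ext k3 => s _; rewrite scalerA -expRD opprB addrC.
  have le : (- (n + n0).+1%:R : R) <= - (n + n0)%:R <= t.
    by rewrite lerN2 ler_nat leqnSn n0t// leq_addl.
  have := isint_unique NF _ k1 (isint_cat NF le k3 k2).
  rewrite opprD addrA addrAC; apply.
  by case/andP: le => /le_trans; apply.
have : {ae P, forall w n, (J (n + n0).+1 - J (n + n0)%N) w = (expR (- t) *: A (n + n0)%N) w}.
  apply/ae_foralln => n; exact/ae_eq_Nrv.
move=> stepw; have /ae_limit_exists[Z hZ] : {ae P, forall w, cvg (J n w @[n --> \oo])}.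
  apply: filterS2 stepw bA => w hw [C hC].
  suff : cvg (J (n + n0)%N w @[n --> \oo]).
    move=> /cvg_ex[l hl]; apply/cvg_ex; exists l.
    by move: hl; rewrite -(cvg_shiftn n0 (fun n => J n w)).
  pose r : R := expR (- 2^-1).
  apply: (@geometric_increments_cvg _ _ r (expR (- t) * C * r ^+ n0)).
  - exact: expR_gt0.
  - by rewrite /r expR_lt1 oppr_lt0.
  move=> n; have := hw n.
  rewrite -[X in X = _]/(J (n + n0).+1 w - J (n + n0)%N w).
  rewrite -[X in _ = X]/(expR (- t) * A (n + n0)%N w).
  rewrite addSn => ->; rewrite normrM gtr0_norm ?expR_gt0//.
  rewrite -!mulrA ler_pM2l ?expR_gt0// -exprD addnC.
  exact: hC.
by exists Z, J.
Qed.

(** Trades the kernel e^{-(t-s)} for e^s, which is independent of [t], so that integrals belonging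
    to different [t] can be concatenated. *)
Lemma exp_improper_approx t Z eps : exp_improper t Z -> 0 < eps ->
  exists n0, forall n, (n0 <= n)%N -> - n%:R <= t /\
    forall K, isint N (fun s => expR s *: X s) (- n%:R) t K ->
    N (K - expR t *: Z) < eps.
Proof.
move=> [J [hJ hZ]] e0.
pose m := (Num.truncn (expR t)).+1.
have m0 : 0 < m%:R :> R by [].
have [n1 h1] := ae_cvg_Nrv hZ (divr_gt0 e0 m0).
exists (maxn n1 (Num.truncn `|t|).+1) => n; rewrite geq_max => /andP[n1n n2n].
have nt : - n%:R <= t.
  have : `|t| <= n%:R by rewrite (le_trans (ltW (truncnS_gt _)))// ler_nat.
  by rewrite ler_norml => /andP[].
split => // K hK.
have hK' : isint N (fun s => expR s *: X s) (- n%:R) t (expR t *: J n).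
  have := isintZ NF (expR t) (hJ n nt).
  by apply: isint_ext => s _; rewrite scalerA -expRD opprB addrC subrK.
have := fnorm_dist NF K (expR t *: J n) (expR t *: Z).
rewrite (isint_unique NF nt hK hK') add0r => /le_lt_trans; apply.
rewrite -scalerBr; apply: (le_lt_trans (fnormZ_nat NF (n := m) _ _)).
  by rewrite ger0_norm ?expR_ge0// ltW// truncnS_gt.
by rewrite mulrC -ltr_pdivlMr//; exact: h1.
Qed.

Lemma exp_improper_unique t Z Z' : exp_improper t Z -> exp_improper t Z' ->
  N (Z - Z') = 0.
Proof.
move=> h h'; suff e : N (expR t *: Z - expR t *: Z') = 0.
  have -> : Z - Z' = expR (- t) *: (expR t *: Z - expR t *: Z').
    by rewrite -scalerBr scalerA -expRD addNr expR0 scale1r.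
  exact: (fnorm_eq0Z NF).
apply/eqP; rewrite eq_le (fnorm_ge0 NF) andbT; apply/ler_addgt0Pl => e e0; rewrite addr0.
have [|n1 h1] := exp_improper_approx (eps := e / 2) h; first lra.
have [|n2 h2] := exp_improper_approx (eps := e / 2) h'; first lra.
have [nt k1] := h1 _ (leq_maxl n1 n2); have [_ k2] := h2 _ (leq_maxr n1 n2).
have [K hK] := exp_integral_exists SI X01 nt.
have := fnorm_dist NF (expR t *: Z) K (expR t *: Z'); rewrite (fnormC NF _ K).
have := k1 K hK; have := k2 K hK; lra.
Qed.

Lemma exp_improper_increments (Z : R -> V) a b : (forall t, exp_improper t (Z t)) ->
  a <= b -> isint N (fun s => expR s *: X s) a b (expR b *: Z b - expR a *: Z a).
Proof.
move=> hZ ab; have [I hI] := exp_integral_exists SI X01 ab.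
apply: (isint_cvg NF _ hI).
apply/eqP; rewrite eq_le (fnorm_ge0 NF) andbT; apply/ler_addgt0Pl => e e0; rewrite addr0.
have [|n1 h1] := exp_improper_approx (eps := e / 2) (hZ a); first lra.
have [|n2 h2] := exp_improper_approx (eps := e / 2) (hZ b); first lra.
have [na k1] := h1 _ (leq_maxl n1 n2); have [nb k2] := h2 _ (leq_maxr n1 n2).
have [Ka hKa] := exp_integral_exists SI X01 na.
have hKb : isint N (fun s => expR s *: X s) (- (maxn n1 n2)%:R) b (Ka + I).
  by apply: (isint_cat NF _ hKa hI); rewrite na.
have := k1 _ hKa; have := k2 _ hKb.
have := fnormB NF (Ka + I - expR b *: Z b) (Ka - expR a *: Z a).
rewrite (_ : Ka + I - _ - (Ka - _) = I - (expR b *: Z b - expR a *: Z a)); last first.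
  by rewrite !opprB -(addrA Ka) [LHS]addrC [LHS]addrA subrK addrCA.
lra.
Qed.

End ImproperIntegrals.

(** * Stochastic continuity of measurable processes *)

Section TranslationContinuity.
Context {R : realType}.
Local Notation mu := (@lebesgue_measure R).
Local Notation T := (measurableTypeR R).

Lemma measurable_translation (h : R) : measurable_fun [set: T] (fun t : T => t + h : T).
Proof. by apply: measurable_funD; [exact: measurable_id|exact: measurable_cst]. Qed.

Lemma lebesgue_translation (h : R) (B : set T) : measurable B ->
  mu [set t | B (t + h)] = mu B.
Proof.
move=> mB.
pose f : {mfun T >-> T} := mfun_Sub (mem_set (measurable_translation h) : _ \in mfun).
transitivity (pushforward mu f B) => //.
apply/esym/lebesgue_measure_unique => //.
move=> _ [[a b]] _ <-.
have e : [set t | t + h \in `]a, b]] = `]a - h, b - h]%classic.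
  by apply/seteqP; split=> t; rewrite /= !in_itv /= ltrBlDr lerBrDr.
transitivity (mu `]a - h, b - h]%classic); last by rewrite -e.
rewrite !lebesgue_measure_itv /= !lte_fin ltrD2r; case: ifP => // _.
by rewrite -!EFinB; congr EFin; lra.
Qed.

(** Lusin gives a compact [K] on which [x] is continuous. Where both [t] and [t + h n] are in [K],
    dominated convergence applies; elsewhere the integrand is at most 1, on a set covered by [B] and
    its translate. *)
Lemma translation_cvg (x : R -> R) (h : nat -> R) eps :
  measurable_fun [set: T] x -> h n @[n --> \oo] --> 0 -> (forall n, `|h n| <= 1) ->
  0 < eps ->
  exists n0, forall n, (n0 <= n)%N ->
    (\int[mu]_(t in `[0%R, 1%R]) (Num.min `|x (t + h n)%R - x t| 1)%:E <= eps%:E)%E.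
Proof.
move=> mx h0 h1 e0.
(* Contains [t + h n] for every [t] in [[0, 1]], as [|h n| <= 1]. *)
pose E : set T := `[-1, 2]%classic.
have mE : measurable E by exact: measurable_itv.
have finE : (mu E < +oo)%E.
  by rewrite /E lebesgue_measure_itv /= ifT ?ltry// lte_fin; lra.
have e40 : 0 < eps / 4 by lra.
have [K [cK KE BK xK]] := measurable_almost_continuous mE finE e40 (measurable_funTS mx).
have mK : measurable K by apply: compact_measurable.
pose B := E `\` K; have mB : measurable B by exact: measurableD.
pose D : set T := `[0, 1]%classic.
have mD : measurable D by exact: measurable_itv.
have mxh n : measurable_fun [set: T] (fun t : T => x (t + h n)).
  exact: measurableT_comp mx (measurable_translation (h n)).
pose m n (t : T) : R := Num.min `|x (t + h n) - x t| 1.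
have mm n : measurable_fun [set: T] (m n).
  apply: measurable_minr; last exact: measurable_cst.
  by apply: measurableT_comp => //; exact: measurable_funB.
have m01 n t : 0 <= m n t <= 1.
  by rewrite /m le_min normr_ge0 ler01 ge_min lexx orbT.
have mi (C : set T) n : measurable C ->
    measurable_fun [set: T] (fun t : T => \1_C (t + h n) : R).
  move=> mC; apply: measurableT_comp (measurable_translation (h n)).
  exact: measurable_indic.
pose c n (t : T) : R := m n t * (\1_K t * \1_K (t + h n)).
have mc n : measurable_fun [set: T] (c n).
  apply: measurable_funM => //; apply: measurable_funM; last exact: mi.
  exact: measurable_indic.
have c01 n t : 0 <= c n t <= 1.
  have /andP[a1 a2] := m01 n t.
  by rewrite /c !indicE; case: (_ \in _); case: (_ \in _);
    rewrite /= ?mul1r ?mul0r ?mulr1 ?mulr0 ?lexx ?ler01 ?a1 ?a2.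
have hc : (\int[mu]_(t in D) (c n t)%:E)%E @[n --> \oo] --> 0%E.
  have k1 n : measurable_fun D (fun t => (c n t)%:E).
    by apply/measurable_EFinP; exact: measurable_funTS.
  have k2 : {ae mu, forall t, D t -> (c n t)%:E @[n --> \oo] --> cst 0%E t}.
    apply: aeW => t _ /=; have [Kt|nKt] := pselect (K t); last first.
      by apply: cvg_near_cst; apply: nearW => n; rewrite /c indicE memNset//= mul0r mulr0.
    apply/fine_cvgP; split; first exact: nearW.
    have /cvgrPdist_lt xt : x @ within K (nbhs t) --> x t.
      by move/subspace_continuousP : xK; exact.
    apply/cvgrPdist_lt => e e1.
    have /nbhs_ballP[dl /= d0 hd] := xt e e1.
    have /cvgrPdist_lt/(_ _ d0) := h0; apply: filterS => n hn /=.
    have /andP[a1 a2] := c01 n t; rewrite sub0r normrN ger0_norm//.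
    rewrite /c !indicE mem_set//= mul1r.
    case: (boolP (t + h n \in K)) => [/set_mem Kth|_]; last by rewrite mulr0.
    rewrite mulr1 /m gt_min; apply/orP; left; rewrite distrC; apply: hd => //=.
    by rewrite /ball /= opprD addrA subrr add0r normrN -[h n]subr0 distrC.
  have k3 : mu.-integrable D (cst 1%E).
    apply/integrableP; split; first exact: measurable_cst.
    under eq_integral do rewrite /= normr1.
    by rewrite integral_cst//= mul1e lebesgue_measure_itv /= ifT ?ltry// lte_fin.
  have k4 : {ae mu, forall t n, D t -> (`|(c n t)%:E| <= cst 1 t)%E}.
    apply: aeW => t n _; have /andP[a1 a2] := c01 n t.
    by rewrite /= lee_fin ger0_norm.
  have [_ _] := dominated_convergence mD k1 (measurable_cst _) k2 k3 k4.
  by rewrite integral_cst//= mul0e.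
have hB : (mu B <= (eps / 4)%:E)%E by exact: ltW.
have ib (C : set T) : measurable C -> (\int[mu]_(t in D) (\1_C t)%:E <= mu C)%E.
  by move=> mC; rewrite integral_indic// measureIl.
have hBh n : (\int[mu]_(t in D) (\1_B (t + h n)%R)%:E <= (eps / 4)%:E)%E.
  apply: le_trans hB; rewrite -(lebesgue_translation (h n) mB).
  have mBh : measurable ([set t | B (t + h n)] : set T).
    rewrite -[X in measurable X]setTI; exact: (measurable_translation (h n) measurableT mB).
  by apply: le_trans (ib _ mBh); rewrite le_eqVlt; apply/orP; left; apply/eqP.
have {}hc : exists n0, forall n, (n0 <= n)%N -> (\int[mu]_(t in D) (c n t)%:E <= (eps / 4)%:E)%E.
  have /fine_cvgP[[n1 _ f1] /cvgrPdist_lt/(_ _ e40)[n2 _ f2]] := hc.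
  exists (maxn n1 n2) => n; rewrite geq_max => /andP[/f1 /= g1 /f2 /= g2].
  rewrite -(fineK g1) lee_fin ltW//; move: g2; rewrite sub0r normrN.
  exact: le_lt_trans (ler_norm _).
have [n0 hn0] := hc; exists n0 => n /hn0 {}hn0.
have pw t : D t -> m n t <= c n t + (\1_B t + \1_B (t + h n)).
  rewrite /D /= in_itv /= => t01.
  have Et : E t by rewrite /E /= in_itv /=; lra.
  have Eth : E (t + h n).
    by rewrite /E /= in_itv /=; have := h1 n; rewrite ler_norml; lra.
  have /andP[a1 a2] := m01 n t; have /andP[c1 _] := c01 n t.
  have i0 (C : set T) (u : T) : 0 <= \1_C u :> R by rewrite indicE.
  have ib1 : B t -> m n t <= c n t + (\1_B t + \1_B (t + h n)).
    by move=> Bt; have := i0 B (t + h n); rewrite [\1_B t]indicE mem_set//=; lra.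
  have ib2 : B (t + h n) -> m n t <= c n t + (\1_B t + \1_B (t + h n)).
    by move=> Bt; have := i0 B t; rewrite [\1_B (t + h n)]indicE mem_set//=; lra.
  have [Kt|nKt] := pselect (K t); last exact: ib1.
  have [Kth|nKth] := pselect (K (t + h n)); last exact: ib2.
  have -> : c n t = m n t by rewrite /c !indicE !mem_set//= !mulr1.
  by rewrite lerDl addr_ge0.
apply: (@le_trans _ _ (\int[mu]_(t in D) ((c n t)%:E +
    ((\1_B t)%:E + (\1_B (t + h n)%R)%:E)))%E).
  apply: ge0_le_integral => //.
  - apply/measurable_EFinP; exact: (measurable_funTS (mm n)).
  - apply: emeasurable_funD; first by apply/measurable_EFinP; exact: measurable_funTS.
    apply: emeasurable_funD; apply/measurable_EFinP; apply: measurable_funTS.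
      exact: measurable_indic.
    exact: mi.
have mB1 : measurable_fun D (fun t : T => (\1_B t : R)%:E).
  by apply/measurable_EFinP; apply: measurable_funTS; exact: measurable_indic.
have mB2 : measurable_fun D (fun t : T => (\1_B (t + h n)%R : R)%:E).
  by apply/measurable_EFinP; apply: measurable_funTS; exact: mi.
rewrite ge0_integralD//; first last.
- exact: emeasurable_funD.
- by move=> t _; rewrite -EFinD lee_fin addr_ge0// indicE.
- by apply/measurable_EFinP; exact: measurable_funTS.
- by move=> t _; rewrite lee_fin; case/andP: (c01 n t).
rewrite ge0_integralD//.
apply: (le_trans (leeD hn0 (leeD (le_trans (ib _ mB) hB) (hBh n)))).
by rewrite -!EFinD lee_fin; lra.
Qed.

End TranslationContinuity.

Section StochasticContinuity.
Context {R : realType} {d : measure_display} {Omega : measurableType d}.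
Variable P : probability Omega R.
Local Notation V := {mfun Omega >-> R}.
Local Notation N := (@Nrv R d Omega P).
Let NF : fnorm N := fnorm_Nrv P.
Local Notation mu := (@lebesgue_measure R).
Local Notation T := (measurableTypeR R).
Variable X : R -> V.
Hypothesis SI : forall h, same_fdd P (incr X h) (incr X 0).
Hypothesis mX : measurable_fun [set: R * Omega] (fun p : R * Omega => X p.1 p.2).

Let D : set T := `[0, 1]%classic.
Let m (h : R) (p : T * Omega) : R :=
  Num.min `|X (p.1 + h) p.2 - X p.1 p.2| 1.

Let muD : mu D = 1%E.
Proof. by rewrite /D lebesgue_measure_itv /= lte_fin ltr01 oppr0 adde0. Qed.

Let m01 h p : 0 <= m h p <= 1.
Proof. by rewrite /m le_min normr_ge0 ler01 ge_min lexx orbT. Qed.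

Let measurable_m h : measurable_fun [set: T * Omega] (m h).
Proof.
apply: measurable_minr; last exact: measurable_cst.
apply: measurableT_comp => //; apply: measurable_funB; last exact: mX.
have : measurable_fun [set: T * Omega] (fun p : T * Omega => (p.1 + h : T, p.2)).
  apply/measurable_fun_pairP; split.
    exact: measurableT_comp (measurable_translation h) measurable_fst.
  exact: measurable_snd.
exact: measurableT_comp mX.
Qed.

Let f h (p : T * Omega) : \bar R := (m h p * \1_D p.1)%:E.

Let measurable_f h : measurable_fun [set: T * Omega] (f h).
Proof.
apply/measurable_EFinP; apply: measurable_funM => //.
apply: (measurableT_comp _ measurable_fst); apply: measurable_indic.
exact: measurable_itv.
Qed.

Let f0 h p : (0 <= f h p)%E.
Proof. by rewrite lee_fin mulr_ge0//; case/andP: (m01 h p). Qed.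

Let section_f h w : (\int[mu]_t f h (t, w) = \int[mu]_(t in D) (m h (t, w))%:E)%E.
Proof.
rewrite [RHS]integral_mkcond; apply: eq_integral => t _.
rewrite patchE /f indicE; case: (t \in D) => /=; by rewrite ?mulr1 ?mulr0.
Qed.

Lemma Nrv_incr_integral h :
  ((N (X h - X 0))%:E = \int[P]_w \int[mu]_(t in D) (m h (t, w))%:E)%E.
Proof.
under eq_integral do rewrite -section_f.
rewrite -(fubini_tonelli (m1 := mu) (m2 := P) (f h))//.
have E t : (\int[P]_w f h (t, w) = (N (X h - X 0))%:E * (\1_D t)%:E)%E.
  have tw := twin_incr P X t h 0.
  transitivity (\int[P]_w ((m h (t, w))%:E * (\1_D t)%:E))%E.
    by apply: eq_integral => w _; rewrite -EFinM.
  rewrite -(twin_Nrv (SI t) tw) NrvE ge0_integralZr//.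
  - congr (_ * _)%E; apply: eq_integral => w _; congr EFin.
    by rewrite /m /tmod add0r (addrC t).
  - apply/measurable_EFinP.
    exact: (measurableT_comp (measurable_m h) (pair1_measurable t)).
  - by move=> w _; rewrite lee_fin; case/andP: (m01 h (t, w)).
under eq_integral do rewrite E.
have mD : measurable D by exact: measurable_itv.
have mi : measurable_fun [set: T] (fun t => (\1_D t : R)%:E).
  by apply/measurable_EFinP; exact: measurable_indic.
have i0 t : [set: T] t -> (0 <= (\1_D t : R)%:E)%E by rewrite lee_fin indicE.
rewrite (ge0_integralZl_EFin mu measurableT i0 mi) ?(fnorm_ge0 NF)//.
by rewrite (integral_indic mu measurableT mD) setIT -[X in (_ * X)%E]/(mu D) muD mule1.
Qed.

Lemma measurable_incr_continuous eps : 0 < eps ->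
  exists2 delta, 0 < delta & forall h, `|h| < delta -> N (X h - X 0) < eps.
Proof.
(* Dominated convergence is sequential, so a sequence [h n] tending to 0 is extracted from the
   negation. *)
move=> e0; apply: contrapT => hno.
have bad n : exists h : R, `|h| < n.+1%:R^-1 /\ eps <= N (X h - X 0).
  apply: contrapT => hn; apply: hno; exists n.+1%:R^-1; first by rewrite invr_gt0.
  by move=> h hh; rewrite ltNge; apply/negP => he; apply: hn; exists h.
have [h hh] := choice bad.
have h1 n : `|h n| <= 1.
  by rewrite (le_trans (ltW (hh n).1))// invf_le1// ler1n.
have h0 : h n @[n --> \oo] --> 0.
  apply/cvgrPdist_lt => e e1; have /cvgrPdist_lt/(_ _ e1) := @cvg_harmonic R.
  apply: filterS => n; rewrite !sub0r !normrN; apply: le_lt_trans.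
  by rewrite (le_trans (ltW (hh n).1))// ler_norm.
pose F n w := (\int[mu]_(t in D) (m (h n) (t, w))%:E)%E.
have mD : measurable D by exact: measurable_itv.
have F0 n w : (0 <= F n w)%E.
  by apply: integral_ge0 => t _; rewrite lee_fin; case/andP: (m01 (h n) (t, w)).
have F1 n w : (F n w <= 1)%E.
  apply: (@le_trans _ _ (\int[mu]_(t in D) 1%:E)%E).
    apply: ge0_le_integral => //.
    - by move=> t _; rewrite lee_fin; case/andP: (m01 (h n) (t, w)).
    - apply/measurable_EFinP; apply: measurable_funTS.
      exact: (measurableT_comp (measurable_m (h n)) (pair2_measurable w)).
    - by move=> t _; rewrite lee_fin; case/andP: (m01 (h n) (t, w)).
  by rewrite integral_cst//= mul1e -[X in (X <= _)%E]/(mu D) muD.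
have mF n : measurable_fun [set: Omega] (F n).
  have := measurable_fun_fubini_tonelli_G (m1 := mu) (f (h n)) (measurable_f (h n)) (f0 (h n)).
  by apply: eq_measurable_fun => w _; rewrite /fubini_G section_f.
have cF : {ae P, forall w, setT w -> F n w @[n --> \oo] --> cst 0%E w}.
  apply: aeW => w _ /=; apply/fine_cvgP.
  have ff n : F n w \is a fin_num.
    by rewrite ge0_fin_numE// (le_lt_trans (F1 n w))// ltry.
  split; first exact: nearW.
  apply/cvgrPdist_lt => e e1.
  have e20 : 0 < e / 2 by lra.
  have mx : measurable_fun [set: T] (fun t => X t w).
    exact: (measurableT_comp mX (pair2_measurable w)).
  have [n0 hn0] := translation_cvg mx h0 h1 e20.
  exists n0 => // n /= /hn0 hn; rewrite sub0r normrN ger0_norm ?fine_ge0//.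
  by rewrite -lte_fin fineK// (le_lt_trans hn)// lte_fin; lra.
have iP : P.-integrable setT (cst 1%E) by exact: finite_measure_integrable_cst.
have bF : {ae P, forall w n, setT w -> (`|F n w| <= cst 1 w)%E}.
  by apply: aeW => w n _ /=; rewrite gee0_abs.
have [_ _] := dominated_convergence measurableT mF (measurable_cst _) cF iP bF.
rewrite integral_cst//= mul0e => /fine_cvgP[_ /cvgrPdist_lt/(_ _ e0)[n0 _ hn0]].
have := hn0 n0 (leqnn n0); rewrite /= -Nrv_incr_integral /= sub0r normrN.
rewrite ger0_norm ?(fnorm_ge0 NF)// ltNge; have [_ ->] := hh n0.
by [].
Qed.

Lemma measurable_stochastic_continuous t eps : 0 < eps ->
  exists2 delta, 0 < delta & forall s, `|s - t| < delta -> N (X s - X t) < eps.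
Proof.
move=> /measurable_incr_continuous[dl d0 hd]; exists dl => // s /hd.
have := twin_incr P X t (s - t) 0; rewrite subrK add0r => tw.
by rewrite (twin_Nrv (SI t) tw).
Qed.

End StochasticContinuity.

(** * The stationary solution *)

Lemma zmod_cancel_window (U : zmodType) (x y u v z : U) :
  x - y - (u - v) - (x - z) = v - y - (u - z).
Proof.
by rewrite !opprB -(addrA x) [LHS]addrC [LHS]addrA subrK [RHS]addrCA
  (addrA (- y)) (addrC (- y)).
Qed.

Lemma zmod_cancel (U : zmodType) (x y u z : U) :
  x - y - u - (x - z) = - y - (u - z).
Proof.
by rewrite !opprB -(addrA x) [LHS]addrC [LHS]addrA subrK [RHS]addrCA.
Qed.

Section LangevinStationarity.
Context {R : realType} {d : measure_display} {Omega : measurableType d}.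
Variable P : probability Omega R.
Local Notation V := {mfun Omega >-> R}.
Local Notation N := (@Nrv R d Omega P).
Let NF : fnorm N := fnorm_Nrv P.
Variable X : R -> V.
Hypothesis SI : forall h, same_fdd P (incr X h) (incr X 0).
Hypothesis X01 : Rm N X 0 1.
Hypothesis X00 : N (X 0) = 0.
Hypothesis X1log : ('E_P[fun w => (logp `|X 1 w|)%R] < +oo)%E.

Lemma expRN_nat_small (eta : R) : 0 < eta ->
  exists n0, forall n, (n0 <= n)%N -> expR (- n%:R) <= eta.
Proof.
move=> eta0; exists (Num.truncn eta^-1).+1 => n hn.
rewrite expRN -[leRHS]invrK lef_pV2 ?posrE ?expR_gt0 ?invr_gt0//.
apply: (@le_trans _ _ n%:R).
  by rewrite (le_trans (ltW (truncnS_gt _)))// ler_nat.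
by have := @expR_ge1Dx R n%:R; lra.
Qed.

Lemma scaled_X_small eps : 0 < eps ->
  exists n0, forall n, (n0 <= n)%N -> N (expR (- n%:R) *: X (- n%:R)) < eps.
Proof.
move=> e0.
have H : {ae P, forall w, (expR (- n%:R) *: X (- n%:R)) w @[n --> \oo] --> (0 : V) w}.
  apply: filterS (X_geometric_bound SI X00 X1log) => w [C C0 hC].
  have r1 : `|expR (- 2^-1) : R| < 1.
    by rewrite ger0_norm ?expR_ge0// expR_lt1 oppr_lt0.
  have /cvgrPdist_lt hg := cvg_geometric C r1.
  apply/cvgrPdist_lt => e e1; apply: filterS (hg e e1) => n.
  rewrite !sub0r !normrN; apply: le_lt_trans.
  rewrite -[X in `|X| <= _]/(expR (- n%:R) * X (- n%:R) w) normrM.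
  rewrite [X in X * _]ger0_norm ?expR_ge0//.
  apply: (@le_trans _ _ (expR (- n%:R) * (C * expR 2^-1 ^+ n))).
    by rewrite ler_wpM2l ?expR_ge0.
  rewrite /= mulrCA ger0_norm ?mulr_ge0 ?exprn_ge0 ?expR_ge0//.
  rewrite ler_wpM2l// -!expRM_natl -expRD ler_expR.
  by have := ler0n R n; lra.
have [n0 h] := ae_cvg_Nrv H e0; exists n0 => n /h.
by rewrite subr0.
Qed.

(** The increment part of the window integral has the F-norm of [expR (- n%:R) *: K] with [K] fixed,
    by equality of laws; the part carrying [X (- n%:R)] is small by its geometric bound. *)
Lemma window_small tau eps : 0 <= tau -> 0 < eps ->
  exists n0, forall n, (n0 <= n)%N -> forall L,
    isint N (fun s => expR s *: X s) (- n%:R) (tau - n%:R) L -> N L < eps.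
Proof.
move=> tau0 e0; have e20 : 0 < eps / 2 by lra.
have [K hK] : exists K, isint N (fun t => expR t *: (X t - X 0)) 0 tau K.
  have [I hI] := exp_integral_exists SI X01 tau0.
  exists (I - (expR tau - expR 0) *: X 0).
  apply: isint_ext (isintB NF hI (isint_expC NF (X 0) tau0)) => t _.
  by rewrite scalerBr.
have [eta eta0 hK'] := fnorm_absorb NF K e20.
have [n1 h1] := expRN_nat_small eta0.
pose m := (Num.truncn `|expR tau - 1|).+1.
have m0 : 0 < m%:R :> R by [].
have [n2 h2] := scaled_X_small (divr_gt0 e20 m0).
exists (maxn n1 n2) => n; rewrite geq_max => /andP[/h1 n1n /h2 n2n] L hL.
have [Xi hXi tw] := exp_integral_shift SI X01 (- n%:R) tau0 hK.
have nt : - n%:R <= tau - n%:R by rewrite lerDr.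
have e1 := isint_unique NF nt hL hXi.
have := fnorm_dist0 NF L (expR (- n%:R) *: (Xi + (expR tau - 1) *: X (- n%:R))).
rewrite e1 add0r => /le_lt_trans; apply.
rewrite scalerDr (scalerA (expR _)) (mulrC (expR (- _))) -scalerA.
apply: (le_lt_trans (fnorm_triangle NF _ _)).
have b1 : N (expR (- n%:R) *: Xi) < eps / 2.
  rewrite (twin_Nrv (SI (- n%:R)) (twinZ (expR (- n%:R)) tw)).
  by apply: hK'; rewrite ger0_norm ?expR_ge0.
have b2 : N ((expR tau - 1) *: (expR (- n%:R) *: X (- n%:R))) < eps / 2.
  apply: (le_lt_trans (fnormZ_nat NF (n := m) _ _)); first exact/ltW/truncnS_gt.
  by rewrite mulrC -ltr_pdivlMr.
lra.
Qed.

Lemma exp_improper_approx_scaled t Z eps : exp_improper P X t Z -> 0 < eps ->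
  exists n0, forall n, (n0 <= n)%N -> - n%:R <= t /\
    forall K, isint N (fun s => expR s *: X s) (- n%:R) t K ->
    N (expR (- t) *: K - Z) < eps.
Proof.
move=> hZ e0; pose m := (Num.truncn (expR (- t))).+1.
have m0 : 0 < m%:R :> R by [].
have [n0 h] := exp_improper_approx hZ (divr_gt0 e0 m0).
exists n0 => n /h[nt hK]; split => // K /hK {}hK.
have -> : expR (- t) *: K - Z = expR (- t) *: (K - expR t *: Z).
  by rewrite scalerBr scalerA -expRD addNr expR0 scale1r.
apply: (le_lt_trans (fnormZ_nat NF (n := m) _ _)).
  by rewrite ger0_norm ?expR_ge0//; exact/ltW/truncnS_gt.
by rewrite mulrC -ltr_pdivlMr.
Qed.

(* The kernel e^{-(t-s)} has total mass 1 on ]-oo, t], so in the limit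
   c --> -oo the integral below is X_t - Z_t, a function of the increments of X
   only. *)
Lemma isint_kernel c t K : c <= t ->
  isint N (fun s => expR s *: X s) c t K ->
  isint N (fun s => expR (- (t - s)) *: (X t - X s)) c t
    ((1 - expR (c - t)) *: X t - expR (- t) *: K).
Proof.
move=> ct hK.
have h1 := isintZ NF (expR (- t)) (isintB NF (isint_expC NF (X t) ct) hK).
have -> : (1 - expR (c - t)) *: X t - expR (- t) *: K =
    expR (- t) *: ((expR t - expR c) *: X t - K).
  by rewrite scalerBr scalerA mulrBr -!expRD addNr expR0 (addrC (- t)).
apply: isint_ext h1 => s _; rewrite -scalerBr scalerA -expRD.
by rewrite opprB addrC.
Qed.

(** The kernel integrals over [[-n, t]] and over its translate by [tau] are twins. Three errors
    separate the translated one from its limit: the improper tail, the window between [-n] and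
    [-n + tau], and the missing kernel mass [k] times [X (t + tau)]. *)
Lemma langevin_twin (Z : R -> V) t tau : 0 <= tau ->
  (forall t, exp_improper P X t (Z t)) ->
  twin P (incr X tau) (incr X 0) (X (t + tau) - Z (t + tau)) (X t - Z t).
Proof.
move=> tau0 hZ; apply: twin_lim => e e0; have e30 : 0 < e / 3 by lra.
have [n1 h1] := exp_improper_approx_scaled (hZ t) e30.
have [n2 h2] := exp_improper_approx_scaled (hZ (t + tau)) e30.
have [eta1 eta10 k1] := fnorm_absorb NF (X t) e30.
have [eta2 eta20 k2] := fnorm_absorb NF (X (t + tau)) e30.
(* The missing mass is [k = expR (- n%:R) * expR (- t)], hence the factor [expR t]. *)
pose eta := Num.min eta1 eta2 * expR t.
have eta0 : 0 < eta by rewrite mulr_gt0 ?expR_gt0// lt_min eta10.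
have [n3 h3] := expRN_nat_small eta0.
pose m := (Num.truncn (expR (- (t + tau)))).+1.
have m0 : 0 < m%:R :> R by [].
have [n4 h4] := window_small tau0 (divr_gt0 e30 m0).
pose n := maxn (maxn n1 n2) (maxn n3 n4).
have [|nt a1] := h1 n; first by rewrite /n !leq_max leqnn.
have [|nt2 a2] := h2 n; first by rewrite /n !leq_max leqnn !orbT.
have {}h3 : expR (- n%:R) <= eta by apply: h3; rewrite /n !leq_max leqnn !orbT.
have /h4 {}h4 : (n4 <= n)%N by rewrite /n !leq_max leqnn !orbT.
have [K2 hK2] := exp_integral_exists SI X01 nt.
have [K1 hK1] := exp_integral_exists SI X01 nt2.
have nn : - n%:R <= tau - n%:R by rewrite lerDr.
have [L hL] := exp_integral_exists SI X01 nn.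
have nt3 : - n%:R + tau <= t + tau by rewrite lerD2r.
have hL' : isint N (fun s => expR s *: X s) (- n%:R) (- n%:R + tau) L by rewrite addrC.
have hK3 : isint N (fun s => expR s *: X s) (- n%:R + tau) (t + tau) (K1 - L).
  apply: (isint_sub NF _ hL' hK1); last exact: (exp_integral_exists SI X01 nt3).
  by rewrite nt3 lerDl tau0.
have c1 := isint_kernel nt3 hK3.
have c2 := isint_kernel nt hK2.
pose k := expR (- n%:R - t).
have kE : expR (- n%:R + tau - (t + tau)) = k by congr expR; lra.
rewrite kE in c1.
have ks : `|k| <= Num.min eta1 eta2.
  rewrite ger0_norm ?expR_ge0// /k expRD -ler_pdivlMr ?expR_gt0//.
  by rewrite -expRN opprK.
move: ks; rewrite le_min => /andP[ks1 ks2].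
exists ((1 - k) *: X (t + tau) - expR (- (t + tau)) *: (K1 - L)),
  ((1 - k) *: X t - expR (- t) *: K2); split.
- apply: (twin_isint nt _ c1 c2) => s _.
  have -> : expR (- (t + tau - (s + tau))) = expR (- (t - s)) by congr expR; lra.
  by apply: twinZ; exact: twin_incr.
- have -> : (1 - k) *: X (t + tau) - expR (- (t + tau)) *: (K1 - L) -
      (X (t + tau) - Z (t + tau)) =
      expR (- (t + tau)) *: L - k *: X (t + tau) -
      (expR (- (t + tau)) *: K1 - Z (t + tau)).
    rewrite scalerBl scale1r scalerBr.
    exact: zmod_cancel_window.
  have b1 := k2 k ks2.
  have b2 : N (expR (- (t + tau)) *: L) < e / 3.
    apply: (le_lt_trans (fnormZ_nat NF (n := m) _ _)).
      by rewrite ger0_norm ?expR_ge0//; exact/ltW/truncnS_gt.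
    by rewrite mulrC -ltr_pdivlMr//; exact: h4.
  have b3 := a2 _ hK1.
  have := fnormB NF (expR (- (t + tau)) *: L - k *: X (t + tau))
    (expR (- (t + tau)) *: K1 - Z (t + tau)).
  have := fnormB NF (expR (- (t + tau)) *: L) (k *: X (t + tau)); lra.
- have -> : (1 - k) *: X t - expR (- t) *: K2 - (X t - Z t) =
      - (k *: X t) - (expR (- t) *: K2 - Z t).
    rewrite scalerBl scale1r.
    exact: zmod_cancel.
  have b1 := k1 k ks1; have b3 := a1 _ hK2.
  have := fnormB NF (- (k *: X t)) (expR (- t) *: K2 - Z t).
  rewrite (fnormN NF); lra.
Qed.

End LangevinStationarity.

(** * The two halves of the theorem *)

Lemma zmod_increments (U : zmodType) (y z y0 h k x w : U) :
  y - z + (h - k) - (x - w) = w - (z - y0 + k) - (x - (y - y0 + h)).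
Proof.
have -> : w - (z - y0 + k) - (x - (y - y0 + h)) =
    (w - x) + ((y - y0 + h) - (z - y0 + k)).
  by rewrite (opprB x) [LHS]addrACA [RHS]addrACA; congr (_ + _); exact: addrC.
rewrite opprB [LHS]addrC; congr (_ + _).
by rewrite opprD [RHS]addrACA; congr (_ + _); rewrite opprB addrA subrK.
Qed.

(** * Oriented integrals and the two directions *)

Section OrientedIntegrals.
Context {R : realType} {d : measure_display} {Omega : measurableType d}.
Variable P : probability Omega R.
Local Notation V := {mfun Omega >-> R}.
Local Notation N := (@Nrv R d Omega P).
Let NF : fnorm N := fnorm_Nrv P.
Variable Y : R -> {RV P >-> R}.

Lemma oriented_int_ge0 t (I : {RV P >-> R}) : 0 <= t ->
  oriented_int (fun=> 1) Y t I <-> isint N (fun s => Y s : V) 0 t I.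
Proof.
move=> t0; rewrite /oriented_int t0; apply: (iff_trans (Riemann_intP _ _ _ _ _)).
by split; apply: isint_ext => s _; rewrite scale1r.
Qed.

Lemma oriented_int_lt0 t (I : {RV P >-> R}) : t < 0 ->
  oriented_int (fun=> 1) Y t I <-> isint N (fun s => Y s : V) t 0 (- (I : V)).
Proof.
move=> t0; rewrite /oriented_int leNgt t0 /=.
apply: (iff_trans (Riemann_intP _ _ _ _ (- (I : V)))).
by split; apply: isint_ext => s _; rewrite scale1r.
Qed.

Hypothesis hY : forall a b, a <= b -> exists I, isint N (fun s => Y s : V) a b I.

Lemma oriented_int_exists t : exists I : {RV P >-> R}, oriented_int (fun=> 1) Y t I.
Proof.
have [t0|t0] := leP 0 t.
  by have [I hI] := hY t0; exists I; apply/oriented_int_ge0.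
have [I hI] := hY (ltW t0); exists (- I : V); apply/oriented_int_lt0 => //.
by rewrite opprK.
Qed.

Lemma oriented_int_unique t (I J : {RV P >-> R}) :
  oriented_int (fun=> 1) Y t I -> oriented_int (fun=> 1) Y t J ->
  N ((I : V) - J) = 0.
Proof.
have [t0|t0] := leP 0 t.
  move=> /(oriented_int_ge0 _ t0) h1 /(oriented_int_ge0 _ t0) h2.
  exact: (isint_unique NF t0 h1 h2).
move=> /(oriented_int_lt0 _ t0) h1 /(oriented_int_lt0 _ t0) h2.
have := isint_unique NF (ltW t0) h1 h2.
by rewrite -opprD (fnormN NF).
Qed.

Lemma oriented_int_increment (H : R -> V) a b :
  (forall t, oriented_int (fun=> 1) Y t (H t : {RV P >-> R})) -> a <= b ->
  isint N (fun s => Y s : V) a b (H b - H a).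
Proof.
move=> hH ab; have [a0|a0] := leP 0 a.
  have /(oriented_int_ge0 _ a0) h1 := hH a.
  have /(oriented_int_ge0 _ (le_trans a0 ab)) h2 := hH b.
  by apply: (isint_sub NF _ h1 h2 (hY ab)); rewrite a0.
have /(oriented_int_lt0 _ a0) h1 := hH a.
have [b0|b0] := leP 0 b.
  have /(oriented_int_ge0 _ b0) h2 := hH b.
  by rewrite addrC; apply: (isint_cat NF _ h1 h2); rewrite (ltW a0).
have /(oriented_int_lt0 _ b0) h2 := hH b.
have [J hJ] := hY ab; apply: (isint_cvg NF _ hJ).
have ab0 : a <= b <= 0 by rewrite ab (ltW b0).
have := isint_unique NF (ltW a0) (isint_cat NF ab0 hJ h2) h1.
by rewrite opprK opprB addrA addrAC.
Qed.

End OrientedIntegrals.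

Section Converse.
Context {R : realType} {d : measure_display} {Omega : measurableType d}.
Variable P : probability Omega R.
Local Notation V := {mfun Omega >-> R}.
Local Notation N := (@Nrv R d Omega P).
Let NF : fnorm N := fnorm_Nrv P.

Lemma converse (Y : R -> {RV P >-> R}) :
  stationary Y ->
  (forall s t : R, s < t -> in_Rm s t Y) ->
  (forall t : R, defines_L0 P (X_of_Y Y t)) /\
  (forall X : R -> {RV P >-> R},
     (forall t : R, X_of_Y Y t (X t)) ->
     stationary_increments X /\ {ae P, forall w, X 0 w = 0}).
Proof.
move=> hst hRm.
have hY a b : a <= b -> exists I, isint N (fun s => Y s : V) a b I.
  rewrite le_eqVlt => /predU1P[->|ab]; first by exists 0; exact: isint_refl.
  have /in_RmP hR := hRm a b ab; have [I hI] := hR _ (Dminus_cst a b 1).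
  by exists I; apply: isint_ext hI => t _; rewrite scale1r.
split.
  move=> t; split.
    have [I hI] := oriented_int_exists hY t.
    exists ((Y t : V) - (Y 0 : V) + (I : V)); exists I; split => //.
    exact: aeW.
  move=> y z [I [hI yI]] [J [hJ zJ]].
  have /ae_eq_Nrv IJ := oriented_int_unique hI hJ.
  apply: filterS3 yI zJ IJ => w -> -> ->; reflexivity.
move=> X hX; have [H hH] := choice hX.
have hH1 t := (hH t).1; have hH2 t := (hH t).2.
have XE t : N ((X t : V) - ((Y t : V) - (Y 0 : V) + (H t : V))) = 0.
  by apply/ae_eq_Nrv; exact: hH2.
have hinc a b := @oriented_int_increment _ _ _ P Y hY H a b hH1.
split; last first.
  have /(oriented_int_ge0 _ _ (lexx 0)) h0 := hH1 0.
  have := isint_unique NF (lexx 0) h0 (isint_refl NF _ 0); rewrite subr0 => /Nrv_eq0 H0.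
  by apply: filterS2 H0 (hH2 0) => w hw ->; rewrite hw subrr addr0.
move=> h.
pose U t : V := Y (t + h); pose W t : V := Y t.
have UW : same_fdd P U W by exact: hst.
pose U' (p : R * R) : V := (X (p.1 + h) : V) - (X (p.2 + h) : V).
pose W' (p : R * R) : V := (X p.1 : V) - (X p.2 : V).
suff : same_fdd P U' W' by [].
apply: (fdd_twin UW) => -[a b]; rewrite /U' /W' /=.
have tw a' b' : a' <= b' -> twin P U W (H (b' + h) - H (a' + h)) (H b' - H a').
  move=> ab; have ab' : a' + h <= b' + h by rewrite lerD2r.
  by apply: (twin_isint ab _ (hinc _ _ ab') (hinc _ _ ab)) => t _; exact: twin_gen.
have {}tw : twin P U W (H (a + h) - H (b + h)) (H a - H b).
  (* Integrals are taken over ordered intervals, so the other orientation is recovered through the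
     scalar -1. *)
  have [ab|/ltW ba] := leP a b; last exact: tw.
  have := twinZ (-1) (tw a b ab).
  by rewrite !scaleN1r !opprB.
have gen t : twin P U W (Y (t + h) : V) (Y t : V) by exact: (twin_gen P U W t).
have tY := twinD (twinB (gen a) (gen b)) tw.
(* [Y 0] cancels in increments, which are then almost surely functions of [Y] at two times and of
   one integral. *)
have Eq s t : N ((Y s : V) - (Y t : V) + ((H s : V) - (H t : V)) -
    ((X s : V) - (X t : V))) = 0.
  apply/eqP; rewrite eq_le (fnorm_ge0 NF) andbT.
  have -> : (Y s : V) - (Y t : V) + ((H s : V) - (H t : V)) - ((X s : V) - (X t : V)) =
      ((X t : V) - ((Y t : V) - (Y 0 : V) + (H t : V))) -
      ((X s : V) - ((Y s : V) - (Y 0 : V) + (H s : V))).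
    exact: zmod_increments.
  by rewrite (le_trans (fnormB NF _ _))// !XE addr0.
by apply: (twin_eq (P := P) _ _ tY); exact: Eq.
Qed.

End Converse.

Section Direct.
Context {R : realType} {d : measure_display} {Omega : measurableType d}.
Variable P : probability Omega R.
Local Notation V := {mfun Omega >-> R}.
Local Notation N := (@Nrv R d Omega P).
Let NF : fnorm N := fnorm_Nrv P.

Lemma stationary_incr (X : R -> {RV P >-> R}) : stationary_increments X ->
  forall h, same_fdd P (incr (fun t => X t : V) h) (incr (fun t => X t : V) 0).
Proof.
move=> hX h.
have -> : incr (fun t => X t : V) 0 = fun p => (X p.1 : V) - (X p.2 : V).
  by apply/funext => p; rewrite /incr !addr0.
exact: hX.
Qed.

Lemma improper_intP (X : R -> {RV P >-> R}) t (Z : {RV P >-> R}) :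
  improper_int (fun s => expR (- (t - s))) X t Z <->
  exp_improper P (fun t => X t : V) t Z.
Proof.
by split=> -[J [hJ hZ]]; exists J; split => // n /hJ /Riemann_intP.
Qed.

Lemma direct (X : R -> {RV P >-> R}) :
  measurable_process X ->
  stationary_increments X ->
  {ae P, forall w, X 0 w = 0} ->
  in_Rm 0 1 X ->
  (exists I : {RV P >-> R},
     Riemann_int (fun t : R => expR t) X 0 1 I /\
     ('E_P[fun w => (logp `|I w|)%R] < +oo)%E) ->
  ('E_P[fun w => (logp `|X 1 w|)%R] < +oo)%E ->
  (forall t : R, defines_L0 P (Y_of_X X t)) /\
  (forall Y : R -> {RV P >-> R},
     (forall t : R, Y_of_X X t (Y t)) ->
     [/\ stationary Y,
         stochastically_continuous Y,
         (forall s t : R, s < t -> in_Rm s t Y) &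
         (forall t : R, X_of_Y Y t (X t))]).
Proof.
move=> mX /stationary_incr SI X0 /in_RmP X01 [K1 [/Riemann_intP K1int K1log]] X1log.
pose Xv t : V := X t.
have X00 : N (Xv 0) = 0 by apply/Nrv_eq0.
split.
  move=> t; split.
    have [Z hZ] := exp_improper_exists SI X01 X00 K1int K1log X1log t.
    exists (Xv t - Z); exists Z; split; first exact/improper_intP.
    exact: aeW.
  move=> y z [I [/improper_intP hI yI]] [J [/improper_intP hJ zJ]].
  have /ae_eq_Nrv IJ := exp_improper_unique SI X01 hI hJ.
  by apply: filterS3 yI zJ IJ => w -> -> ->.
move=> Y hY; have [Z hZ] := choice hY.
have hI t : exp_improper P Xv t (Z t) by apply/improper_intP; case: (hZ t).
pose Zv t : V := Z t; pose Yv t : V := Y t.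
have YE t : N (Yv t - (Xv t - Zv t)) = 0.
  by apply/ae_eq_Nrv; case: (hZ t).
(* This primitive of [expR s *: Xv s] turns the improper integrals into an instance of the abstract
   Langevin argument. *)
pose G t := expR t *: Zv t.
have ZG t : expR (- t) *: G t = Zv t by rewrite scalerA -expRD addNr expR0 scale1r.
have hX a b : a <= b -> Rm N Xv a b by exact: (Rm_all SI X01).
have hG a b : a <= b -> isint N (fun s => expR s *: Xv s) a b (G b - G a).
  exact: (exp_improper_increments SI X01 hI).
have RmZ a b : a <= b -> Rm N Zv a b.
  move=> ab; have := Langevin_Rm NF hX hG ab.
  by rewrite (_ : (fun t => expR (- t) *: G t) = Zv)//; apply/funext.
have idZ a b : a <= b -> isint N Yv a b (Zv b - Zv a).
  move=> ab; have := Langevin_identity NF hX hG ab; rewrite !ZG.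
  by apply: (isint_near_eq NF) => t _; rewrite ZG (fnormC NF).
split.
- have tw tau : 0 <= tau -> same_fdd P (fun t => Yv (t + tau)) Yv.
    move=> tau0; apply: (fdd_twin (SI tau)) => t.
    apply: (twin_eq (P := P) _ _ (langevin_twin SI X01 X00 X1log t tau0 hI)).
      by rewrite (fnormC NF).
    by rewrite (fnormC NF).
  (* For negative [tau], the positive shift [- tau] is applied to the times [t i + tau]. *)
  move=> tau; have [tau0|/ltW tau0] := leP 0 tau; first exact: tw.
  have {}tw := tw (- tau); rewrite oppr_ge0 in tw.
  move=> n t A mA; have := tw tau0 n (fun i => t i + tau) A mA.
  rewrite (_ : (fun w => _) = (fun w => [tuple Y (t i) w | i < n])).
    by move=> ->.
  by apply/funext => w; apply: eq_from_tnth => i; rewrite !tnth_mktuple addrK.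
- move=> t.
  have -> : (fun s => Fnorm P (fun w => Y s w - Y t w)) = EFin \o (fun s => N (Yv s - Yv t)).
    by apply/funext => s /=; rewrite -FnormE.
  suff h : N (Yv s - Yv t) @[s --> t] --> (0 : R) by apply: cvg_comp h _; exact: cvg_id.
  apply/cvgrPdist_lt => e e0; have e20 : 0 < e / 2 by lra.
  have [d1 d10 h1] := measurable_stochastic_continuous SI mX t e20.
  have [d2 d20 h2] := Langevin_continuous NF hG t e20.
  apply/nbhs_ballP; exists (Num.min d1 d2) => /=; first by rewrite lt_min d10.
  move=> s; rewrite /ball /= distrC lt_min => /andP[/h1 b1 /h2 b2].
  rewrite sub0r normrN ger0_norm ?(fnorm_ge0 NF)//.
  rewrite !ZG in b2.
  have := fnorm_dist NF (Yv s) (Xv s - Zv s) (Yv t); rewrite YE add0r.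
  have := fnorm_dist NF (Xv s - Zv s) (Xv t - Zv t) (Yv t).
  rewrite (fnormC NF (Xv t - Zv t)) YE addr0.
  have := fnormB NF (Xv s - Xv t) (Zv s - Zv t).
  rewrite (_ : Xv s - Xv t - (Zv s - Zv t) = Xv s - Zv s - (Xv t - Zv t)); last first.
    by rewrite !opprB [LHS]addrACA [RHS]addrACA; congr (_ + _); exact: addrC.
  lra.
- move=> a b /ltW ab; apply/in_RmP => phi hphi.
  have [I1 hI1] := hX _ _ ab _ hphi; have [I2 hI2] := RmZ _ _ ab _ hphi.
  exists (I1 - I2); apply: (isint_near_eq NF) (isintB NF hI1 hI2) => t _.
  by rewrite -!scalerBr (fnorm_eq0Z NF)// (fnormC NF).
(* By the Langevin identity the integral of [Y] from 0 to [t] is the increment of [Z], so the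
   right-hand side collapses to [X t - X 0], where [X 0] is almost surely 0. *)
- move=> t; exists (Zv t - Zv 0); split.
    have [t0|t0] := leP 0 t.
      by apply/oriented_int_ge0 => //; exact: idZ.
    by apply/oriented_int_lt0 => //; rewrite opprB; exact/idZ/ltW.
  have /ae_eq_Nrv ht := YE t; have /ae_eq_Nrv h0 := YE 0.
  apply: filterS3 X0 ht h0 => w x0 yt y0.
  rewrite -[LHS]/(Xv t w) -[X in X - _ + _]/(Yv t w) -[X in _ - X + _]/(Yv 0 w) yt y0.
  rewrite -[X in X - _ + _]/(Xv t w - Zv t w) -[X in _ - X + _]/(Xv 0 w - Zv 0 w).
  rewrite -[X in _ + X]/(Zv t w - Zv 0 w) [Xv 0 w]x0; lra.
Qed.

End Direct.

Theorem theorem2p2 (R : realType) (d : measure_display)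
    (Omega : measurableType d) (P : probability Omega R) :
  (forall X : R -> {RV P >-> R},
    measurable_process X ->
    stationary_increments X ->
    {ae P, forall w, X 0 w = 0} ->
    in_Rm 0 1 X ->
    (exists I : {RV P >-> R},
       Riemann_int (fun t : R => expR t) X 0 1 I /\
       ('E_P[fun w => (logp `|I w|)%R] < +oo)%E) ->
    ('E_P[fun w => (logp `|X 1 w|)%R] < +oo)%E ->
    (forall t : R, defines_L0 P (Y_of_X X t)) /\
    (forall Y : R -> {RV P >-> R},
       (forall t : R, Y_of_X X t (Y t)) ->
       [/\ stationary Y,
           stochastically_continuous Y,
           (forall s t : R, s < t -> in_Rm s t Y) &
           (forall t : R, X_of_Y Y t (X t))])) /\
  (forall Y : R -> {RV P >-> R},
    stationary Y ->
    (forall s t : R, s < t -> in_Rm s t Y) ->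
    (forall t : R, defines_L0 P (X_of_Y Y t)) /\
    (forall X : R -> {RV P >-> R},
       (forall t : R, X_of_Y Y t (X t)) ->
       stationary_increments X /\ {ae P, forall w, X 0 w = 0})).
Proof. by split=> [X|Y]; [exact: direct|exact: converse]. Qed.
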